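(* Let $\mu_0\neq\mu_1$ be two Hölder Gibbs probabilities on $\Omega=\{1,\dots,d\}^{\mathbb{N}}$ with Hölder Jacobians $J_0,J_1$. In the Min-Max hypotheses test (described in the context) the best choice of $E$ is $E=0$. Moreover, the best decay rate for minimizing the probability of wrong decisions is given by $e^{nr}$, where $r<0$ is the minimum value of the pressure function $$P_1(t)=P\left(t(\log J_0-\log J_1)+\log J_1\right),\qquad t\in\mathbb{R}.$$ The value of $r$ is given by $$r=h(\mu)+\int\log J_1\,d\mu,$$ where $\mu$ is a Gibbs probability measure satisfying $\int(\log J_0-\log J_1)\,d\mu=0$, namely the equilibrium probability of $t_0(\log J_0-\log J_1)+\log J_1$, with $t_0$ the point where $P_1'(t_0)=0$.
   Context: Let $\sigma:\Omega\to\Omega$, $\sigma(b_0,b_1,b_2,\dots)=(b_1,b_2,\dots)$, be the shift on $\Omega=\{1,\dots,d\}^{\mathbb{N}}$ (with its product topology and a usual compatible metric, to which Hölder continuity refers). For a Hölder function $A:\Omega\to\mathbb{R}$ the pressure is $P(A)=\sup_{\nu}\{\int A\,d\nu+h(\nu)\}$, the supremum over $\sigma$-invariant probabilities $\nu$, where $h(\nu)$ is the Shannon–Kolmogorov entropy; the unique probability attaining it is the equilibrium probability of $A$. A Hölder Jacobian is a function $J>0$ on $\Omega$ with $\log J$ Hölder and $\sum_{a=1}^d J(a,b_0,b_1,\dots)=1$ for all $(b_0,b_1,\dots)\in\Omega$; then $P(\log J)=0$, and the equilibrium probability of $\log J$ is the Hölder Gibbs probability with Jacobian $J$. Hypotheses: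 $H_j$ ($j=0,1$) says that the process is described by $\mu_j$, with Jacobian $J_j$. Put $$S_n(y)=\frac1n\sum_{i=0}^{n-1}\log\frac{J_0(\sigma^i(y))}{J_1(\sigma^i(y))},\qquad P_j(t)=P\left(t(\log J_0-\log J_1)+\log J_j\right)\quad(j=0,1),$$ and $c^-=\inf_t P_1'(t)<0<c^+=\sup_t P_1'(t)$. A test is given by a monotone sequence $u_n$ converging to a limit $E$ with $c^-<E<c^+$; one announces $H_1$ if $S_n<u_n$ and $H_0$ if $S_n>u_n$. Only the limit $E$ is regarded as relevant. The quantity $\mu_1(S_n>u_n)$ is associated with the wrong decision of announcing $H_0$ when $H_1$ is true, and $\mu_0(S_n\le u_n)$ with the wrong decision of announcing $H_1$ when $H_0$ is true. Write $a_n\sim e^{-nc}$ when $\lim_n\frac1n\log a_n=-c$. Large deviation theory gives $$\mu_1(S_n>u_n)\sim e^{-C_1(E)\,n},\qquad \mu_0(S_n\le u_n)\sim e^{-C_0(E)\,n},$$ with $C_1(E)=\inf\{I_1(x):x\ge 0\}$, $C_0(E)=\inf\{I_0(x):x\le 0\}$ and $I_j(x)=\sup_t[t(x+E)-P_j(t)]$. Min-Max hypotheses test: wrong decisions carry constant losses $y_1$ (weighting $\mu_1(S_n>u_n)$) and $y_0$ (weighting $\mu_0(S_n\le u_n)$). For each $E$ one considers the asymptotics of the maximum of $y_1\,\mu_1(S_n>u_n)\sim y_1e^{-C_1(E)n}$ and $y_0\,\mu_0(S_n\le u_n)\sim y_0e^{-C_0(E)n}$, and one seeks the $E$ minimizing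 this maximal cost of wrong decisions. Values of $E$ for which $C_0(E)$ or $C_1(E)$ is not positive are discarded, and the best $E$ is sought as the minimum point of the function $E\mapsto\max\{C_0(E),C_1(E)\}$ over the remaining $E$. The best decay rate $e^{nr}$ refers to this min-max value, $\min\max\{y_1\mu_1(S_n>u_n),\,y_0\mu_0(S_n\le u_n)\}\sim e^{nr}$. *)

(* Defs.v *)
From HB Require Import structures.
From mathcomp Require Import all_boot all_order all_algebra.
From mathcomp Require Import all_classical all_reals all_analysis.
Import Order.TTheory GRing.Theory Num.Theory.
Import numFieldNormedType.Exports.

Set Implicit Arguments.
Unset Strict Implicit.
Unset Printing Implicit Defensive.

Local Open Scope classical_set_scope.
Local Open Scope ring_scope.

(* Measurable types are pointed in the library, hence inhabited: the alphabet
   is 'I_d.+1, with d.+1 letters. *)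
Definition seq_space (d : nat) :=
  prod_topology (fun _ : nat => discrete_topology 'I_d.+1).

HB.instance Definition _ (d : nat) := Topological.copy (seq_space d)
  (prod_topology (fun _ : nat => discrete_topology 'I_d.+1)).
HB.instance Definition _ (d : nat) :=
  isPointed.Build (seq_space d) (fun=> ord0).

(* Sequences with the Borel sigma-algebra of the product topology. *)
Definition Omega (d : nat) := g_sigma_algebraType (@open (seq_space d)).

HB.instance Definition _ (d : nat) := Measurable.copy (Omega d)
  (g_sigma_algebraType (@open (seq_space d))).

Definition seq_shift (d : nat) (b : Omega d) : Omega d := fun n => b n.+1.

Definition cons_letter (d : nat) (a : 'I_d.+1) (b : Omega d) : Omega d :=
  fun n => if n is m.+1 then b m else a.

Section Thermodynamics.
Context {R : realType} {d : nat}.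
Implicit Types (A J K : Omega d -> R) (nu mu : probability (Omega d) R).

(* Equal to 2^-N, with N the first index at which x and y differ, and to 0 if
   x = y. *)
Definition seq_dist (x y : Omega d) : R :=
  sup (range (fun n : nat => (x n != y n)%:R * 2 ^- n)).

Definition holder A : Prop :=
  exists C alpha : R, [/\ 0 < alpha, alpha <= 1 &
    forall x y, `|A x - A y| <= C * seq_dist x y `^ alpha].

Definition invariant nu : Prop :=
  forall B : set (Omega d), measurable B -> nu (@seq_shift d @^-1` B) = nu B.

(* A finite measurable partition is given by its labelling xi. This is the
   entropy of the join of its first n preimages under the shift; 0 * ln 0 = 0
   since ln 0 = 0. *)
Definition join_entropy nu (k : nat) (xi : Omega d -> 'I_k) (n : nat) : R :=
  \sum_(w : {ffun 'I_n -> 'I_k})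
    let p := fine (nu [set x | forall i : 'I_n, xi (iter i (@seq_shift d) x) = w i])
    in - (p * ln p).

Definition partition_entropy nu (k : nat) (xi : Omega d -> 'I_k) : R :=
  lim (n%:R^-1 * join_entropy nu xi n @[n --> \oo]).

Definition entropy nu : \bar R :=
  ereal_sup [set e | exists (k : nat) (xi : Omega d -> 'I_k),
    (forall j, measurable (xi @^-1` [set j])) /\
    e = (partition_entropy nu xi)%:E].

Definition free_energy A nu : \bar R :=
  (\int[nu]_x (A x)%:E + entropy nu)%E.

Definition pressure A : \bar R := ereal_sup (free_energy A @` invariant).

Definition equilibrium A nu : Prop :=
  invariant nu /\ free_energy A nu = pressure A.

(* Equality of probabilities: the values of nu outside the sigma-algebra carry
   no meaning, so Leibniz equality of the records would be too fine. *)
Definition same_probability mu nu : Prop :=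
  forall B : set (Omega d), measurable B -> mu B = nu B.

Definition holder_jacobian J : Prop :=
  [/\ forall x, 0 < J x, holder (fun x => ln (J x)) &
      forall b, \sum_(a < d.+1) J (cons_letter a b) = 1].

Definition gibbs J mu : Prop :=
  holder_jacobian J /\ equilibrium (fun x => ln (J x)) mu.

Section HypothesisTest.
Context (J0 J1 : Omega d -> R).

Definition tilt K (t : R) (x : Omega d) : R :=
  t * (ln (J0 x) - ln (J1 x)) + ln (K x).

Definition tilted_pressure K (t : R) : R := fine (pressure (tilt K t)).

Definition P0 : R -> R := tilted_pressure J0.
Definition P1 : R -> R := tilted_pressure J1.

Definition mean_llr (n : nat) (y : Omega d) : R :=
  n%:R^-1 *
  \sum_(i < n) ln (J0 (iter i (@seq_shift d) y) / J1 (iter i (@seq_shift d) y)).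

Definition rate_function (P : R -> R) (E x : R) : \bar R :=
  ereal_sup (range (fun t : R => (t * (x + E) - P t)%:E)).

Definition C0 (E : R) : \bar R :=
  ereal_inf (rate_function P0 E @` [set x | x <= 0]).
Definition C1 (E : R) : \bar R :=
  ereal_inf (rate_function P1 E @` [set x | 0 <= x]).

Definition c_minus : \bar R :=
  ereal_inf (range (fun t : R => (derive1 P1 t)%:E)).
Definition c_plus : \bar R :=
  ereal_sup (range (fun t : R => (derive1 P1 t)%:E)).

Definition admissible (E : R) : Prop :=
  [/\ (c_minus < E%:E)%E, (E%:E < c_plus)%E, (0 < C0 E)%E & (0 < C1 E)%E].

Definition max_cost mu0 mu1 (y0 y1 : R) (u : R^nat) (n : nat) : \bar R :=
  maxe (y1%:E * mu1 [set y | (u n < mean_llr n y)%R])%E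
       (y0%:E * mu0 [set y | (mean_llr n y <= u n)%R])%E.

(* For every test with limit E, the maximal cost of wrong decisions is
   ~ e^(n rho). The extended logarithm lne 0 = -oo is used, so that a vanishing
   cost does not count as a cost equal to 1. *)
Definition cost_rate mu0 mu1 (y0 y1 E rho : R) : Prop :=
  forall u : R^nat, nondecreasing_seq u \/ nonincreasing_seq u ->
    u @ \oo --> E ->
    ((n%:R^-1)%:E * lne (max_cost mu0 mu1 y0 y1 u n))%E @[n --> \oo]
      --> rho%:E.

End HypothesisTest.
End Thermodynamics.

(* Main.v *)
(* A potential whose variations decay geometrically is studied through its
   transfer operator. Averaging with a regular kernel contracts oscillations
   measured with suitable weights. Applied to the ratios of consecutive
   iterates of the operator, this yields a positive eigenfunction, hence a
   cohomologous normalised potential B, and then an invariant mean, realised as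
   a measure m by cutting [0, 1[ into nested intervals. On cylinders m is
   comparable to exp of the Birkhoff sums of B; so the entropy of m is minus
   the integral of B, and comparing the law of an itinerary with m smeared by
   a noise kernel shows that no invariant probability has more entropy relative
   to B. The pressure is therefore the logarithm of the eigenvalue, whose
   first-order perturbation gives the derivative of the pressure and the
   uniqueness of equilibria.

   On the line t psi + log J1, with psi = log J0 - log J1, equality in a
   subgradient inequality of the pressure P between two parameters would make
   Birkhoff sums of psi boundedly close to a constant multiple of n, and then
   mu0 = mu1. Hence P is strictly convex; as P(0) = P(1) = 0, its minimum r < 0
   is attained at some t0 in ]0, 1[. The admissible E are slopes E = P'(t) with
   0 < t < 1, and there C1(E) = t E - P(t) and C0(E) = C1(E) - E, so that
   max(C0, C1) is smallest at E = 0. The decay of the wrong decisions follows by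
   comparing Gibbs measures at two parameters on cylinders: Chernoff's bound
   from above, and tilting to a slope close to E from below. *)
Require Import Defs.
From HB Require Import structures.
From mathcomp Require Import all_boot all_order all_algebra.
From mathcomp Require Import all_classical all_reals all_analysis.
From mathcomp Require Import measurable_realfun.
From mathcomp Require Import ring lra.
Import Order.TTheory GRing.Theory Num.Theory.
Import numFieldNormedType.Exports.
Set Implicit Arguments.
Unset Strict Implicit.
Unset Printing Implicit Defensive.
Local Open Scope classical_set_scope.
Local Open Scope ring_scope.

(** Hölder functions are handled through geometric variations at one common rate [th], so that every
    estimate has an explicit constant and the eigenfunction is a geometric limit, with no
    compactness or fixed-point argument. Two points with n common letters share only a fraction
    exp(-K th^n) of the kernel weights, and the remaining mass forgets the agreement altogether; the
    weights of the oscillations answer exactly this trade-off. Both families of pressures are one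
    function, since P0(t) = P1(t + 1): mu1 sits at t = 0 and mu0 at t = 1, which is why t0 falls
    between them. The entropy is a supremum over all finite measurable partitions of a limit not
    known to exist. The upper bound must hold for each partition, whereas convergence is needed only
    for the first-letter partition under a Gibbs measure, where the Gibbs bounds give it directly.
    The maximal cost has the rate -min(C0, C1), which is a different criterion from max(C0, C1).
    Both select E = 0: there C0 = C1 = -r, and any other admissible E pushes one of the constants
    above -r and the other below. *)

Section Agreement.
Context {R : realType} {d : nat}.
Implicit Types (x y z : Omega d) (a : 'I_d.+1) (n k : nat) (f g A : Omega d -> R).
Local Notation shift := (@seq_shift d).

Definition agree n x y := forall i, (i < n)%N -> x i = y i.

Lemma agree0 x y : agree 0 x y. Proof. by []. Qed.

Lemma agree_sym n x y : agree n x y -> agree n y x.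
Proof. by move=> h i /h. Qed.

Lemma agree_trans n x y z : agree n x y -> agree n y z -> agree n x z.
Proof. by move=> h1 h2 i hi; rewrite h1 ?h2. Qed.

Lemma agreeW n k x y : (n <= k)%N -> agree k x y -> agree n x y.
Proof. by move=> nk h i ni; apply: h; exact: leq_trans nk. Qed.

Lemma agree_cons n a x y : agree n x y ->
  agree n.+1 (cons_letter a x) (cons_letter a y).
Proof. by move=> h [|i] //= ?; exact: h. Qed.

Lemma agree_shift n x y : agree n.+1 x y -> agree n (shift x) (shift y).
Proof. by move=> h i hi; apply: h. Qed.

Lemma shift_cons a x : shift (cons_letter a x) = x.
Proof. exact: funext. Qed.

Lemma cons_shift x : cons_letter (x 0%N) (shift x) = x.
Proof. by apply: funext => -[]. Qed.

Lemma iter_shiftE n x : iter n shift x = fun i => x (n + i)%N.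
Proof.
elim: n x => [|n IH] x; first by apply: funext.
by rewrite iterS IH; apply: funext => i; rewrite /seq_shift addnS.
Qed.

Lemma agree_iter_shift n k x y : agree (n + k) x y ->
  agree k (iter n shift x) (iter n shift y).
Proof. by move=> h i hi; rewrite !iter_shiftE h// ltn_add2l. Qed.

(** Hölder continuity in the metric 2^-N, an exponent alpha corresponding to th = 2^-alpha. The case
    n = 0 bounds the total oscillation by [K], so regular functions are bounded. *)
Definition regular (th K : R) f :=
  forall n x y, agree n x y -> `|f x - f y| <= K * th ^+ n.

Lemma regularW th K K' f : 0 <= th -> K <= K' -> regular th K f -> regular th K' f.
Proof.
by move=> th0 KK' h n x y /h/le_trans; apply; rewrite ler_wpM2r// exprn_ge0.
Qed.

Lemma regular_ge0 th K f : regular th K f -> 0 <= K.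
Proof.
move=> h; have := h 0%N point point (agree0 _ _).
by rewrite subrr normr0 expr0 mulr1.
Qed.

Lemma regular_cst th c : regular th 0 (fun=> c).
Proof. by move=> n x y _; rewrite subrr normr0 mul0r. Qed.

Lemma regularD th K L f g : regular th K f -> regular th L g ->
  regular th (K + L) (fun x => f x + g x).
Proof.
move=> hf hg n x y xy; rewrite mulrDl opprD addrACA.
by rewrite (le_trans (ler_normD _ _))// lerD ?hf ?hg.
Qed.

Lemma regularZ th K s f : regular th K f -> regular th (`|s| * K) (fun x => s * f x).
Proof. by move=> hf n x y xy; rewrite -mulrBr normrM -mulrA ler_wpM2l// hf. Qed.

Lemma regularN th K f : regular th K f -> regular th K (fun x => - f x).
Proof. by move=> hf n x y xy; rewrite -opprD normrN hf. Qed.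

Lemma regularB th K L f g : regular th K f -> regular th L g ->
  regular th (K + L) (fun x => f x - g x).
Proof. by move=> hf hg; apply: regularD => //; exact: regularN. Qed.

(* Composition with the shift loses one coordinate of agreement, hence the
   factor 1/th. *)
Lemma regular_shift th K f : 0 < th -> th < 1 -> regular th K f ->
  regular th (K / th) (f \o shift).
Proof.
move=> th0 th1 hf [|n] x y xy /=.
  rewrite (le_trans (hf 0%N _ _ (agree0 _ _)))// ler_wpM2r//.
  by rewrite ler_pdivlMr// ler_piMr ?(regular_ge0 hf)// ltW.
by rewrite (le_trans (hf n _ _ (agree_shift xy)))// exprS mulrA divfK// gt_eqF.
Qed.

Lemma regular_bound th K f x : regular th K f -> `|f x| <= `|f point| + K.
Proof.
move=> hf; have := hf 0%N x point (agree0 _ _); rewrite expr0 mulr1.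
have := ler_normD (f x - f point) (f point); rewrite subrK; lra.
Qed.

Definition birk n A x : R := \sum_(i < n) A (iter i shift x).

Lemma birk0 A x : birk 0 A x = 0. Proof. by rewrite /birk big_ord0. Qed.

Lemma birkS n A x : birk n.+1 A x = A x + birk n A (shift x).
Proof.
rewrite /birk big_ord_recl; congr (_ + _).
by apply: eq_bigr => i _; rewrite -iterSr.
Qed.

Lemma birkD n f g x : birk n (fun z => f z + g z) x = birk n f x + birk n g x.
Proof. exact: big_split. Qed.

Lemma birkZ n s f x : birk n (fun z => s * f z) x = s * birk n f x.
Proof. by rewrite /birk mulr_sumr. Qed.

Lemma birk_coboundary n g x :
  birk n (fun z => g z - g (shift z)) x = g x - g (iter n shift x).
Proof.
elim: n x => [|n IH] x; first by rewrite birk0 subrr.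
by rewrite birkS IH -iterSr addrA subrK.
Qed.

End Agreement.

(** * Contraction of oscillations by averaging kernels *)

Section Contraction.
Context {R : realType}.

Lemma expR_quadratic (x : R) : `|x| <= 1 / 2 -> `|expR x - 1 - x| <= 2 * x ^+ 2.
Proof.
rewrite ler_norml => /andP[x1 x2]; rewrite ler_norml; apply/andP; split.
  by have := expR_ge1Dx x; have := sqr_ge0 x; lra.
have h : expR x * (1 - x) <= 1.
  rewrite -[leRHS](_ : expR x * expR (- x) = 1); last by rewrite -expRD subrr expR0.
  by rewrite ler_wpM2l ?expR_ge0//; exact: expR_ge1Dx.
have h2 : expR x <= (1 - x)^-1 by rewrite -ler_pdivlMr ?mul1r // in h; lra.
have h3 : (1 - x)^-1 - 1 - x = x ^+ 2 * (1 - x)^-1 by field; lra.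
have h4 : (1 - x)^-1 <= 2.
  by rewrite -[leRHS]invrK lef_pV2 ?posrE; lra.
have := ler_wpM2l (sqr_ge0 x) h4; lra.
Qed.

Lemma one_sub_expRN_ge (x : R) : 0 <= x -> x / (1 + x) <= 1 - expR (- x).
Proof.
move=> x0; have h : expR (- x) <= (1 + x)^-1.
  by rewrite expRN lef_pV2 ?posrE ?expR_gt0 ?expR_ge1Dx//; lra.
have -> : x / (1 + x) = 1 - (1 + x)^-1 by field; lra.
lra.
Qed.

(** With D = C / (1 - r), the sequence u - D r^k is nondecreasing and u + D r^k nonincreasing. The
    supremum of the former lies between the two, which gives the limit and its error bound at
    once. *)
Lemma geometric_cvg (u : nat -> R) (C r : R) : 0 < r -> r < 1 ->
  (forall k, `|u k.+1 - u k| <= C * r ^+ k) ->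
  exists l, forall k, `|u k - l| <= C / (1 - r) * r ^+ k.
Proof.
move=> r0 r1 hu; set D := C / (1 - r).
have hD : D * (1 - r) = C by rewrite /D divfK//; lra.
have C0 : 0 <= C by have := hu 0%N; rewrite expr0 mulr1; apply: le_trans.
have D0 : 0 <= D by rewrite divr_ge0//; lra.
have step k : C * r ^+ k = D * r ^+ k - D * r ^+ k.+1 by rewrite -hD exprS; ring.
pose a k := u k - D * r ^+ k; pose b k := u k + D * r ^+ k.
have incr : nondecreasing_seq a.
  apply/nondecreasing_seqP => k; rewrite /a.
  by have := hu k; rewrite step ler_norml; lra.
have decr : nonincreasing_seq b.
  apply/nonincreasing_seqP => k; rewrite /b.
  by have := hu k; rewrite step ler_norml; lra.
have ab k : a k <= b k.
  by rewrite /a /b; have := mulr_ge0 D0 (exprn_ge0 k (ltW r0)); lra.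
have abj j k : a j <= b k.
  have [jk|kj] := leqP j k; first exact: le_trans (incr _ _ jk) (ab k).
  exact: le_trans (ab j) (decr _ _ (ltnW kj)).
have sa : has_sup (range a).
  split; first by exists (a 0%N); exists 0%N.
  by exists (b 0%N) => _ [j _ <-].
exists (sup (range a)) => k.
have h1 : a k <= sup (range a) by apply: ub_le_sup; [exact: sa.2|exists k].
have h2 : sup (range a) <= b k.
  by apply: ge_sup; [exact: sa.1|move=> _ [j _ <-]].
by rewrite ler_norml; move: h1 h2; rewrite /a /b; lra.
Qed.

(* The common part [e q] of the two weights is coupled along the diagonal. *)
Lemma coupling (k : nat) (p q u v : 'I_k -> R) (e D V : R) :
  (forall a, 0 <= q a) -> \sum_a p a = 1 -> \sum_a q a = 1 ->
  0 <= e -> (forall a, e * q a <= p a) ->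
  (forall a, u a - v a <= D) -> (forall a b, u a - v b <= V) ->
  \sum_a p a * u a - \sum_a q a * v a <= e * D + (1 - e) * V.
Proof.
move=> q0 sp sq e0 epq huv hV; set m := \sum_a q a * v a.
have um a : u a <= m + V.
  have -> : m + V = \sum_b q b * (v b + V).
    rewrite /m; under [RHS]eq_bigr do rewrite mulrDr.
    by rewrite big_split/= -mulr_suml sq mul1r.
  have -> : u a = \sum_b q b * u a by rewrite -mulr_suml sq mul1r.
  by apply: ler_sum => b _; rewrite ler_wpM2l//; have := hV a b; lra.
have h1 : \sum_a (p a - e * q a) * u a <= (1 - e) * (m + V).
  have -> : (1 - e) * (m + V) = \sum_a (p a - e * q a) * (m + V).
    by rewrite -mulr_suml sumrB sp -mulr_sumr sq mulr1.
  by apply: ler_sum => a _; rewrite ler_wpM2l ?um ?subr_ge0.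
have h2 : \sum_a q a * u a <= m + D.
  have -> : m + D = \sum_b q b * (v b + D).
    rewrite /m; under [RHS]eq_bigr do rewrite mulrDr.
    by rewrite big_split/= -mulr_suml sq mul1r.
  by apply: ler_sum => b _; rewrite ler_wpM2l//; have := huv b; lra.
have -> : \sum_a p a * u a = \sum_a (p a - e * q a) * u a + e * \sum_a q a * u a.
  rewrite mulr_sumr -big_split/=; apply: eq_bigr => a _; ring.
have := ler_wpM2l e0 h2; lra.
Qed.

Variables (th K : R).
Hypotheses (th0 : 0 < th) (th1 : th < 1) (K0 : 0 <= K).

Lemma onem_rate_gt0 : 0 < 1 - th. Proof. by rewrite subr_gt0. Qed.

Lemma one_plus_gt0 : 0 < 1 + K. Proof. by rewrite ltr_wpDr. Qed.

#[local] Hint Resolve onem_rate_gt0 one_plus_gt0 : core.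

(** The exponent is the sum of K th^k over k >= n: this is the product of all the one-step shares
    exp(-K th^k) from n on. *)
Definition retain n : R := expR (- (K / (1 - th) * th ^+ n)).

Lemma retain_gt0 n : 0 < retain n.
Proof. exact: expR_gt0. Qed.

(* Weights for which one step of averaging is a strict contraction: [retain n]
   is the limit of the coupled mass when starting from n common letters. *)
Definition osc_weight n : R := 1 - retain n + retain 0 / 2 * th ^+ n.

(** The two candidates are the contraction factors of the two parts of [osc_weight]: the first for 1
    - [retain n], and [th] for the geometric term. *)
Definition osc_rate : R := Num.max (1 - retain 0 / 2 * ((1 - th) / (1 + K))) th.

Lemma osc_rate_bounds : 0 < osc_rate /\ osc_rate < 1.
Proof.
rewrite /osc_rate lt_max th0 orbT gt_max th1 andbT; split => //.
by rewrite gtrBl !mulr_gt0 ?invr_gt0 ?retain_gt0.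
Qed.

Lemma retainS n : retain n = expR (- (K * th ^+ n)) * retain n.+1.
Proof.
rewrite /retain -expRD; congr expR; rewrite exprS; field.
by rewrite subr_eq0 eq_sym lt_eqF.
Qed.

Lemma retain_le1 n : retain n <= 1.
Proof.
by rewrite -[leRHS]expR0 ler_expR oppr_le0 mulr_ge0 ?exprn_ge0 ?mulr_ge0 ?invr_ge0// ltW.
Qed.

(** Write p = exp(-K th^n) and eta = [retain 0] / 2, so that [osc_weight 0] = 1 - eta. By [retainS]
    the left side is 1 - [retain n] + p eta th^(n+1) - (1 - p) eta. The gain (1 - p) eta is a fixed
    proportion of 1 - [retain n], and the geometric term shrinks by [th]. *)
Lemma osc_weight_step n :
  expR (- (K * th ^+ n)) * osc_weight n.+1 + (1 - expR (- (K * th ^+ n))) * osc_weight 0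
  <= osc_rate * osc_weight n.
Proof.
rewrite /osc_weight expr0 mulr1 exprS.
set p := expR _; set e := retain n; set e1 := retain n.+1; set eta := retain 0 / 2.
have ep : e = p * e1 by rewrite /e /p /e1 -retainS.
have eta0 : 0 < eta by rewrite divr_gt0 ?expR_gt0.
have e01 : retain 0 = 2 * eta by rewrite /eta mulrCA divff ?mulr1.
have e1' : e <= 1 := retain_le1 n.
have tn : 0 <= th ^+ n by rewrite exprn_ge0// ltW.
have tn1 : th ^+ n <= 1 by rewrite exprn_ile1// ltW.
have p1 : p <= 1 by rewrite -[leRHS]expR0 ler_expR oppr_le0 mulr_ge0.
set c := (1 - th) / (1 + K).
have c0 : 0 <= c by rewrite divr_ge0// ltW.
have pc : c * (1 - e) <= 1 - p.
  set x := K * th ^+ n.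
  have x0 : 0 <= x by rewrite mulr_ge0.
  have xK : x <= K by rewrite /x ler_piMr.
  have h1 : 1 - e <= x / (1 - th).
    have := expR_ge1Dx (- (K / (1 - th) * th ^+ n)); rewrite -/(retain n) -/e /x.
    by rewrite mulrAC; lra.
  have h2 : c * (1 - e) <= x / (1 + K).
    apply: (le_trans (ler_wpM2l c0 h1)); rewrite /c le_eqVlt; apply/orP; left.
    by apply/eqP; field; rewrite !gt_eqF.
  apply: (le_trans h2); apply: le_trans (one_sub_expRN_ge x0).
  by rewrite ler_wpM2l// lef_pV2 ?posrE; lra.
rewrite e01.
have r1 : 1 - eta * c <= osc_rate by rewrite /osc_rate le_max lexx.
have r2 : th <= osc_rate by rewrite /osc_rate le_max lexx orbT.
have g1 := ler_wpM2l (ltW eta0) pc.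
have g2 : (1 - eta * c) * (1 - e) <= osc_rate * (1 - e).
  by rewrite ler_wpM2r//; lra.
have g3 : th * (eta * th ^+ n) <= osc_rate * (eta * th ^+ n).
  by rewrite ler_wpM2r// mulr_ge0// ltW.
have g4 : p * (eta * (th * th ^+ n)) <= eta * (th * th ^+ n).
  by apply: ler_piMl p1; apply: mulr_ge0 (ltW eta0) (mulr_ge0 (ltW th0) tn).
rewrite mulrDr; lra.
Qed.

Variable (d : nat).
Implicit Types (x y : Omega d).

Definition kernel_regular (p : 'I_d.+1 -> Omega d -> R) :=
  [/\ forall a x, 0 <= p a x, forall x, \sum_a p a x = 1 &
      forall a n x y, agree n x y -> expR (- (K * th ^+ n)) * p a y <= p a x].

(** Induction on k through [coupling]: with mass exp(-K th^n) both points receive the same letter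
    and agree on n + 1 letters; with the remaining mass no agreement is assumed. The geometric term
    of [osc_weight] serves the base case, where th^n must be dominated even if K = 0. *)
Lemma osc_iter (p : nat -> 'I_d.+1 -> Omega d -> R) (h : nat -> Omega d -> R) (W : R) :
  (forall k, kernel_regular (p k)) ->
  (forall k x, h k.+1 x = \sum_a p k a x * h k (cons_letter a x)) ->
  regular th W (h 0%N) ->
  forall k n x y, agree n x y ->
    h k x - h k y <= W / (retain 0 / 2) * osc_rate ^+ k * osc_weight n.
Proof.
move=> hp hh h0; set N := W / _.
have eta0 : 0 < retain 0 / 2 by rewrite divr_gt0 ?expR_gt0.
have N0 : 0 <= N by rewrite divr_ge0 ?(regular_ge0 h0)// ltW.
have [r0 r1] := osc_rate_bounds.
elim=> [|k IH] n x y xy.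
  rewrite expr0 mulr1; have := h0 _ _ _ xy.
  have -> : W * th ^+ n = N * (retain 0 / 2 * th ^+ n).
    by rewrite /N mulrA divfK// gt_eqF.
  move=> /(le_trans (ler_norm _))/le_trans; apply; rewrite ler_wpM2l// /osc_weight.
  by have := retain_le1 n; lra.
have [p0 p1 pe] := hp k.
rewrite !hh; apply: (@le_trans _ _ (expR (- (K * th ^+ n)) *
   (N * osc_rate ^+ k * osc_weight n.+1) +
   (1 - expR (- (K * th ^+ n))) * (N * osc_rate ^+ k * osc_weight 0))).
  apply: coupling => //.
  - by move=> a; apply: pe.
  - by move=> a; apply: IH; exact: agree_cons.
  - by move=> a b; apply: IH; exact: agree0.
rewrite exprSr [leRHS](_ : _ = N * osc_rate ^+ k * (osc_rate * osc_weight n)); last by ring.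
have := fun h => ler_wpM2l (h : 0 <= N * osc_rate ^+ k) (osc_weight_step n).
move=> /(_ (mulr_ge0 N0 (exprn_ge0 k (ltW r0)))); lra.
Qed.

(** The oscillation of [h k] decays geometrically, and [h k.+1 x - h k x] is an average of
    differences of values of [h k], so the functions converge uniformly, to a constant. *)
Lemma kernel_cvg (p : nat -> 'I_d.+1 -> Omega d -> R) (h : nat -> Omega d -> R) (W : R) :
  (forall k, kernel_regular (p k)) ->
  (forall k x, h k.+1 x = \sum_a p k a x * h k (cons_letter a x)) ->
  regular th W (h 0%N) ->
  exists l C r, [/\ 0 < r, r < 1, 0 <= C & forall k x, `|h k x - l| <= C * r ^+ k].
Proof.
move=> hp hh h0; have H := osc_iter hp hh h0.
have [r0 r1] := osc_rate_bounds; set r := osc_rate in H r0 r1 *.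
set C := W / (retain 0 / 2) * osc_weight 0.
have C0 : 0 <= C.
  have := H 0%N 0%N point point (agree0 _ _); by rewrite subrr expr0 mulr1.
have H0 k x y : `|h k x - h k y| <= C * r ^+ k.
  rewrite ler_norml lerNl opprB /C mulrAC; apply/andP.
  by split; apply: H; exact: agree0.
have dif k x : `|h k.+1 x - h k x| <= C * r ^+ k.
  have [p0 p1 _] := hp k.
  have -> : h k.+1 x - h k x = \sum_a p k a x * (h k (cons_letter a x) - h k x).
    rewrite hh; under [RHS]eq_bigr do rewrite mulrBr.
    by rewrite sumrB -mulr_suml p1 mul1r.
  apply: (le_trans (ler_norm_sum _ _ _)).
  have -> : C * r ^+ k = \sum_a p k a x * (C * r ^+ k) by rewrite -mulr_suml p1 mul1r.
  by apply: ler_sum => a _; rewrite normrM (ger0_norm (p0 _ _)) ler_wpM2l.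
have [l hl] := geometric_cvg r0 r1 (fun k => dif k point).
exists l, (C + C / (1 - r)), r; split=> //.
  by rewrite addr_ge0// divr_ge0//; lra.
move=> k x; rewrite mulrDl -(subrK (h k point) (h k x)) -addrA.
exact: le_trans (ler_normD _ _) (lerD (H0 _ _ _) (hl _)).
Qed.

End Contraction.

(** * The transfer operator and its positive eigenfunction *)

Section TransferOperator.
Context {R : realType} {d : nat}.
Implicit Types (x y : Omega d) (a : 'I_d.+1) (n k : nat) (f g A F G : Omega d -> R).

Lemma geometric_small (C r e : R) : 0 < r -> r < 1 -> 0 < e ->
  exists k, C * r ^+ k <= e.
Proof.
move=> r0 r1 e0.
have h : (fun k => C * r ^+ k) @ \oo --> C * 0.
  by apply: cvgMr; apply: cvg_expr; rewrite ger0_norm// ltW.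
have : \forall k \near \oo, C * r ^+ k <= e.
  by apply: (cvgr_le _ h); rewrite mulr0.
by case=> N _ hN; exists N; apply: hN => /=.
Qed.

Lemma le_geometric (a b C r : R) : 0 < r -> r < 1 ->
  (forall k, a <= b + C * r ^+ k) -> a <= b.
Proof.
move=> r0 r1 h; apply/ler_addgt0Pr => e e0.
have [k hk] := geometric_small C r0 r1 e0.
by rewrite (le_trans (h k))// lerD2l.
Qed.

(** Logarithm of the transfer operator acting on exponentials: for F = A + g it is ln of the
    operator of A applied to exp g. In this form it is monotone and commutes with adding
    constants. *)
Definition log_tr F x : R := ln (\sum_(a < d.+1) expR (F (cons_letter a x))).

Lemma sum_letters_gt0 (u : 'I_d.+1 -> R) : (forall a, 0 < u a) -> 0 < \sum_a u a.
Proof.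
move=> h; rewrite (bigD1 ord0)//= ltr_wpDr// sumr_ge0// => a _; exact: ltW.
Qed.

Lemma log_trK F x : expR (log_tr F x) = \sum_(a < d.+1) expR (F (cons_letter a x)).
Proof. by rewrite lnK// posrE sum_letters_gt0// => a; rewrite expR_gt0. Qed.

Lemma log_tr_le F G x y e :
  (forall a, F (cons_letter a x) <= G (cons_letter a y) + e) ->
  log_tr F x <= log_tr G y + e.
Proof.
move=> h; rewrite -ler_expR expRD !log_trK mulr_suml ler_sum// => a _.
by rewrite -expRD ler_expR.
Qed.

Lemma log_tr_add F x (e : R) : log_tr (fun y => F y + e) x = log_tr F x + e.
Proof.
apply/eqP; rewrite eq_le log_tr_le//=.
by rewrite -lerBrDr log_tr_le// => a; rewrite addrK.
Qed.

(** Prepending a letter gains one coordinate of agreement, hence the factor [th]; monotonicity and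
    commutation with constants ensure that the logarithm of the sum loses nothing. *)
Lemma regular_log_tr th K F : regular th K F -> regular th (K * th) (log_tr F).
Proof.
move=> hF n x y xy; have xy' a := agree_cons a xy.
have h z w a : agree n z w ->
    F (cons_letter a z) <= F (cons_letter a w) + K * th * th ^+ n.
  move=> /(agree_cons a)/hF/(le_trans (ler_norm _)); rewrite exprS mulrA.
  by rewrite lerBlDl.
rewrite ler_norml lerNl opprB !lerBlDl; apply/andP; split; apply: log_tr_le => a.
  by apply: h; exact: agree_sym.
exact: h.
Qed.

Lemma expR_sub_le (s t : R) : expR s - expR t <= expR s * (s - t).
Proof.
have := ler_wpM2l (expR_ge0 s) (expR_ge1Dx (t - s)).
by rewrite -expRD [s + (t - s)]addrCA subrr addr0; lra.
Qed.

Lemma regular_expR th K F : 0 <= th -> regular th K F ->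
  regular th (expR (`|F point| + K) * K) (fun x => expR (F x)).
Proof.
move=> th0 hF.
have h n x y : agree n x y ->
    expR (F x) - expR (F y) <= expR (`|F point| + K) * K * th ^+ n.
  move=> xy; apply: (le_trans (expR_sub_le _ _)).
  apply: (@le_trans _ _ (expR (F x) * (K * th ^+ n))).
    by rewrite ler_wpM2l ?expR_ge0// (le_trans (ler_norm _))// hF.
  rewrite mulrA ler_wpM2r ?exprn_ge0// ler_wpM2r ?(regular_ge0 hF)// ler_expR.
  exact: le_trans (ler_norm _) (regular_bound _ hF).
move=> n x y xy; rewrite ler_norml lerNl opprB !h//; exact: agree_sym.
Qed.

Lemma ln_lipschitz (s t e : R) : expR e <= expR s -> expR e <= expR t ->
  `|s - t| <= expR (- e) * `|expR s - expR t|.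
Proof.
have h u v : expR e <= expR u -> v - u <= expR (- e) * `|expR v - expR u|.
  move=> eu; have [uv|] := lerP (v - u) 0.
    by rewrite (le_trans uv)// mulr_ge0 ?expR_ge0.
  move=> uv.
  have h1 := ler_wpM2l (expR_ge0 u) (expR_ge1Dx (v - u)).
  have h2 : expR e * (v - u) <= expR v - expR u.
    move: h1; rewrite -expRD [u + (v - u)]addrCA subrr addr0 => h1.
    have := ler_wpM2r (ltW uv) eu; lra.
  have h3 := ler_wpM2l (expR_ge0 (- e)) h2.
  move: h3; rewrite mulrA -expRD addNr expR0 mul1r => /le_trans; apply.
  by rewrite ler_wpM2l ?expR_ge0// ler_norm.
move=> es et; rewrite ler_norml lerNl opprB; apply/andP; split; last exact: h.
by rewrite distrC h.
Qed.

Section Eigenfunction.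
Variables (th K : R) (A : Omega d -> R).
Hypotheses (th0 : 0 < th) (th1 : th < 1) (hA : regular th K A).

Let th_neq : 1 - th != 0. Proof. by rewrite gt_eqF// subr_gt0. Qed.
Let K0 : 0 <= K. Proof. exact: regular_ge0 hA. Qed.

(** Fixed point of C -> (K + C) th, so that all iterates share one regularity constant. *)
Let Kd := K * th / (1 - th).
Let Kd0 : 0 <= Kd.
Proof. by apply: divr_ge0; [exact: mulr_ge0 K0 (ltW th0)|rewrite subr_ge0 ltW]. Qed.

(** Logarithm of the n-th iterate of the transfer operator of [A] on the constant 1. *)
Let lg n := iter n (fun g => log_tr (fun x => A x + g x)) (fun=> 0 : R).

Let lgS n x : lg n.+1 x = log_tr (fun y => A y + lg n y) x.
Proof. by []. Qed.

Let regular_lg n : regular th Kd (lg n).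
Proof.
elim: n => [|n IH].
  by apply: (regularW (ltW th0) Kd0); exact: regular_cst.
have -> : Kd = (K + Kd) * th by rewrite /Kd; field.
by apply: regular_log_tr; exact: regularD.
Qed.

(** Ratio of consecutive iterates of the operator on 1; the probabilities [p n] below are those for
    which [u n.+1] is an average of [u n]. *)
Let u n x := expR (lg n.+1 x - lg n x).
Let p n a x := expR (A (cons_letter a x) + lg n (cons_letter a x) - lg n.+1 x).

Let sum_p n x : \sum_a p n a x = 1.
Proof.
under eq_bigr do rewrite /p expRD.
by rewrite -mulr_suml -(log_trK (fun y => A y + lg n y)) -lgS -expRD subrr expR0.
Qed.

Let u_step n x : u n.+1 x = \sum_a p n a x * u n (cons_letter a x).
Proof.
rewrite /u expRD {1}lgS log_trK mulr_suml; apply: eq_bigr => a _.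
by rewrite /p -!expRD; congr expR; ring.
Qed.

Let K2 := K + Kd + Kd.

Let p_kernel n : kernel_regular th K2 (p n).
Proof.
split=> [a x|x|a k x y xy]; [exact: expR_ge0|exact: sum_p|].
rewrite /p -expRD ler_expR.
have h1 := hA (agree_cons a xy); have h2 := regular_lg n (agree_cons a xy).
have h3 := regular_lg n.+1 xy.
have tk : th ^+ k.+1 <= th ^+ k.
  by rewrite exprS ler_piMl// ?exprn_ge0// ltW.
have h4 := ler_wpM2l K0 tk; have h5 := ler_wpM2l Kd0 tk.
by move: h1 h2 h3; rewrite !ler_norml /K2; lra.
Qed.

Let u_cvg : exists l C r, [/\ 0 < r, r < 1, 0 <= C &
  forall k x, `|u k x - l| <= C * r ^+ k].
Proof.
have K20 : 0 <= K2 by exact: addr_ge0 (addr_ge0 K0 Kd0) Kd0.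
apply: (kernel_cvg th0 th1 K20 p_kernel u_step).
by apply: (regular_expR (ltW th0)); apply: regularB; exact: regular_lg.
Qed.

(** Averages keep the lower bound of [u 0]. A positive lower bound makes the logarithm Lipschitz
    along the ratios, so that convergence passes from [u] to [lg]. *)
Let u_ge : exists e, forall n x, expR e <= u n x.
Proof.
exists (- (`|lg 1 point| + Kd)); elim=> [|n IH] x.
  rewrite /u /= subr0 ler_expR lerNl.
  apply: le_trans (regular_bound x (regular_lg 1)).
  by rewrite -normrN ler_norm.
rewrite u_step -[leLHS]mul1r -(sum_p n x) mulr_suml ler_sum// => a _.
by rewrite ler_wpM2l ?expR_ge0.
Qed.

Let lg_cvg : exists c C r, [/\ 0 < r, r < 1 &
  forall n x, `|lg n.+1 x - lg n x - c| <= C * r ^+ n].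
Proof.
have [l [C [r [r0 r1 C0 hu]]]] := u_cvg; have [e he] := u_ge.
set D := expR (- e) * (2 * C).
have duu n m x y : (n <= m)%N ->
    `|lg m.+1 x - lg m x - (lg n.+1 y - lg n y)| <= D * r ^+ n.
  move=> nm; apply: (le_trans (ln_lipschitz (he m x) (he n y))).
  rewrite /D -mulrA ler_wpM2l ?expR_ge0// -!/(u _ _).
  have h1 : `|u m x - l| <= C * r ^+ n.
    apply: (le_trans (hu m x)); rewrite ler_wpM2l// ler_wiXn2l ?ltW//.
  have := ler_normB (u m x - l) (u n y - l); rewrite opprB addrA subrK.
  by have := hu n y; lra.
have [c hc] := geometric_cvg r0 r1
  (fun n => duu n n.+1 point point (leqnSn n)).
exists c, (D + D / (1 - r)), r; split=> // n x.
have := ler_normD (lg n.+1 x - lg n x - (lg n.+1 point - lg n point))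
  (lg n.+1 point - lg n point - c).
rewrite addrA subrK => /le_trans; apply; rewrite mulrDl lerD ?duu//.
Qed.

(** Here c is the limit of the increments of [lg] and g that of lg n - n c. The eigenvalue equation
    is the limit of the recurrence [lgS], because [log_tr] is monotone and commutes with
    constants. *)
Lemma rpf : exists c g L, regular th L g /\
  forall x, log_tr (fun y => A y + g y) x = c + g x.
Proof.
have [c [C [r [r0 r1 h]]]] := lg_cvg.
pose b n x := lg n x - n%:R * c.
have bS n x : `|b n.+1 x - b n x| <= C * r ^+ n.
  rewrite (_ : b n.+1 x - b n x = lg n.+1 x - lg n x - c) ?h//.
  by rewrite /b -natr1; ring.
have /choice[g hg] : forall x, exists gx, forall n, `|b n x - gx| <= C / (1 - r) * r ^+ n.
  by move=> x; exact: (geometric_cvg r0 r1 (fun n => bS n x)).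
exists c, g, Kd; split.
  move=> n x y xy; apply: (le_geometric (C := C / (1 - r) * 2) r0 r1) => k.
  have h1 := hg x k; have h2 := hg y k; have h3 := regular_lg k xy.
  by move: h1 h2 h3; rewrite /b !ler_norml; lra.
move=> x; set D := C / (1 - r) in hg.
have h1 n : `|log_tr (fun y => A y + g y) x - (b n.+1 x + c)| <= D * r ^+ n.
  have -> : b n.+1 x + c = log_tr (fun y => A y + b n y) x.
    rewrite /b lgS (_ : (fun y => A y + (lg n y - n%:R * c)) =
      (fun y => A y + lg n y + - (n%:R * c))); last by apply: funext => y; rewrite addrA.
    by rewrite log_tr_add -natr1; ring.
  rewrite ler_norml lerNl opprB !lerBlDl; apply/andP.
  by split; apply: log_tr_le => a; have := hg (cons_letter a x) n;
    rewrite ler_norml; lra.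
have Dr k : D * r ^+ k.+1 <= D * r ^+ k.
  rewrite ler_wpM2l//; last by rewrite exprS ler_piMl ?exprn_ge0 ?ltW.
  by have := hg x 0%N; rewrite expr0 mulr1; apply: le_trans.
apply/eqP; rewrite eq_le; apply/andP; split;
  apply: (le_geometric (C := D + D) r0 r1) => k;
  have := h1 k; have := hg x k.+1; have := Dr k; rewrite !ler_norml; lra.
Qed.

End Eigenfunction.
End TransferOperator.

(** * Normalised potentials and the invariant mean *)

Section NormalisedPotential.
Context {R : realType} {d : nat}.
Implicit Types (x y : Omega d) (a : 'I_d.+1) (n k : nat) (f g A B : Omega d -> R).
Local Notation shift := (@seq_shift d).

Definition tr A f x : R := \sum_(a < d.+1) expR (A (cons_letter a x)) * f (cons_letter a x).

Definition normalised B := forall x, \sum_(a < d.+1) expR (B (cons_letter a x)) = 1.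

(** For regular [f] and a regular normalised [B], the iterates converge uniformly to a constant, so
    the base point is immaterial. *)
Definition mean B f : R := lim (iter n (tr B) f point @[n --> \oo]).

(** In exponential form: exp g is a positive eigenfunction of the transfer operator of [A], with
    eigenvalue exp c. *)
Definition eigenpair A c g := forall x, log_tr (fun y => A y + g y) x = c + g x.

Lemma trD A f g x : tr A (fun y => f y + g y) x = tr A f x + tr A g x.
Proof. by rewrite /tr -big_split/=; apply: eq_bigr => a _; rewrite mulrDr. Qed.

Lemma trZ A (s : R) f x : tr A (fun y => s * f y) x = s * tr A f x.
Proof. by rewrite /tr mulr_sumr; apply: eq_bigr => a _; rewrite mulrCA. Qed.

Lemma tr_le A f g x : (forall y, f y <= g y) -> tr A f x <= tr A g x.
Proof. by move=> h; apply: ler_sum => a _; rewrite ler_wpM2l ?expR_ge0. Qed.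

Lemma tr_cst B (s : R) x : normalised B -> tr B (fun=> s) x = s.
Proof. by move=> hB; rewrite /tr -mulr_suml hB mul1r. Qed.

Lemma tr_sum A (I : finType) (F : I -> Omega d -> R) x :
  tr A (fun y => \sum_i F i y) x = \sum_i tr A (F i) x.
Proof.
rewrite /tr; under eq_bigr do rewrite mulr_sumr.
exact: exchange_big.
Qed.

Lemma tr_shift B f x : normalised B -> tr B (f \o shift) x = f x.
Proof.
move=> hB; rewrite /tr; under eq_bigr do rewrite /= shift_cons.
by rewrite -mulr_suml hB mul1r.
Qed.

Lemma eigenpair_tr A c g x : eigenpair A c g ->
  tr A (fun y => expR (g y)) x = expR c * expR (g x).
Proof.
move=> h; rewrite -expRD -h log_trK; apply: eq_bigr => a _.
by rewrite expRD.
Qed.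

(** Collatz-Wielandt comparison: i, the infimum of f / exp g, is positive, and applying the operator
    to i exp g <= f gives i exp(c - k) <= i. *)
Lemma eigenpair_le th L A c g f (k e : R) : regular th L g -> eigenpair A c g ->
  0 < e -> (forall x, e <= f x) ->
  (forall x, tr A f x <= expR k * f x) -> c <= k.
Proof.
move=> hg hc e0 ef hk.
pose q x := f x * expR (- g x).
have qpos x : e * expR (- (`|g point| + L)) <= q x.
  apply: ler_pM; rewrite ?(ltW e0) ?expR_ge0// ler_expR lerN2.
  exact: le_trans (ler_norm _) (regular_bound _ hg).
set i := inf (range q).
have hinf : has_inf (range q).
  split; first by exists (q point), point.
  by exists (e * expR (- (`|g point| + L))) => _ [x _ <-].
have i0 : 0 < i.
  apply: (@lt_le_trans _ _ (e * expR (- (`|g point| + L)))).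
    by rewrite mulr_gt0 ?expR_gt0.
  by apply: lb_le_inf; [exact: hinf.1|move=> _ [x _ <-]].
have iq x : i * expR (g x) <= f x.
  have : i <= q x by apply: ge_inf; [exact: hinf.2|exists x].
  by move=> /(ler_wpM2r (expR_ge0 (g x))); rewrite /q -mulrA -expRD addNr expR0 mulr1.
have : i * expR (c - k) <= i.
  apply: lb_le_inf; first exact: hinf.1.
  move=> _ [x _ <-]; rewrite /q.
  have h := le_trans (tr_le A x iq) (hk x).
  move: h; rewrite trZ (eigenpair_tr _ hc) => h.
  have := ler_wpM2r (expR_ge0 (- k - g x)) h.
  rewrite [X in _ <= X](_ : _ = f x * expR (- g x)); last first.
    by rewrite (mulrC (expR k)) -mulrA -expRD addrA subrr sub0r.
  apply: le_trans; rewrite -!mulrA -!expRD le_eqVlt; apply/orP; left; apply/eqP.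
  by congr (_ * expR _); ring.
by rewrite ger_pMr// -[X in _ <= X]expR0 ler_expR subr_le0.
Qed.

(** The dual comparison, with the supremum of f / exp g; the upper bound [b] makes it finite. *)
Lemma eigenpair_ge th L A c g f (k e b : R) : regular th L g -> eigenpair A c g ->
  0 < e -> (forall x, e <= f x) -> (forall x, f x <= b) ->
  (forall x, expR k * f x <= tr A f x) -> k <= c.
Proof.
move=> hg hc e0 ef fb hk.
pose q x := f x * expR (- g x).
have f0 x : 0 <= f x by rewrite (le_trans (ltW e0)).
have qle x : q x <= b * expR (`|g point| + L).
  apply: ler_pM; rewrite ?expR_ge0// ler_expR.
  apply: le_trans (regular_bound x hg); rewrite -normrN; exact: ler_norm.
set i := sup (range q).
have hsup : has_sup (range q).
  split; first by exists (q point), point.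
  by exists (b * expR (`|g point| + L)) => _ [x _ <-].
have qi x : q x <= i by apply: ub_le_sup; [exact: hsup.2|exists x].
have i0 : 0 < i.
  by apply: lt_le_trans (qi point); rewrite mulr_gt0 ?expR_gt0// (lt_le_trans e0).
have iq x : f x <= i * expR (g x).
  have := ler_wpM2r (expR_ge0 (g x)) (qi x).
  by rewrite /q -mulrA -expRD addNr expR0 mulr1.
have : i <= i * expR (c - k).
  apply: ge_sup; first exact: hsup.1.
  move=> _ [x _ <-]; rewrite /q.
  have h := le_trans (hk x) (tr_le A x iq).
  move: h; rewrite trZ (eigenpair_tr _ hc) => h.
  have := ler_wpM2r (expR_ge0 (- k - g x)) h.
  rewrite [X in X <= _ -> _](_ : _ = f x * expR (- g x)); last first.
    by rewrite (mulrC (expR k)) -mulrA -expRD addrA subrr sub0r.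
  move=> /le_trans; apply; rewrite -!mulrA -!expRD le_eqVlt; apply/orP; left; apply/eqP.
  by congr (_ * expR _); ring.
by rewrite ler_pMr// -[X in X <= _]expR0 ler_expR subr_ge0.
Qed.

Lemma geometric_bound_cvg (u : nat -> R) l C r : 0 < r -> r < 1 ->
  (forall n, `|u n - l| <= C * r ^+ n) -> u @ \oo --> l.
Proof.
move=> r0 r1 h; have hr : (fun n => C * r ^+ n) @ \oo --> C * 0.
  by apply: cvgMr; apply: cvg_expr; rewrite ger0_norm// ltW.
apply/cvgrPdist_le => e e0.
have : \forall n \near \oo, C * r ^+ n <= e.
  by apply: (cvgr_le _ hr); rewrite mulr0.
by apply: filterS => n; rewrite distrC; exact: le_trans.
Qed.

Section Mean.
Variables (th K : R) (B : Omega d -> R).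
Hypotheses (th0 : 0 < th) (th1 : th < 1) (hB : regular th K B) (nB : normalised B).

Lemma tr_kernel : kernel_regular th K (fun a x => expR (B (cons_letter a x))).
Proof.
split=> [a x|x|a k x y xy]; [exact: expR_ge0|exact: nB|].
rewrite -expRD ler_expR; have := hB (agree_cons a xy).
have : K * th ^+ k.+1 <= K * th ^+ k.
  rewrite ler_wpM2l ?(regular_ge0 hB)// exprS ler_piMl ?exprn_ge0 ?ltW//.
by rewrite ler_norml; lra.
Qed.

Lemma mean_rate W f : regular th W f -> exists C r, [/\ 0 < r, r < 1, 0 <= C &
  forall n x, `|iter n (tr B) f x - mean B f| <= C * r ^+ n].
Proof.
move=> hf.
have [l [C [r [r0 r1 C0 h]]]] := kernel_cvg th0 th1 (regular_ge0 hB)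
  (fun=> tr_kernel) (h := fun k => iter k (tr B) f) (fun k x => erefl) hf.
exists C, r; split=> //; suff -> : mean B f = l by [].
apply: cvg_lim => //; exact: (geometric_bound_cvg r0 r1 (fun n => h n point)).
Qed.

Lemma mean_cvg W f x : regular th W f -> iter n (tr B) f x @[n --> \oo] --> mean B f.
Proof.
move=> /mean_rate[C [r [r0 r1 _ h]]].
exact: (geometric_bound_cvg r0 r1 (fun n => h n x)).
Qed.

Lemma iter_trD f g n x : iter n (tr B) (fun y => f y + g y) x =
  iter n (tr B) f x + iter n (tr B) g x.
Proof.
elim: n x => [//|n IH] x; rewrite !iterS -trD; congr (tr B _ x).
exact: funext.
Qed.

Lemma iter_trZ s f n x : iter n (tr B) (fun y => s * f y) x = s * iter n (tr B) f x.
Proof.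
elim: n x => [//|n IH] x; rewrite !iterS -trZ; congr (tr B _ x).
exact: funext.
Qed.

Lemma iter_tr_le f g n x : (forall y, f y <= g y) ->
  iter n (tr B) f x <= iter n (tr B) g x.
Proof. by move=> h; elim: n x => [//|n IH] x; rewrite !iterS; exact: tr_le. Qed.

Lemma meanD W V f g : regular th W f -> regular th V g ->
  mean B (fun y => f y + g y) = mean B f + mean B g.
Proof.
move=> hf hg; apply: cvg_lim => //.
under eq_fun do rewrite iter_trD.
by apply: cvgD; [exact: mean_cvg hf|exact: mean_cvg hg].
Qed.

Lemma meanZ W s f : regular th W f -> mean B (fun y => s * f y) = s * mean B f.
Proof.
move=> hf; apply: cvg_lim => //; under eq_fun do rewrite iter_trZ.
by apply: cvgMr; exact: mean_cvg hf.
Qed.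

Lemma mean_cst s : mean B (fun=> s) = s.
Proof.
apply: cvg_lim => //; rewrite (_ : (fun n => _) = (fun=> s)); first exact: cvg_cst.
apply: funext => n; elim: n point => [//|n IH] x; rewrite iterS.
by rewrite (_ : iter n (tr B) _ = fun=> s) ?tr_cst//; exact: funext.
Qed.

Lemma mean_le W V f g : regular th W f -> regular th V g ->
  (forall x, f x <= g x) -> mean B f <= mean B g.
Proof.
move=> hf hg fg; apply: (ler_cvg_to (mean_cvg point hf) (mean_cvg point hg)).
by apply: nearW => n; exact: iter_tr_le.
Qed.

Lemma mean_tr W f : regular th W f -> mean B (tr B f) = mean B f.
Proof.
move=> hf; apply: cvg_lim => //; under eq_fun do rewrite -iterSr.
have := mean_cvg point hf.
by rewrite -(cvg_shiftS (fun n => iter n (tr B) f point)).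
Qed.

(** [tr B] is a left inverse of composition with the shift, and the mean does not see [tr B]. *)
Lemma mean_shift W f : regular th W f -> mean B (f \o shift) = mean B f.
Proof.
move=> hf; rewrite -(mean_tr (regular_shift th0 th1 hf)).
by congr mean; apply: funext => x; exact: tr_shift.
Qed.

(** Reduction to [regular_log_tr]: adding a constant makes f at least 1, hence the exponential of a
    regular function, and [tr B] fixes the added constant. *)
Lemma regular_tr W f : regular th W f -> exists V, regular th V (tr B f).
Proof.
move=> hf; set b := `|f point| + W.
have hb := regularD hf (regular_cst th (b + 1)).
pose f1 y := f y + (b + 1).
have f1pos y : 1 <= f1 y.
  by have := regular_bound y hf; rewrite -/b /f1 ler_norml; lra.
have hlnf : regular th (1 * W) (fun y => ln (f1 y)).
  move=> n x y xy; have p z : 0 < f1 z by apply: lt_le_trans (f1pos z).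
  apply: (le_trans (ln_lipschitz (e := 0) _ _)); rewrite ?expR0 ?lnK ?posrE//.
  rewrite oppr0 expR0 !mul1r; have := hb _ _ _ xy; rewrite addr0; exact: le_trans.
have hR := regular_expR (ltW th0) (regular_log_tr (regularD hB hlnf)).
exists (expR (`|log_tr (fun x => B x + ln (f1 x)) point| + (K + 1 * W) * th) *
  ((K + 1 * W) * th)) => n x y xy.
suff E z : tr B f z = expR (log_tr (fun x => B x + ln (f1 x)) z) - (b + 1).
  by rewrite !E opprB addrA subrK; exact: hR.
rewrite log_trK; apply/eqP; rewrite -subr_eq opprK -(tr_cst (b + 1) z nB) -trD; apply/eqP.
apply: eq_bigr => a _; rewrite expRD lnK// posrE.
exact: lt_le_trans (f1pos _).
Qed.

End Mean.
End NormalisedPotential.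

(** * First-order perturbation of the eigenvalue *)

Section EigenvalueDerivative.
Context {R : realType} {d : nat}.
Implicit Types (x y : Omega d) (n k : nat) (f g B : Omega d -> R).
Variables (th K W : R) (B f : Omega d -> R).
Hypotheses (th0 : 0 < th) (th1 : th < 1) (hB : regular th K B) (nB : normalised B)
  (hf : regular th W f).

Let M := mean B f.
(** Truncated Neumann series for the Poisson equation (1 - T) v = T f - M with T = [tr B]; the
    telescoping error is the single term T^(m+1) f - M. *)
Let v m x : R := \sum_(i < m) (iter i.+1 (tr B) f x - M).

Let tr_v m x : tr B (fun y => f y + v m y) x =
  v m x + M + (iter m.+1 (tr B) f x - M).
Proof.
rewrite trD /v tr_sum.
have -> : \sum_(i < m) tr B (fun y => iter i.+1 (tr B) f y - M) x =
   \sum_(i < m) (iter i.+2 (tr B) f x - M).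
  by apply: eq_bigr => i _; rewrite trD tr_cst.
pose G i := iter i.+1 (tr B) f x - M.
have E1 : \sum_(i < m.+1) G i = G 0%N + \sum_(i < m) G i.+1 by rewrite big_ord_recl.
have E2 : \sum_(i < m.+1) G i = \sum_(i < m) G i + G m by rewrite big_ord_recr.
by move: E1; rewrite E2 /G /=; lra.
Qed.

(* The first-order corrector: 1 + s v is an approximate eigenfunction of the
   operator perturbed by s f, since f + T v = v + M up to a small error. *)
Lemma corrector (e : R) : 0 < e -> exists (w h : Omega d -> R) (V : R),
  [/\ 0 < V, forall x, `|w x| <= V, forall x, `|h x| <= e &
     forall x, tr B (fun y => f y + w y) x = w x + M + h x].
Proof.
move=> e0; have [C [r [r0 r1 C0 hr]]] := mean_rate th0 th1 hB nB hf.
have [m hm] := geometric_small C r0 r1 e0.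
exists (v m), (fun x => iter m.+1 (tr B) f x - M), (m%:R * C + 1); split.
- by rewrite ltr_pwDr// mulr_ge0.
- move=> x; rewrite (le_trans (ler_norm_sum _ _ _))//.
  apply: (@le_trans _ _ (\sum_(i < m) C)); last by rewrite sumr_const card_ord -mulr_natl; lra.
  apply: ler_sum => i _; apply: (le_trans (hr _ _)).
  by rewrite ler_piMr// exprn_ile1// ltW.
- move=> x; apply: (le_trans (hr _ _)); apply: le_trans hm.
  by rewrite ler_wpM2l// exprS ler_piMl ?exprn_ge0// ltW.
- exact: tr_v.
Qed.

(** The test function 1 + s w is put into the two comparison lemmas. The perturbed operator sends it
    to 1 + s (w + M + h) up to order s^2, which lies between the multiples exp(s M - e |s|) and
    exp(s M + e |s|) of 1 + s w. The eigenfunction itself never has to be differentiated. *)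
Lemma eigenvalue_deriv (e : R) : 0 < e -> exists2 del, 0 < del &
  forall s, `|s| <= del -> forall c g L, regular th L g ->
    eigenpair (fun x => B x + s * f x) c g -> `|c - s * M| <= e * `|s|.
Proof.
move=> e0; have e40 : 0 < e / 4 by lra.
have [w [h [V [V0 wV he trw]]]] := corrector e40.
set F := `|f point| + W + 1.
have F0 : 0 < F by have := regular_ge0 hf; have := normr_ge0 (f point); rewrite /F; lra.
have fF x : `|f x| <= F by have := regular_bound x hf; rewrite /F; lra.
set N := `|M| + e.
have N0 : 0 < N by have := normr_ge0 M; rewrite /N; lra.
(* All second-order terms: the first two bound the remainder of exp(s f) (1 + s w), the last two
   that of exp k (1 + s w) for |k| <= |s| N. *)
set Q := F * V + 4 * F ^+ 2 + N * V + 3 * N ^+ 2.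
have FV : 0 < F * V by rewrite mulr_gt0.
have FF : 0 < F ^+ 2 by rewrite exprn_gt0.
have NV : 0 < N * V by rewrite mulr_gt0.
have NN : 0 < N ^+ 2 by rewrite exprn_gt0.
have Q0 : 0 < Q by rewrite /Q; lra.
(* For |s| <= 1 / Z, the products of |s| with V, F and N are at most 1/2 and |s| Q is at most e / 2;
   with the e / 4 allowed for h the total error stays below e |s|. *)
set Z := 2 * V + 2 * F + 2 * N + 2 * Q / e.
have Qe : 0 < Q / e by rewrite divr_gt0.
have Z0 : 0 < Z by rewrite /Z; lra.
exists Z^-1; first by rewrite invr_gt0.
move=> s hs c g L hg hc; set a := `|s|.
have a0 : 0 <= a by exact: normr_ge0.
have aZ : a * Z <= 1 by rewrite -ler_pdivlMr// div1r.
have [aV0 aF0 aN0 aQ0] : [/\ 0 <= a * V, 0 <= a * F, 0 <= a * N & 0 <= a * (Q / e)].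
  by split; apply: mulr_ge0 => //; exact: ltW.
have [aV aF aN aQ] : [/\ a * V <= 1/2, a * F <= 1/2, a * N <= 1/2 & a * (Q / e) <= 1/2].
  by move: aZ aV0 aF0 aN0 aQ0; rewrite /Z; clear; move=> *; split; lra.
have aQe : a * Q <= e / 2.
  have := ler_wpM2r (ltW e0) aQ; rewrite -mulrA divfK ?gt_eqF//; lra.
have sw x : `|s * w x| <= a * V by rewrite normrM ler_wpM2l.
have sf x : `|s * f x| <= a * F by rewrite normrM ler_wpM2l.
have aa : 0 <= a ^+ 2 by rewrite exprn_ge0.
have aaQ : a ^+ 2 * Q <= a * (e / 2) by rewrite expr2 -mulrA ler_wpM2l.
clear aV0 aQ0 aQ Q0 Z0 Qe FV FF NV NN aZ aQe hs Z.
pose rem x := expR (s * f x) * (1 + s * w x) - 1 - s * (f x + w x).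
have hrem x : `|rem x| <= a ^+ 2 * (F * V + 4 * F ^+ 2).
  have h1 := expR_quadratic (le_trans (sf x) aF).
  set t := s * f x in h1; set q := s * w x; set rho := expR t - 1 - t in h1.
  have -> : rem x = t * q + rho * (1 + q).
    by rewrite /rem (mulrDr s) -/t -/q /rho; ring.
  have ht2 : t ^+ 2 <= a ^+ 2 * F ^+ 2.
    by rewrite -exprMn -real_normK ?num_real// lerXn2r ?nnegrE ?sf.
  have h2 : `|t * q| <= a ^+ 2 * (F * V).
    rewrite normrM (_ : a ^+ 2 * _ = (a * F) * (a * V)); last by ring.
    by apply: ler_pM => //; [exact: sf|exact: sw].
  have h3 : `|rho * (1 + q)| <= (2 * t ^+ 2) * 2.
    rewrite normrM; apply: ler_pM => //.
    by have := ler_normD 1 q; have := sw x; rewrite -/q normr1; lra.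
  have := ler_normD (t * q) (rho * (1 + q)); clear -h2 h3 ht2 th K W th0 th1 hB nB hf; lra.
have trW x : tr B (fun y => expR (s * f y) * (1 + s * w y)) x =
    1 + s * (w x + M + h x) + tr B rem x.
  rewrite -trw -trZ -[in RHS](tr_cst 1 x nB) -!trD; congr (tr B _ x).
  by apply: funext => y; rewrite /rem; ring.
have trrem x : `|tr B rem x| <= a ^+ 2 * (F * V + 4 * F ^+ 2).
  have h1 y : rem y <= a ^+ 2 * (F * V + 4 * F ^+ 2) by apply: le_trans (ler_norm _) _.
  have h2 y : - (a ^+ 2 * (F * V + 4 * F ^+ 2)) <= rem y.
    by rewrite lerNl; apply: le_trans (hrem y); rewrite -normrN ler_norm.
  have := tr_le B x h1; have := tr_le B x h2; rewrite !tr_cst// ler_norml.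
  by move=> -> ->.
have trE x : tr (fun y => B y + s * f y) (fun y => 1 + s * w y) x =
    tr B (fun y => expR (s * f y) * (1 + s * w y)) x.
  by apply: eq_bigr => i _; rewrite expRD mulrA.
have W1 x : 1 / 2 <= 1 + s * w x by have := sw x; rewrite ler_norml; lra.
have W2 x : 1 + s * w x <= 3 / 2 by have := sw x; rewrite ler_norml; lra.
have sM : `|s * M| <= a * `|M| by rewrite normrM.
have kN (k : R) : `|k - s * M| <= e * a -> `|k| <= a * N.
  move=> hk; have := ler_normD (k - s * M) (s * M); rewrite subrK /N; lra.
have sh x : `|s * h x| <= a * (e / 4) by rewrite normrM ler_wpM2l.
have kw (k : R) x : `|k| <= a * N -> `|k * (s * w x)| <= a ^+ 2 * (N * V).
  move=> hk; rewrite normrM (_ : a ^+ 2 * _ = (a * N) * (a * V)); last by ring.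
  by apply: ler_pM.
have ae : 0 <= a * e by rewrite mulr_ge0// ltW.
rewrite ler_norml; apply/andP; split.
  have hk : `|s * M - e * a| <= a * N.
    by apply: kN; rewrite addrAC subrr sub0r normrN ger0_norm// mulr_ge0// ltW.
  suff : s * M - e * a <= c by lra.
  apply: (@eigenpair_ge _ _ _ _ _ _ _ _ _ _ _ hg hc _ W1 W2); first lra.
  move=> x; rewrite trE trW; set k := s * M - e * a in hk *.
  have kh : `|k| <= 1/2 by apply: le_trans hk aN.
  have h1 : expR k <= 1 + k + 2 * k ^+ 2.
    by have := expR_quadratic kh; rewrite ler_norml; lra.
  have k2 : k ^+ 2 <= a ^+ 2 * N ^+ 2.
    by rewrite -exprMn -real_normK ?num_real// lerXn2r ?nnegrE.
  have h2 : expR k * (1 + s * w x) <= (1 + k + 2 * k ^+ 2) * (1 + s * w x).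
    by rewrite ler_wpM2r//; have := W1 x; lra.
  have h3 : 2 * k ^+ 2 * (1 + s * w x) <= 2 * k ^+ 2 * (3 / 2).
    by rewrite ler_wpM2l// mulr_ge0// sqr_ge0.
  apply: (le_trans h2).
  have := kw k x hk; have := sh x; have := trrem x; rewrite !ler_norml.
  move: aaQ h3 k2 ae; rewrite /Q /k; clear aV aF aN F0 N0 a0 h1 h2 kh; lra.
have hk : `|s * M + e * a| <= a * N.
  by apply: kN; rewrite addrAC subrr add0r ger0_norm// mulr_ge0// ltW.
suff : c <= s * M + e * a by lra.
apply: (@eigenpair_le _ _ _ _ _ _ _ _ _ _ hg hc _ W1); first lra.
move=> x; rewrite trE trW; set k := s * M + e * a in hk *.
have h2 : (1 + k) * (1 + s * w x) <= expR k * (1 + s * w x).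
  by rewrite ler_wpM2r ?expR_ge1Dx//; have := W1 x; lra.
apply: le_trans h2.
have := kw k x hk; have := sh x; have := trrem x; rewrite !ler_norml.
move: aaQ ae (sqr_ge0 (a * N)); rewrite /Q /k; clear aV aF aN F0 N0 a0; lra.
Qed.

End EigenvalueDerivative.

(** * Cylinders and the Borel sigma-algebra *)

Section Cylinders.
Context {d : nat}.
Implicit Types (x y : Omega d) (n k m : nat).

Definition cyl n x : set (Omega d) := [set y | agree n x y].

Lemma cyl_eq n x y : agree n x y -> cyl n x = cyl n y.
Proof.
move=> xy; apply/seteqP; split => z /=; apply: agree_trans => //.
exact: agree_sym.
Qed.

Definition extend (w : seq 'I_d.+1) : Omega d := nth ord0 w.

Definition prefix n x : seq 'I_d.+1 := mkseq (x : nat -> 'I_d.+1) n.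

Lemma extend_prefix n x : agree n x (extend (prefix n x)).
Proof. by move=> i hi; rewrite /extend /prefix nth_mkseq. Qed.

Lemma coordinate_open i (a : 'I_d.+1) : open [set y : seq_space d | y i = a].
Proof.
rewrite openE => x xa; rewrite /interior /=.
apply: (@proj_continuous nat (fun=> discrete_topology 'I_d.+1) i x [set a]).
by apply: open_nbhs_nbhs; split; [exact: discrete_open|exact: xa].
Qed.

Lemma measurable_cyl n x : measurable (cyl n x).
Proof.
rewrite (_ : cyl n x = \bigcap_(i in `I_n) [set y | y i = x i]); last first.
  by apply/seteqP; split => y /= h i /= hi; rewrite h.
apply: bigcap_measurableType => i _; apply: sub_sigma_algebra.
exact: coordinate_open.
Qed.

(** The cylinders around x generate a filter that converges to x, since convergence in a product is
    coordinatewise and a cylinder of length i + 1 fixes coordinate i. *)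
Lemma open_cyl (U : set (seq_space d)) (x : seq_space d) : open U -> U x ->
  exists n, cyl n x `<=` U.
Proof.
move=> oU Ux.
pose F := filter_from (@setT nat) (fun n => cyl n x : set (seq_space d)).
have FF : Filter F.
  apply: filter_from_filter; first by exists 0%N.
  move=> i j _ _; exists (maxn i j) => // y h; split; apply: agreeW h.
    exact: leq_maxl.
  exact: leq_maxr.
have Fx : F --> x.
  apply/cvg_sup => i A /=.
  move=> [_ [[C oC <-] /= Cx CA]].
  exists i.+1 => // y h; apply: CA => /=.
  by rewrite -(h i).
have [n _ h] : F U by apply: Fx; exact: open_nbhs_nbhs.
by exists n.
Qed.

(** The empty set is included so that the family is closed under intersection, as uniqueness of
    measures requires. *)
Definition cylinders : set (set (Omega d)) :=
  [set C | C = set0 \/ exists n x, C = cyl n x].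

(** An open set is the union of the cylinders that it contains; these are indexed by finite words,
    so countably many suffice, enumerated through [unpickle]. *)
Lemma measurable_cylinders : @measurable _ (Omega d) = <<s cylinders >>.
Proof.
apply/seteqP; split; last first.
  apply: smallest_sub; first exact: sigma_algebra_measurable.
  by move=> _ [->|[n [x ->]]]; [exact: measurable0|exact: measurable_cyl].
apply: smallest_sub; first exact: smallest_sigma_algebra.
move=> U oU.
pose F k : set (Omega d) := if unpickle k is Some w then
  if `[< cyl (size (w : seq 'I_d.+1)) (extend w) `<=` U >]
  then cyl (size w) (extend w) else set0 else set0.
have -> : U = \bigcup_k F k.
  apply/seteqP; split => x.
    move=> Ux; have [n hn] := open_cyl oU Ux.
    have cE : cyl n x = cyl (size (prefix n x)) (extend (prefix n x)).
      by rewrite size_mkseq; apply: cyl_eq; exact: extend_prefix.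
    exists (pickle (prefix n x)) => //; rewrite /F pickleK.
    case: asboolP => [_|]; last by rewrite -cE.
    by rewrite -cE.
  by move=> [k _]; rewrite /F; case: unpickle => [w|//]; case: asboolP => // h /h.
apply: (@bigcup_measurable _ (g_sigma_algebraType cylinders)) => k _.
rewrite /F; case: unpickle => [w|]; last exact: measurable0.
case: asboolP => _; last exact: measurable0.
by apply: sub_sigma_algebra; right; exists (size w), (extend w).
Qed.

Lemma setI_cylinders : setI_closed cylinders.
Proof.
move=> A B [->|[n [x ->]]]; first by rewrite set0I; left.
move=> [->|[m [y ->]]]; first by rewrite setI0; left.
wlog nm : n m x y / (n <= m)%N.
  move=> h; have [nm|mn] := leqP n m; first exact: h.
  by rewrite setIC; apply: h; exact: ltnW.
have [xy|xy] := pselect (agree n x y).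
  right; exists m, y; apply/seteqP; split => z /=; first by case.
  by move=> yz; split => //; apply: agree_trans xy _; exact: agreeW yz.
left; apply/seteqP; split => z //= [xz yz]; apply: xy.
by apply: agree_trans xz _; apply: agree_sym; exact: agreeW yz.
Qed.

Lemma cyl0 x : cyl 0 x = setT.
Proof. by apply/seteqP; split. Qed.

Lemma same_probability_cyl (R : realType) (mu nu : probability (Omega d) R) :
  (forall n x, mu (cyl n x) = nu (cyl n x)) -> same_probability mu nu.
Proof.
move=> h B mB; apply: (measure_unique cylinders (fun=> setT)) => //.
- exact: measurable_cylinders.
- exact: setI_cylinders.
- by move=> _; right; exists 0%N, point; rewrite cyl0.
- by apply/seteqP; split => // x _; exists 0%N.
- by move=> A [->|[n [x ->]]]; [rewrite !measure0|exact: h].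
- by move=> _; apply: (le_lt_trans (probability_le1 mu _) (ltry 1)); exact: measurableT.
Qed.

Definition word n x : {ffun 'I_n -> 'I_d.+1} := [ffun i => x (val i)].

Lemma wordP n x y : word n x = word n y <-> agree n x y.
Proof.
split=> [/ffunP h i hi|h]; first by have := h (Ordinal hi); rewrite !ffunE.
by apply/ffunP => i; rewrite !ffunE; exact: (h i (ltn_ord i)).
Qed.

Definition of_word n (w : {ffun 'I_n -> 'I_d.+1}) : Omega d :=
  fun i => if insub i is Some j then w j else ord0.

Lemma of_wordK n : cancel (@of_word n) (@word n).
Proof.
move=> w; apply/ffunP => i; rewrite ffunE /of_word.
by case: insubP => [j _ /val_inj ->//|]; rewrite ltn_ord.
Qed.

Lemma agree_of_word n x : agree n x (of_word (word n x)).
Proof. by apply/wordP; rewrite of_wordK. Qed.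

Lemma measurable_word (d' : measure_display) (T : measurableType d') n (f : Omega d -> T) :
  (forall x y, agree n x y -> f x = f y) -> measurable_fun setT f.
Proof.
move=> hf _ Y mY; rewrite setTI.
rewrite (_ : f @^-1` Y = \big[setU/set0]_(w : {ffun 'I_n -> 'I_d.+1} | f (of_word w) \in Y)
   cyl n (of_word w)).
  by apply: bigsetU_measurable => w _; exact: measurable_cyl.
apply/seteqP; split => x.
  move=> Yx; rewrite (bigD1 (word n x))/=; last first.
    by rewrite inE -(hf _ _ (agree_of_word (n := n) x)).
  by left => /=; apply: agree_sym; exact: agree_of_word.
elim/big_ind: _ => //= [A B hA hB [/hA|/hB]//|w].
by rewrite inE => Yw /hf <-.
Qed.

Lemma shift_cyl n x : @seq_shift d @^-1` cyl n x =
  \big[setU/set0]_(a < d.+1) cyl n.+1 (cons_letter a x).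
Proof.
apply/seteqP; split => y.
  move=> h; rewrite (bigD1 (y 0%N))//=; left => i /=.
  by case: i => [|i]//= hi; rewrite (h i).
elim/big_ind: _ => //= [A B hA hB [/hA|/hB]//|a _] h i hi.
exact: (h i.+1 hi).
Qed.

Lemma measurable_shift : measurable_fun setT (@seq_shift d : Omega d -> Omega d).
Proof.
move=> _ Y mY; rewrite setTI.
pose S := [set Y : set (Omega d) | measurable (@seq_shift d @^-1` Y)].
suff : <<s cylinders >> `<=` S by rewrite -measurable_cylinders => /(_ Y mY).
apply: smallest_sub.
  split=> [|A mA|F mF]; rewrite /S /=.
  - by rewrite preimage_set0; exact: measurable0.
  - by rewrite -[X in measurable X]/(setT `\` (@seq_shift d @^-1` A)); exact: measurableD.
  - by rewrite preimage_bigcup; apply: bigcup_measurable => k _; exact: mF.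
move=> _ [->|[n [x ->]]]; first by rewrite /S /= preimage_set0; exact: measurable0.
by rewrite /S /= shift_cyl; apply: bigsetU_measurable => a _; exact: measurable_cyl.
Qed.

End Cylinders.

(** * Expectations of bounded functions and finite-valued labels *)

Section Expectation.
Context {R : realType} {d' : measure_display} {T : measurableType d'}.
Variable P : probability T R.
Implicit Types (f g : T -> R).

Definition bounded_measurable f :=
  measurable_fun setT f /\ exists C, forall x, `|f x| <= C.

Definition Ex f : R := fine (\int[P]_x (f x)%:E).

Lemma bm_integrable f : bounded_measurable f -> P.-integrable setT (EFin \o f).
Proof.
move=> [mf [C hC]]; apply: measurable_bounded_integrable => //.
  exact: le_lt_trans (probability_le1 P measurableT) (ltry _).
by exists C; split; [exact: num_real|move=> M CM x _ /=; rewrite (le_trans (hC x))// ltW].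
Qed.

Lemma EFin_Ex f : bounded_measurable f -> (\int[P]_x (f x)%:E = (Ex f)%:E)%E.
Proof.
by move=> hf; rewrite fineK//; by apply: integrable_fin_num => //; exact: bm_integrable.
Qed.

Lemma bm_cst (s : R) : bounded_measurable (fun=> s).
Proof. by split; [exact: measurable_cst|exists `|s|]. Qed.

Lemma bmD f g : bounded_measurable f -> bounded_measurable g ->
  bounded_measurable (fun x => f x + g x).
Proof.
move=> [mf [C hC]] [mg [D hD]]; split; first exact: measurable_funD.
by exists (C + D) => x; rewrite (le_trans (ler_normD _ _))// lerD.
Qed.

Lemma bmZ s f : bounded_measurable f -> bounded_measurable (fun x => s * f x).
Proof.
move=> [mf [C hC]]; split; first by apply: measurable_funM => //; exact: measurable_cst.
by exists (`|s| * C) => x; rewrite normrM ler_wpM2l.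
Qed.

Lemma bm_sum (I : finType) (F : I -> T -> R) : (forall i, bounded_measurable (F i)) ->
  bounded_measurable (fun x => \sum_i F i x).
Proof.
move=> hF; elim: (index_enum I) => [|i r IH].
  by under eq_fun do rewrite big_nil; exact: bm_cst.
by under eq_fun do rewrite big_cons; exact: bmD.
Qed.

Lemma bm_indic B : measurable B -> bounded_measurable (\1_B : T -> R).
Proof.
move=> mB; split; first exact: measurable_indic.
by exists 1 => x; rewrite indicE ger0_norm ?ler0n// lern1; case: (_ \in _).
Qed.

Lemma ExD f g : bounded_measurable f -> bounded_measurable g ->
  Ex (fun x => f x + g x) = Ex f + Ex g.
Proof. by move=> hf hg; apply: RintegralD => //; exact: bm_integrable. Qed.

Lemma ExZ s f : bounded_measurable f -> Ex (fun x => s * f x) = s * Ex f.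
Proof. by move=> hf; apply: RintegralZl => //; exact: bm_integrable. Qed.

Lemma Ex_cst s : Ex (fun=> s) = s.
Proof.
rewrite /Ex -[fine _]/(Rintegral P setT (fun=> s)) Rintegral_cst//.
by apply: etrans (congr1 ( *%R s) (congr1 fine (probability_setT P))) _; exact: mulr1.
Qed.

Lemma Ex_le f g : bounded_measurable f -> bounded_measurable g ->
  (forall x, f x <= g x) -> Ex f <= Ex g.
Proof. by move=> hf hg fg; apply: le_Rintegral => //; exact: bm_integrable. Qed.

Lemma Ex_sum (I : finType) (F : I -> T -> R) : (forall i, bounded_measurable (F i)) ->
  Ex (fun x => \sum_i F i x) = \sum_i Ex (F i).
Proof.
move=> hF; suff H r : bounded_measurable (fun x => \sum_(i <- r) F i x) /\
    Ex (fun x => \sum_(i <- r) F i x) = \sum_(i <- r) Ex (F i) by exact: (H _).2.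
elim: r => [|i r [IH1 IH2]].
  under eq_fun do rewrite big_nil.
  by rewrite big_nil Ex_cst; split => //; exact: bm_cst.
under eq_fun do rewrite big_cons.
by rewrite big_cons ExD// IH2; split => //; exact: bmD.
Qed.

Lemma Ex_indic B : measurable B -> Ex (\1_B) = fine (P B).
Proof. by move=> mB; rewrite /Ex integral_indic// setIT. Qed.

Lemma Ex_abs_le f g e : bounded_measurable f -> bounded_measurable g ->
  (forall x, `|f x - g x| <= e) -> `|Ex f - Ex g| <= e.
Proof.
move=> hf hg fg; have h1 : Ex f <= Ex (fun x => g x + e).
  by apply: Ex_le => // [|x]; [exact: bmD hg (bm_cst e)|have := fg x; rewrite ler_norml; lra].
have h2 : Ex g <= Ex (fun x => f x + e).
  by apply: Ex_le => // [|x]; [exact: bmD hf (bm_cst e)|have := fg x; rewrite ler_norml; lra].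
move: h1 h2; rewrite !ExD ?Ex_cst//; try exact: bm_cst.
by rewrite ler_norml; lra.
Qed.

Definition measurable_label (I : finType) (Z : T -> I) :=
  forall i, measurable [set x | Z x = i].

Definition pr B : R := fine (P B).

Lemma pr_ge0 B : 0 <= pr B.
Proof. by rewrite fine_ge0. Qed.

Lemma pr_EFin B : measurable B -> (pr B)%:E = P B.
Proof. by move=> mB; rewrite fineK// fin_num_measure. Qed.

Lemma pr_le A B : measurable A -> measurable B -> A `<=` B -> pr A <= pr B.
Proof.
move=> mA mB AB; rewrite -lee_fin !pr_EFin//; apply: le_measure => //; exact: mem_set.
Qed.

Lemma label_sum (I : finType) (Z : T -> I) (F : I -> R) x :
  F (Z x) = \sum_i F i * \1_[set y | Z y = i] x.
Proof.
rewrite (bigD1 (Z x))//= indicE mem_set// mulr1 big1 ?addr0// => i iZ.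
by rewrite indicE memNset ?mulr0//= => h; rewrite h eqxx in iZ.
Qed.

Lemma bm_label (I : finType) (Z : T -> I) (F : I -> R) : measurable_label Z ->
  bounded_measurable (F \o Z).
Proof.
move=> hZ; rewrite (_ : F \o Z = fun x => \sum_i F i * \1_[set y | Z y = i] x).
  by apply: bm_sum => i; apply: bmZ; exact: bm_indic.
by apply: funext => x; exact: label_sum.
Qed.

Lemma Ex_label (I : finType) (Z : T -> I) (F : I -> R) : measurable_label Z ->
  Ex (F \o Z) = \sum_i pr [set x | Z x = i] * F i.
Proof.
move=> hZ; rewrite (_ : F \o Z = fun x => \sum_i F i * \1_[set y | Z y = i] x); last first.
  by apply: funext => x; exact: label_sum.
rewrite Ex_sum => [|i]; last by apply: bmZ; exact: bm_indic.
by apply: eq_bigr => i _; rewrite ExZ ?Ex_indic ?(mulrC (F i))//; exact: bm_indic.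
Qed.

Lemma measurable_label_set (I : finType) (Z : T -> I) (Q : pred I) :
  measurable_label Z -> measurable [set x | Q (Z x)].
Proof.
move=> hZ; rewrite (_ : [set x | _] = \big[setU/set0]_(i | Q i) [set x | Z x = i]).
  by apply: bigsetU_measurable => i _; exact: hZ.
apply/seteqP; split => x /=.
  by move=> QZ; rewrite (bigD1 (Z x))//=; left.
by elim/big_ind: _ => //= [A B hA hB [/hA|/hB]//|i Qi ->].
Qed.

Lemma measurable_label_pair (I J : finType) (Z : T -> I) (Y : T -> J) :
  measurable_label Z -> measurable_label Y -> measurable_label (fun x => (Z x, Y x)).
Proof.
move=> hZ hY [i j]; rewrite (_ : [set x | _] = [set x | Z x = i] `&` [set x | Y x = j]).
  exact: measurableI.
by apply/seteqP; split => x /= [-> ->].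
Qed.

Lemma measurable_label_ffun (n : nat) (I : finType) (Z : 'I_n -> T -> I) :
  (forall i, measurable_label (Z i)) ->
  measurable_label (fun x => [ffun i => Z i x] : {ffun 'I_n -> I}).
Proof.
move=> hZ w.
rewrite (_ : [set x | _] = \bigcap_(i in [set: 'I_n]) [set x | Z i x = w i]).
  by apply: fin_bigcap_measurable => [|i _]; [exact: finite_finset|exact: hZ].
apply/seteqP; split => x /=.
  by move=> <- i _ /=; rewrite ffunE.
by move=> h; apply/ffunP => i; rewrite ffunE; exact: h.
Qed.

Lemma label_pr_sum1 (I : finType) (Z : T -> I) : measurable_label Z ->
  \sum_i pr [set x | Z x = i] = 1.
Proof.
move=> hZ; have := Ex_label (fun=> 1) hZ; rewrite /comp Ex_cst => ->.
by apply: eq_bigr => i _; rewrite mulr1.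
Qed.

Lemma pr_label_set (I : finType) (Z : T -> I) (Q : pred I) : measurable_label Z ->
  pr [set x | Q (Z x)] = \sum_(i | Q i) pr [set x | Z x = i].
Proof.
move=> hZ; have := Ex_label (fun i => (Q i)%:R) hZ.
rewrite (_ : _ \o Z = \1_[set x | Q (Z x)]); last first.
  apply: funext => x; rewrite indicE /=; have [h|h] := boolP (Q (Z x)).
    by rewrite mem_set.
  by rewrite memNset//=; exact/negP.
rewrite Ex_indic; last exact: measurable_label_set.
move=> h; apply: etrans h _; rewrite [RHS]big_mkcond/=; apply: eq_bigr => i _.
by case: (Q i); rewrite ?mulr1 ?mulr0.
Qed.

End Expectation.

(** * Expectations under the shift *)

Section ShiftExpectation.
Context {R : realType} {d : nat}.
Variable nu : probability (Omega d) R.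
Implicit Types (f g : Omega d -> R).
Local Notation shift := (@seq_shift d).

Lemma measurable_iter_shift n : measurable_fun setT (iter n shift : Omega d -> Omega d).
Proof.
elim: n => [|n IH]; first exact: measurable_id.
rewrite (_ : iter n.+1 _ = shift \o iter n shift)//.
by apply: measurableT_comp => //; exact: measurable_shift.
Qed.

Lemma bm_shift n f : bounded_measurable f -> bounded_measurable (f \o iter n shift).
Proof.
move=> [mf [C hC]]; split; last by exists C => x; exact: hC.
by apply: measurableT_comp => //; exact: measurable_iter_shift.
Qed.

Lemma bm_birk n f : bounded_measurable f -> bounded_measurable (birk n f).
Proof. by move=> hf; apply: bm_sum => i; exact: (bm_shift i hf). Qed.

Lemma Ex_shift f : Defs.invariant nu -> bounded_measurable f -> Ex nu (f \o shift) = Ex nu f.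
Proof.
move=> inv hf; rewrite /Ex; congr fine.
have hf' := bm_shift 1 hf.
rewrite -[LHS](integral_pushforward (measurable_shift (d := d)) (D := setT)
  (f := EFin \o f))//.
- apply: eq_measure_integral; first exact: measurable_shift.
  by move=> mS A mA _; exact: (inv A mA).
- by apply/measurable_EFinP; exact: hf.1.
- by rewrite preimage_setT; exact: (bm_integrable nu hf').
Qed.

Lemma Ex_iter_shift n f : Defs.invariant nu -> bounded_measurable f ->
  Ex nu (f \o iter n shift) = Ex nu f.
Proof.
move=> inv hf; elim: n => [//|n IH].
rewrite -IH -(Ex_shift inv (bm_shift n hf)); congr Ex; apply: funext => x /=.
by rewrite -iterS iterSr.
Qed.

Lemma Ex_birk n f : Defs.invariant nu -> bounded_measurable f ->
  Ex nu (birk n f) = n%:R * Ex nu f.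
Proof.
move=> inv hf; rewrite [LHS](Ex_sum nu) => [|i]; last exact: (bm_shift i hf).
under eq_bigr do rewrite Ex_iter_shift//.
by rewrite sumr_const card_ord mulr_natl.
Qed.

Lemma measurable_word_label n : measurable_label (@word d n).
Proof.
move=> w; rewrite (_ : [set x | _] = cyl n (of_word w)); first exact: measurable_cyl.
apply/seteqP; split => x /=; first by move=> <-; apply: agree_sym; exact: agree_of_word.
by move=> /wordP <-; rewrite of_wordK.
Qed.

Lemma word_cyl n (w : {ffun 'I_n -> 'I_d.+1}) : [set x | word n x = w] = cyl n (of_word w).
Proof.
apply/seteqP; split => x /=; first by move=> <-; apply: agree_sym; exact: agree_of_word.
by move=> /wordP <-; rewrite of_wordK.
Qed.

Lemma bm_regular th K f : 0 < th -> th < 1 -> regular th K f -> bounded_measurable f.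
Proof.
move=> th0 th1 hf; split; last by exists (`|f point| + K) => x; exact: (regular_bound x hf).
apply: (@measurable_fun_cvg _ _ _ setT (fun n x => f (of_word (word n x)))).
  by move=> n; apply: (measurable_word (n := n)) => x y /wordP ->.
move=> x _; apply: (geometric_bound_cvg th0 th1) => n.
by apply: hf; apply: agree_sym; exact: agree_of_word.
Qed.

End ShiftExpectation.

(** * A probability with prescribed masses on cylinders *)

Section CylinderExtension.
Context {R : realType} {d : nat}.
Variable Q : seq 'I_d.+1 -> R.
Hypotheses (Q1 : Q [::] = 1) (Q0 : forall w, 0 <= Q w)
  (Qsum : forall w, Q w = \sum_(a < d.+1) Q (a :: w)).
Implicit Types (w : seq 'I_d.+1) (t : R) (x : Omega d) (a b : 'I_d.+1).

(* Words are stored with their last letter first, so that a cylinder of length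
   n.+1 is indexed by a cons. The masses Q cut [0, 1[ into nested intervals. *)
Fixpoint rprefix n x : seq 'I_d.+1 := if n is m.+1 then (x m : 'I_d.+1) :: rprefix m x else [::].

Lemma rprefix_agree n x y : agree n x y <-> rprefix n x = rprefix n y.
Proof.
elim: n => [|n IH] /=; first by split.
split=> [h|[h1 h2]].
  by congr (_ :: _); [exact: h|apply/IH; exact: agreeW h].
move=> i; rewrite ltnS leq_eqVlt => /predU1P[->//|hi].
by move/IH : h2; exact.
Qed.

(** Total mass of the children of [w] whose letter is below [k]: the offset of child [k] inside the
    interval of [w]. *)
Let S w (k : nat) : R := \sum_(b < d.+1 | (b < k)%N) Q (b :: w).

Let S0 w : S w 0 = 0. Proof. by rewrite /S big_pred0. Qed.

Let Stop w : S w d.+1 = Q w.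
Proof. by rewrite /S Qsum; apply: eq_bigl => b; rewrite ltn_ord. Qed.

Let SS w a : S w a.+1 = S w a + Q (a :: w).
Proof.
rewrite /S (bigD1 a)//= addrC; congr (_ + _); apply: eq_bigl => b.
by rewrite ltnS [RHS]ltn_neqAle andbC.
Qed.

Let S_mono w k l : (k <= l)%N -> S w k <= S w l.
Proof.
move=> kl; rewrite /S [leRHS](bigID (fun b : 'I_d.+1 => (b < k)%N))/=.
rewrite [X in _ <= X + _](eq_bigl (fun b : 'I_d.+1 => (b < k)%N)) => [|b].
  by rewrite lerDl sumr_ge0.
by case: (ltnP b k) => h; rewrite ?andbF// andbT (leq_trans h).
Qed.

Fixpoint left_end w : R := if w is a :: w' then left_end w' + S w' a else 0.

Let I w t := (left_end w <= t) && (t < left_end w + Q w).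

Let I_cons a w t : I (a :: w) t ->  I w t.
Proof.
rewrite /I /= => /andP[h1 h2]; apply/andP; split.
  by apply: le_trans h1; rewrite lerDl -(S0 w) S_mono.
apply: (lt_le_trans h2); rewrite -addrA lerD2l -SS -[leRHS]Stop S_mono//.
Qed.

Let I_exists w t : I w t -> exists a, I (a :: w) t.
Proof.
move=> /andP[h1 h2].
have ex : exists k, t < left_end w + S w k by exists d.+1; rewrite Stop.
case: (ex_minnP ex) => -[|k]; first by rewrite S0 addr0 ltNge h1.
move=> hk kmin; have kd : (k < d.+1)%N by apply: kmin; rewrite Stop.
exists (Ordinal kd); rewrite /I /=; apply/andP; split.
  by rewrite leNgt; apply/negP => /kmin; rewrite ltnn.
by move: hk; rewrite (SS w (Ordinal kd)) addrA.
Qed.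

Let I_inj a b w t : I (a :: w) t -> I (b :: w) t -> a = b.
Proof.
wlog ab : a b / (a < b)%N.
  move=> h ha hb; case: (ltngtP a b) => [ab|ba|/val_inj//]; first exact: h ab ha hb.
  by apply/esym; exact: h ba hb ha.
rewrite /I /= => /andP[_ h1] /andP[h2 _]; exfalso.
move: h1; rewrite -addrA -SS => h1.
have := lt_le_trans h1 (lerD (lexx (left_end w)) (S_mono w ab)).
by rewrite ltNge h2.
Qed.

Let letter t w := odflt ord0 [pick a | I (a :: w) t].

Fixpoint coded_prefix t n : seq 'I_d.+1 :=
  if n is m.+1 then letter t (coded_prefix t m) :: coded_prefix t m else [::].

(** The letters are those of the nested intervals containing t. Points outside [0, 1[ go to the
    constant sequence [ord0]; this is the origin of the null set [junk]. *)
Let coding t : Omega d :=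
  fun n => if (0 <= t) && (t < 1) then letter t (coded_prefix t n) else ord0.

Let coding_prefix t n : 0 <= t -> t < 1 -> rprefix n (coding t) = coded_prefix t n.
Proof. by move=> t0 t1; elim: n => //= n ->; rewrite /coding t0 t1. Qed.

Let letter_in t w : I w t -> I (letter t w :: w) t.
Proof.
move=> /I_exists[a ha]; rewrite /letter; case: pickP => [//|/(_ a)].
by rewrite ha.
Qed.

Let coded_in t n : 0 <= t -> t < 1 -> I (coded_prefix t n) t.
Proof.
move=> t0 t1; elim: n => [|n IH] /=; last exact: letter_in.
by rewrite /I /= Q1 add0r t0 t1.
Qed.

Let I_nil w t : I w t -> (0 <= t) && (t < 1).
Proof. by elim: w => [|a w IH]; [rewrite /I /= Q1 add0r|move=> /I_cons]. Qed.

Let in_coded x n t : I (rprefix n x) t -> coded_prefix t n = rprefix n x.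
Proof.
elim: n => [//|n IH] /= h; have h' := I_cons h.
rewrite IH//; congr (_ :: _); apply: (@I_inj _ _ (rprefix n x) t) => //.
exact: letter_in.
Qed.

Let junk : set R := ~` `[0, 1[.

Let coding_cyl n x : coding @^-1` cyl n x =
  `[left_end (rprefix n x), left_end (rprefix n x) + Q (rprefix n x)[%classic `|`
  (if `[< cyl n x (fun=> ord0) >] then junk else set0).
Proof.
apply/seteqP; split => t /=.
  move=> /rprefix_agree h; have [/andP[t0 t1]|t01] := boolP ((0 <= t) && (t < 1)).
    by left; rewrite in_itv /= h coding_prefix//; exact: coded_in.
  right; case: asboolP => [_|]; first by rewrite /junk /= in_itv /=; exact/negP.
  by apply; apply/rprefix_agree; rewrite h; congr rprefix; apply: funext => i; rewrite /coding (negbTE t01).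
move=> [|].
  rewrite in_itv /= => h; have /andP[t0 t1] := I_nil h.
  by apply/rprefix_agree; rewrite coding_prefix// (in_coded h).
case: asboolP => // hx; rewrite /junk /= in_itv /= => /negP t01.
apply: agree_trans hx _ => i _; by rewrite /coding (negbTE t01).
Qed.

Let measurable_coding : measurable_fun setT (coding : measurableTypeR R -> Omega d).
Proof.
apply: (measurability cylinders); first exact: measurable_cylinders.
move=> _ [_ [->|[n [x ->]]] <-]; rewrite setTI; first by rewrite preimage_set0.
rewrite coding_cyl; apply: measurableU => //; case: asboolP => _ //.
exact: measurableC.
Qed.

Let U01 : probability (measurableTypeR R) R := uniform_prob (@ltr01 R).

Let U01_itv (l u : R) : 0 <= l -> l <= u -> u <= 1 -> U01 `[l, u[%classic = (u - l)%:E.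
Proof.
move=> l0 lu u1; apply: (etrans (integral_uniform_pdf 0 1 _)); rewrite setIidl; last first.
  by move=> t /=; rewrite !in_itv /= => /andP[h1 h2]; rewrite (le_trans l0 h1) (ltW (lt_le_trans h2 u1)).
rewrite (eq_integral (fun=> 1%:E)); last first.
  move=> t; rewrite inE /= in_itv /= => /andP[h1 h2]; rewrite /uniform_pdf subr0 invr1.
  by rewrite (le_trans l0 h1) (ltW (lt_le_trans h2 u1)).
rewrite integral_cst//= mul1e lebesgue_measure_itv/= lte_fin.
by move: lu; rewrite le_eqVlt => /predU1P[->|->]; rewrite ?ltxx ?subrr.
Qed.

Let left_end_bounds w : 0 <= left_end w /\ left_end w + Q w <= 1.
Proof.
elim: w => [|a w [IH1 IH2]] /=; first by rewrite Q1 add0r.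
have h : 0 <= S w a by rewrite -(S0 w) S_mono.
split; first exact: addr_ge0.
apply: le_trans IH2; rewrite -addrA lerD2l -SS -[leRHS]Stop S_mono//.
Qed.

(** Push the uniform law forward by [coding]: the preimage of a cylinder is an interval of length
    [Q], up to the null set [junk]. *)
Lemma cylinder_extension : exists m : probability (Omega d) R,
  forall n x, m (cyl n x) = (Q (rprefix n x))%:E.
Proof.
pose X : {mfun measurableTypeR R >-> Omega d} :=
  MeasurableFun.Pack (MeasurableFun.Class (isMeasurableFun.Build _ _ _ _ _ measurable_coding)).
exists (distribution U01 X : probability (Omega d) R) => n x.
rewrite /= /pushforward /= coding_cyl.
have [b1 b2] := left_end_bounds (rprefix n x).
have mJ : measurable (junk : set (measurableTypeR R)) by exact: measurableC.
have J0 : U01 junk = 0%E.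
  by rewrite /junk probability_setC//= U01_itv// subr0 subee.
rewrite measureU0//.
- by apply: etrans (U01_itv b1 _ b2) _; rewrite ?lerDl// addrAC subrr add0r.
- by case: asboolP => _.
- by case: asboolP => _ //; rewrite measure0.
Qed.

End CylinderExtension.

(** * The Gibbs measure of a normalised potential *)

Section GibbsMeasure.
Context {R : realType} {d : nat}.
Implicit Types (x y : Omega d) (n k : nat) (f g B : Omega d -> R).
Local Notation shift := (@seq_shift d).
Variables (th K : R) (B : Omega d -> R).
Hypotheses (th0 : 0 < th) (th1 : th < 1) (hB : regular th K B) (nB : normalised B).

Definition ind_cyl n x : Omega d -> R := \1_(cyl n x).

Lemma ind_cylE n x y : ind_cyl n x y = `[< agree n x y >]%:R.
Proof. by rewrite /ind_cyl indicE; congr (nat_of_bool _)%:R; apply/idP/asboolP; rewrite inE. Qed.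

(** The indicator can differ only at points agreeing on m < n letters; it then differs by at most 1,
    and th^-n th^m >= 1. *)
Lemma regular_ind_cyl n x : regular th (th ^- n) (ind_cyl n x).
Proof.
move=> m y z yz; rewrite !ind_cylE.
have [nm|mn] := leqP n m.
  have -> : `[< agree n x y >] = `[< agree n x z >].
    apply/asboolP/asboolP => h; apply: agree_trans h _; apply: agreeW nm _ => //.
    exact: agree_sym.
  by rewrite subrr normr0 mulr_ge0// ?invr_ge0 exprn_ge0// ltW.
apply: (@le_trans _ _ 1).
  by case: asboolP => _; case: asboolP => _; rewrite ?subrr ?subr0 ?sub0r ?normrN ?normr0 ?normr1.
rewrite mulrC ler_pdivlMr ?exprn_gt0// mul1r ler_wiXn2l ?ltW//.
exact: ltnW.
Qed.

Lemma regular_sum (I : finType) (F : I -> Omega d -> R) :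
  (forall i, exists L, regular th L (F i)) ->
  exists L, regular th L (fun x => \sum_i F i x).
Proof.
move=> hF; elim: (index_enum I) => [|i r [L hL]].
  by exists 0; under eq_fun do rewrite big_nil; exact: regular_cst.
have [L' hL'] := hF i; exists (L' + L).
by under eq_fun do rewrite big_cons; exact: regularD.
Qed.

Lemma mean_sum (I : finType) (F : I -> Omega d -> R) :
  (forall i, exists L, regular th L (F i)) ->
  mean B (fun x => \sum_i F i x) = \sum_i mean B (F i).
Proof.
move=> hF; suff H r : (exists L, regular th L (fun x => \sum_(i <- r) F i x)) /\
    mean B (fun x => \sum_(i <- r) F i x) = \sum_(i <- r) mean B (F i) by exact: (H _).2.
elim: r => [|i r [[L hL] IH]].
  rewrite (_ : (fun x => \sum_(i <- [::]) F i x) = fun=> 0); last first.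
    by apply: funext => x; rewrite big_nil.
  by rewrite big_nil (mean_cst nB); split => //; exists 0; exact: regular_cst.
have [L' hL'] := hF i.
rewrite (_ : (fun x => \sum_(j <- i :: r) F j x) =
  fun x => F i x + \sum_(j <- r) F j x); last by apply: funext => x; rewrite big_cons.
rewrite big_cons (meanD th0 th1 hB nB hL' hL) IH; split => //.
by exists (L' + L); exact: regularD.
Qed.

Let Q (w : seq 'I_d.+1) : R := mean B (ind_cyl (size w) (extend (rev w))).

Let Q1 : Q [::] = 1.
Proof.
rewrite /Q (_ : ind_cyl _ _ = fun=> 1) ?(mean_cst nB)//.
by apply: funext => y; rewrite ind_cylE; case: asboolP => // -[].
Qed.

Let Q0 w : 0 <= Q w.
Proof.
rewrite -(mean_cst nB 0); apply: (mean_le th0 th1 hB nB (regular_cst th 0) (regular_ind_cyl _ _)).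
by move=> y; rewrite ind_cylE ler0n.
Qed.

Let Qsum w : Q w = \sum_(a < d.+1) Q (a :: w).
Proof.
rewrite /Q -mean_sum; last by move=> a; eexists; exact: regular_ind_cyl.
congr mean; apply: funext => y.
have E (a : 'I_d.+1) : `[< agree (size w).+1 (extend (rev (a :: w))) y >] =
    `[< agree (size w) (extend (rev w)) y >] && (a == y (size w)).
  rewrite rev_cons /extend; apply/asboolP/andP.
    move=> h; split.
      apply/asboolP => i hi; rewrite -(h i (ltnW hi)) nth_rcons size_rev hi//.
    by apply/eqP; rewrite -(h (size w) (ltnSn _)) nth_rcons size_rev ltnn eqxx.
  move=> [/asboolP h /eqP h'] i; rewrite ltnS leq_eqVlt => /predU1P[->|hi].
    by rewrite nth_rcons size_rev ltnn eqxx.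
  by rewrite nth_rcons size_rev hi; exact: h.
under eq_bigr do rewrite ind_cylE E.
rewrite ind_cylE (bigD1 (y (size w)))//= eqxx andbT big1 ?addr0//.
by move=> a /negPf ->; rewrite andbF.
Qed.

Let rev_rprefix n x : rev (rprefix n x) = prefix n x.
Proof.
elim: n => [//|n IH] /=; rewrite rev_cons IH /prefix.
have E : iota 0 n.+1 = rcons (iota 0 n) n by rewrite -addn1 iotaD cats1.
by rewrite /mkseq E map_rcons.
Qed.

Let size_rprefix n x : size (rprefix n x) = n.
Proof. by rewrite -size_rev rev_rprefix size_mkseq. Qed.

Let mass_exists : exists m : probability (Omega d) R,
  forall n x, pr m (cyl n x) = mean B (ind_cyl n x).
Proof.
have [m hm] := cylinder_extension Q1 Q0 Qsum.
exists m => n x; rewrite /pr hm /= /Q size_rprefix rev_rprefix /ind_cyl; congr (mean B \1_ _).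
by apply: cyl_eq; apply: agree_sym; exact: extend_prefix.
Qed.

(** Replace f by its value at the padded n-letter prefix: both sides then become the same finite sum
    over words, and each moves by at most W th^n. *)
Lemma mean_mass (m : probability (Omega d) R) :
  (forall n x, pr m (cyl n x) = mean B (ind_cyl n x)) ->
  forall W f, regular th W f -> Ex m f = mean B f.
Proof.
move=> hm W f hf.
have bf := bm_regular th0 th1 hf.
suff H n : `|Ex m f - mean B f| <= 0 + 2 * W * th ^+ n.
  apply/eqP; rewrite -subr_eq0 -normr_le0.
  exact: (le_geometric th0 th1 H).
pose fn x := \sum_(w : {ffun 'I_n -> 'I_d.+1}) f (of_word w) * ind_cyl n (of_word w) x.
have fnE x : fn x = f (of_word (word n x)).
  rewrite /fn (bigD1 (word n x))//= big1 ?addr0 => [|w hw].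
    rewrite ind_cylE; case: asboolP => [_|]; first by rewrite mulr1.
    by case; apply: agree_sym; exact: agree_of_word.
  rewrite ind_cylE; case: asboolP => [/wordP h|_]; last by rewrite mulr0.
  by move: hw; rewrite -h of_wordK eqxx.
have hreg (w : {ffun 'I_n -> 'I_d.+1}) : exists L, regular th L (fun x => f (of_word w) * ind_cyl n (of_word w) x).
  by eexists; apply: regularZ; exact: regular_ind_cyl.
have [L hL] : exists L, regular th L fn := regular_sum hreg.
have bi (w : {ffun 'I_n -> 'I_d.+1}) : bounded_measurable (ind_cyl n (of_word w)).
  by apply: bm_indic; exact: measurable_cyl.
have E : Ex m fn = mean B fn.
  rewrite /fn Ex_sum => [|w]; last exact: bmZ.
  rewrite mean_sum//; apply: eq_bigr => w _; rewrite ExZ//.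
  rewrite (meanZ th0 th1 hB nB _ (regular_ind_cyl _ _)) -hm; congr (_ * _).
  by rewrite /ind_cyl Ex_indic//; exact: measurable_cyl.
have ffn x : `|f x - fn x| <= W * th ^+ n by rewrite fnE; apply: hf; exact: agree_of_word.
have h1 := Ex_abs_le m bf (bm_regular th0 th1 hL) ffn.
have h2 : mean B f <= mean B (fun x => fn x + W * th ^+ n).
  apply: (mean_le th0 th1 hB nB hf (regularD hL (regular_cst th _))) => x.
  by have := ffn x; rewrite ler_norml; lra.
have h3 : mean B fn <= mean B (fun x => f x + W * th ^+ n).
  apply: (mean_le th0 th1 hB nB hL (regularD hf (regular_cst th _))) => x.
  by have := ffn x; rewrite ler_norml; lra.
rewrite (meanD th0 th1 hB nB hL (regular_cst th _)) (mean_cst nB) in h2.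
rewrite (meanD th0 th1 hB nB hf (regular_cst th _)) (mean_cst nB) in h3.
by move: h1; rewrite E add0r !ler_norml; lra.
Qed.

Lemma tr_ind_cyl n x z : tr B (ind_cyl n.+1 x) z =
  expR (B (cons_letter (x 0%N) z)) * ind_cyl n (shift x) z.
Proof.
rewrite /tr (bigD1 (x 0%N : 'I_d.+1))//= [X in _ + X]big1 ?addr0 => [|a ha].
  rewrite !ind_cylE; congr (_ * (nat_of_bool _)%:R); apply/asboolP/asboolP => h.
    by rewrite -(shift_cons (x 0%N) z); exact: agree_shift.
  by rewrite -{1}(cons_shift x); exact: agree_cons.
rewrite ind_cylE; case: asboolP => [h|_]; last by rewrite mulr0.
have h0 : x 0%N = a := h 0%N (ltn0Sn _).
by rewrite h0 eqxx in ha.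
Qed.

Let D := K / (1 - th).

(** Invariance under [tr B] peels off the first letter, with an error K th^(n+1) in the exponent.
    The factor 1 - th^n lets the errors telescope, since D (th^n - th^(n+1)) = K th^n. *)
Lemma mean_ind_cyl_bounds n x :
  expR (birk n B x - D * (1 - th ^+ n)) <= mean B (ind_cyl n x) /\
  mean B (ind_cyl n x) <= expR (birk n B x + D * (1 - th ^+ n)).
Proof.
elim: n x => [|n IH] x.
  rewrite expr0 subrr mulr0 birk0 subr0 addr0 expR0.
  have -> : ind_cyl 0 x = fun=> 1.
    by apply: funext => y; rewrite ind_cylE; case: asboolP => // -[].
  by rewrite (mean_cst nB).
have [IH1 IH2] := IH (shift x).
have Dn : K * th ^+ n.+1 <= D * (th ^+ n - th ^+ n.+1).
  have -> : D * (th ^+ n - th ^+ n.+1) = K * th ^+ n.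
    by rewrite /D exprS; field; rewrite gt_eqF// subr_gt0.
  by rewrite ler_wpM2l ?(regular_ge0 hB)// exprS ler_piMl ?exprn_ge0// ltW.
have Bz z : agree n (shift x) z -> `|B x - B (cons_letter (x 0%N) z)| <= K * th ^+ n.+1.
  by move=> h; apply: hB; rewrite -{1}(cons_shift x); exact: agree_cons.
have [V hV] := regular_tr th0 hB nB (regular_ind_cyl n.+1 x).
rewrite -(mean_tr th0 th1 hB nB (regular_ind_cyl n.+1 x)) birkS; split.
  apply: (@le_trans _ _ (expR (B x - K * th ^+ n.+1) * mean B (ind_cyl n (shift x)))).
    apply: le_trans (ler_wpM2l (expR_ge0 _) IH1).
    by rewrite -expRD ler_expR; lra.
  rewrite -(meanZ th0 th1 hB nB _ (regular_ind_cyl n (shift x))).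
  apply: (mean_le th0 th1 hB nB (regularZ _ (regular_ind_cyl n (shift x))) hV) => z.
  rewrite tr_ind_cyl ind_cylE; case: asboolP => [h|_]; last by rewrite !mulr0.
  by rewrite !mulr1 ler_expR; have := Bz _ h; rewrite ler_norml; lra.
apply: (@le_trans _ _ (expR (B x + K * th ^+ n.+1) * mean B (ind_cyl n (shift x)))).
  rewrite -(meanZ th0 th1 hB nB _ (regular_ind_cyl n (shift x))).
  apply: (mean_le th0 th1 hB nB hV (regularZ _ (regular_ind_cyl n (shift x)))) => z.
  rewrite tr_ind_cyl ind_cylE; case: asboolP => [h|_]; last by rewrite !mulr0.
  by rewrite !mulr1 ler_expR; have := Bz _ h; rewrite ler_norml; lra.
apply: (le_trans (ler_wpM2l (expR_ge0 _) IH2)).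
by rewrite -expRD ler_expR; lra.
Qed.

(** Bowen's Gibbs property, with [c] in the role of the pressure and a constant [C] uniform in n and
    x. *)
Definition gibbs_bounds (m : probability (Omega d) R) A (c C : R) := forall n x,
  expR (birk n A x - n%:R * c - C) <= pr m (cyl n x) /\
  pr m (cyl n x) <= expR (birk n A x - n%:R * c + C).

Lemma gibbs_measure_exists : exists m : probability (Omega d) R,
  [/\ Defs.invariant m, forall W f, regular th W f -> Ex m f = mean B f &
      exists C, gibbs_bounds m B 0 C].
Proof.
have [m hm] := mass_exists; have hmean := mean_mass hm.
exists m; split => //; last first.
  exists D => n x; rewrite mulr0 subr0 hm.
  have [h1 h2] := mean_ind_cyl_bounds n x.
  have Dn : D * (1 - th ^+ n) <= D.
    rewrite ler_piMr//; first by rewrite /D divr_ge0 ?(regular_ge0 hB)// subr_ge0 ltW.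
    by rewrite lerBlDl lerDr exprn_ge0// ltW.
  split; first by apply: le_trans h1; rewrite ler_expR; lra.
  by apply: (le_trans h2); rewrite ler_expR; lra.
pose X : {mfun Omega d >-> Omega d} :=
  MeasurableFun.Pack (MeasurableFun.Class (isMeasurableFun.Build _ _ _ _ _ (@measurable_shift d))).
apply: (@same_probability_cyl _ _ (distribution m X) m) => n x.
rewrite /= /pushforward /=.
have mc := measurable_cyl n x; have ms : measurable (shift @^-1` cyl n x).
  by have := @measurable_shift d measurableT _ mc; rewrite setTI.
have E : pr m (shift @^-1` cyl n x) = pr m (cyl n x).
  have h := regular_ind_cyl n x.
  apply: etrans (esym (Ex_indic m ms)) (etrans _ (Ex_indic m mc)).
  apply: etrans (hmean _ _ (regular_shift th0 th1 h)) (etrans _ (esym (hmean _ _ h))).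
  exact: (mean_shift th0 th1 hB nB h).
by apply: etrans (etrans (esym (pr_EFin m ms)) _) (pr_EFin m mc); rewrite E.
Qed.

End GibbsMeasure.

(** * Approximation of measurable partitions by cylinders *)

Section PartitionApproximation.
Context {R : realType} {d : nat}.
Variable nu : probability (Omega d) R.
Implicit Types (x y : Omega d) (A B C : set (Omega d)).

Definition determined L C := forall x y, agree L x y -> C x -> C y.

Lemma measurable_determined L C : determined L C -> measurable C.
Proof.
move=> hC; rewrite (_ : C = [set x | [pred w | `[< C (of_word w) >]] (word L x)]).
  by apply: measurable_label_set; exact: measurable_word_label.
apply/seteqP; split => x /= h.
  by apply/asboolP; apply: hC h; exact: agree_of_word.
by move/asboolP : h; apply: hC; apply: agree_sym; exact: agree_of_word.
Qed.

Lemma pr_setU_le A B : measurable A -> measurable B ->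
  pr nu (A `|` B) <= pr nu A + pr nu B.
Proof.
move=> mA mB; rewrite -lee_fin EFinD !pr_EFin//; last exact: measurableU.
exact: measureU2.
Qed.

Definition symdiff A C := (A `\` C) `|` (C `\` A).

Lemma measurable_symdiff A C : measurable A -> measurable C -> measurable (symdiff A C).
Proof. by move=> mA mC; apply: measurableU; exact: measurableD. Qed.

(** Class of good sets: it turns out to be a sigma-algebra containing the cylinders. Measurability
    is part of it so that masses of differences can be computed. *)
Definition approximable A := measurable A /\ forall e, 0 < e ->
  exists L C, determined L C /\ pr nu (symdiff A C) <= e.

Lemma pr_set0 : pr nu set0 = 0.
Proof. by rewrite /pr measure0. Qed.

Lemma approximable_determined L C : determined L C -> approximable C.
Proof.
move=> hC; split; first exact: measurable_determined hC.
by move=> e e0; exists L, C; split=> //; rewrite /symdiff setDv setU0 pr_set0 ltW.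
Qed.

Lemma approximableC A : approximable A -> approximable (setT `\` A).
Proof.
move=> [mA hA]; split; first exact: measurableD.
move=> e /hA[L [C [hC h]]]; exists L, (~` C); split.
  by move=> x y xy nCx Cy; apply: nCx; apply: hC Cy; exact: agree_sym.
apply: le_trans h; rewrite le_eqVlt; apply/orP; left; apply/eqP; congr (pr nu _).
by rewrite /symdiff setTD !setDE !setCK setUC [X in X `|` _]setIC [X in _ `|` X]setIC setUC.
Qed.

Lemma approximableU A B : approximable A -> approximable B -> approximable (A `|` B).
Proof.
move=> [mA hA] [mB hB]; split; first exact: measurableU.
move=> e e0; have e20 : 0 < e / 2 by lra.
have [L [C [hC h]]] := hA _ e20; have [M [D [hD h']]] := hB _ e20.
exists (maxn L M), (C `|` D); split.
  move=> x y xy [Cx|Dx]; [left; apply: hC Cx|right; apply: hD Dx]; apply: agreeW xy.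
    exact: leq_maxl.
  exact: leq_maxr.
have mC := measurable_determined hC; have mD := measurable_determined hD.
have m1 := measurable_symdiff mA mC; have m2 := measurable_symdiff mB mD.
apply: (@le_trans _ _ (pr nu (symdiff A C `|` symdiff B D))).
  apply: pr_le; [|exact: measurableU|].
    by apply: measurable_symdiff; exact: measurableU.
  move=> x [[[Ax|Bx] nCD]|[[Cx|Dx] nAB]].
  - by left; left; split => // Cx; apply: nCD; left.
  - by right; left; split => // Dx; apply: nCD; right.
  - by left; right; split => // Ax; apply: nAB; left.
  - by right; right; split => // Bx; apply: nAB; right.
apply: (le_trans (pr_setU_le m1 m2)); lra.
Qed.

(** By continuity from below a finite union already misses at most e / 2 of the mass, and it is
    approximable by induction. *)
Lemma approximable_bigcup (F : nat -> set (Omega d)) : (forall n, approximable (F n)) ->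
  approximable (\bigcup_n F n).
Proof.
move=> hF; have mF n : measurable (F n) by have [] := hF n.
have mU : measurable (\bigcup_n F n) by exact: bigcup_measurable.
split=> // e e0; have e20 : 0 < e / 2 by lra.
pose G n := \big[setU/set0]_(i < n) F i.
have hG n : approximable (G n).
  elim: n => [|n IH].
    rewrite /G big_ord0; apply: (@approximable_determined 0); by move=> x y _ [].
  by rewrite /G big_ord_recr; exact: approximableU.
have mG n : measurable (G n) by have [] := hG n.
have GF n : G n `<=` \bigcup_n F n.
  elim: n => [|n IH] x; first by rewrite /G big_ord0.
  by rewrite /G big_ord_recr => -[/IH//|Fx]; exists n.
have cG : \bigcup_n G n = \bigcup_n F n.
  apply/seteqP; split => x [n _]; first exact: GF.
  move=> Fx; exists n.+1 => //; rewrite /G big_ord_recr; by right.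
have : nu \o G @ \oo --> nu (\bigcup_n G n).
  apply: nondecreasing_cvg_mu => //; first by rewrite cG.
  apply/nondecreasing_seqP => n; apply/subsetPset => x Gx.
  by rewrite /G big_ord_recr; left.
rewrite cG -(pr_EFin nu mU) => /fine_cvg /= hcv.
have : \forall n \near \oo, pr nu (\bigcup_n F n) - e / 2 <= pr nu (G n).
  by apply: (cvgr_ge _ hcv); lra.
case=> N _ /(_ N (leqnn N)) hN.
have [L [C [hC h]]] := (hG N).2 _ e20.
exists L, C; split=> //; have mC := measurable_determined hC.
have hdiff : pr nu ((\bigcup_n F n) `\` G N) <= e / 2.
  have E : pr nu (\bigcup_n F n) = pr nu (G N) + pr nu ((\bigcup_n F n) `\` G N).
    apply: EFin_inj; rewrite EFinD !pr_EFin//; last exact: measurableD.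
    rewrite -measureU//; [|exact: measurableD|by rewrite setDE setICA setICr setI0].
    by congr (nu _); rewrite setDUK.
  lra.
apply: (@le_trans _ _ (pr nu ((\bigcup_n F n) `\` G N `|` symdiff (G N) C))).
  apply: pr_le; first exact: measurable_symdiff.
    by apply: measurableU; [exact: measurableD|exact: measurable_symdiff].
  move=> x [[Fx nC]|[Cx nF]].
    by have [Gx|nG] := pselect (G N x); [right; left|left].
  by right; right; split=> // /GF.
apply: (le_trans (pr_setU_le _ _)); [exact: measurableD|exact: measurable_symdiff|lra].
Qed.

Lemma measurable_approximable B : measurable B -> approximable B.
Proof.
suff : <<s @cylinders d >> `<=` approximable by rewrite -measurable_cylinders => /(_ B).
apply: smallest_sub.
  split; first by apply: (@approximable_determined 0) => x y _ [].
  - by move=> A; exact: approximableC.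
  - by move=> F; exact: approximable_bigcup.
move=> _ [->|[n [x ->]]].
  by apply: (@approximable_determined 0) => x y _ [].
by apply: (@approximable_determined n) => y z yz xy; exact: agree_trans xy yz.
Qed.

(** Each cell is approximated up to e / k, and f picks a cell whose approximation contains the
    point. Off all the symmetric differences the only such cell is that of xi, so f = xi there. *)
Lemma partition_approx (k : nat) (xi : Omega d -> 'I_k) (e : R) :
  measurable_label xi -> 0 < e ->
  exists L (f : Omega d -> 'I_k), (forall x y, agree L x y -> f x = f y) /\
    pr nu [set x | xi x != f x] <= e.
Proof.
move=> hxi e0; have k0 : (0 < k)%N by apply: leq_ltn_trans (ltn_ord (xi point)).
have ek0 : 0 < e / k%:R by rewrite divr_gt0 ?ltr0n.
have /choice[LC hLC] : forall j : 'I_k, exists LC : nat * set (Omega d),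
    determined LC.1 LC.2 /\ pr nu (symdiff [set x | xi x = j] LC.2) <= e / k%:R.
  move=> j; have [L [C h]] := (measurable_approximable (hxi j)).2 _ ek0.
  by exists (L, C).
pose L := \max_j (LC j).1.
pose f x := odflt (xi point) [pick j | `[< (LC j).2 x >]].
have detj j x y : agree L x y -> (LC j).2 x -> (LC j).2 y.
  by move=> xy; apply: (hLC j).1; apply: agreeW xy; exact: (leq_bigmax j).
have detf x y : agree L x y -> f x = f y.
  move=> xy; rewrite /f; congr odflt; apply: eq_pick => j.
  by apply/asboolP/asboolP; apply: detj => //; exact: agree_sym.
exists L, f; split=> //.
have mj j : measurable (symdiff [set x | xi x = j] (LC j).2).
  by apply: measurable_symdiff => //; exact: measurable_determined (hLC j).1.
have mf : measurable_label f.
  move=> j; apply: (@measurable_determined L) => x y xy /= <-.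
  by apply: detf; exact: agree_sym.
have sub : [set x | xi x != f x] `<=`
    \big[setU/set0]_(j < k) symdiff [set x | xi x = j] (LC j).2.
  move=> x /= hx; apply: contrapT => hn; move/eqP: hx; apply.
  have h j : xi x = j <-> (LC j).2 x.
    apply: contrapT => hj; apply: hn; rewrite (bigD1 j)//=; left.
    rewrite /symdiff /=; have [e1|e1] := pselect (xi x = j); have [e2|e2] := pselect ((LC j).2 x).
    - by exfalso; apply: hj.
    - by left.
    - by right.
    - by exfalso; apply: hj; split.
  rewrite /f; case: pickP => [j /asboolP /h //|/(_ (xi x))].
  by move/asboolP; case; apply/h.
have mneq : measurable [set x | xi x != f x].
  have := measurable_label_set (fun p => p.1 != p.2) (measurable_label_pair hxi mf).
  exact.
apply: (@le_trans _ _ (\sum_(j < k) pr nu (symdiff [set x | xi x = j] (LC j).2))).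
  apply: (@le_trans _ _ (pr nu (\big[setU/set0]_(j < k) symdiff [set x | xi x = j] (LC j).2))).
    by apply: pr_le => //; exact: bigsetU_measurable.
  set D := fun j => symdiff [set x | xi x = j] (LC j).2.
  suff H r : measurable (\big[setU/set0]_(j <- r) D j) /\
      pr nu (\big[setU/set0]_(j <- r) D j) <= \sum_(j <- r) pr nu (D j) by exact: (H _).2.
  elim: r => [|j r [IH1 IH2]]; first by rewrite !big_nil pr_set0.
  rewrite !big_cons; split; first by apply: measurableU => //; exact: mj.
  by apply: (le_trans (pr_setU_le (mj j) IH1)); rewrite lerD2l.
apply: (@le_trans _ _ (\sum_(j < k) e / k%:R)).
  by apply: ler_sum => j _; exact: (hLC j).2.
by rewrite sumr_const card_ord -[_ *+ k]mulr_natr divfK// pnatr_eq0 -lt0n.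
Qed.

End PartitionApproximation.

(** * Partition entropy against a Gibbs measure *)

Section EntropyBounds.
Context {R : realType} {d : nat}.
Implicit Types (x y : Omega d) (B : Omega d -> R) (nu m : probability (Omega d) R).
Local Notation shift := (@seq_shift d).

(** From ln z <= z - 1 at z = q / a. Summed over a probability a and a sub-probability q, the extra
    terms q - a contribute at most 0. *)
Lemma cross_entropy_term (a b q : R) : 0 <= a -> a <= b -> 0 < q ->
  a * - ln b <= a * - ln q + q - a.
Proof.
move=> a0 ab q0; move: a0; rewrite le_eqVlt => /predU1P[<-|a0].
  by rewrite !mul0r; lra.
have b0 : 0 < b := lt_le_trans a0 ab.
have h1 : ln a <= ln b by rewrite ler_ln ?posrE.
have h2 : ln q - ln a <= q / a - 1.
  rewrite -ln_div ?posrE// -[in leLHS](subrK 1 (q / a)) addrC.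
  by apply: le_ln1Dx; rewrite ltrBrDl subrr divr_gt0.
have h3 := ler_wpM2l (ltW a0) h2.
have h4 := ler_wpM2l (ltW a0) h1.
have h5 : a * (q / a) = q by rewrite mulrCA divff ?mulr1// gt_eqF.
move: h3; rewrite !mulrBr h5; lra.
Qed.

Definition itinerary (k n : nat) (xi : Omega d -> 'I_k) x : {ffun 'I_n -> 'I_k} :=
  [ffun i : 'I_n => xi (iter i shift x)].
Arguments itinerary {k} n.

Lemma join_entropyE nu (k : nat) (xi : Omega d -> 'I_k) n :
  join_entropy nu xi n = \sum_w
    pr nu [set x | itinerary n xi x = w] * - ln (pr nu [set x | itinerary n xi x = w]).
Proof.
apply: eq_bigr => w _; rewrite mulrN /=.
suff -> : [set x | forall i : 'I_n, xi (iter i shift x) = w i] =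
    [set x | itinerary n xi x = w] by [].
apply/seteqP; split => x /= h; first by apply/ffunP => i; rewrite ffunE.
by move=> i; rewrite -h ffunE.
Qed.

Lemma measurable_label_shift (I : finType) (Z : Omega d -> I) n : measurable_label Z ->
  measurable_label (Z \o iter n shift).
Proof.
move=> hZ i; have := @measurable_iter_shift d n measurableT _ (hZ i).
by rewrite setTI.
Qed.

Lemma measurable_itinerary (k : nat) (xi : Omega d -> 'I_k) n : measurable_label xi ->
  measurable_label (itinerary n xi).
Proof.
move=> hxi; apply: (measurable_label_ffun (Z := fun i x => xi (iter i shift x))) => i.
exact: measurable_label_shift.
Qed.

(** An arbitrary partition is invisible to bounds on cylinders, so [xi] is replaced by a label [f]
    read off [L] letters. The joint law under nu of the itinerary and of the word of length n + L is
    compared with q: the word has its m-mass, and each label is a noisy copy of the f-label. Per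
    unit of time, -ln q then costs -B on average, e / 2 for the noise, and [lam] at the rare times
    where xi and f differ. *)
Lemma join_entropy_upper nu m (k : nat) (xi : Omega d -> 'I_k) B (C th K e : R) :
  0 < th -> th < 1 -> regular th K B -> Defs.invariant nu -> gibbs_bounds m B 0 C ->
  measurable_label xi -> 0 < e ->
  exists C', forall n, join_entropy nu xi n <= n%:R * (- Ex nu B + e) + C'.
Proof.
move=> th0 th1 hB inv hm hxi e0.
have k0 : (0 < k)%N by apply: leq_ltn_trans (ltn_ord (xi point)).
(* A label is copied with weight s, which costs e / 2; any other label has the weight del / k, which
   costs [lam]. The noise keeps q positive where xi and f differ. *)
set s := expR (- (e / 2)); set del := 1 - s.
have s0 : 0 < s by exact: expR_gt0.
have s1 : s < 1 by rewrite -[ltRHS]expR0 ltr_expR; lra.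
have dk0 : 0 < del / k%:R by rewrite divr_gt0 ?ltr0n// /del; lra.
have dk1 : del / k%:R <= 1.
  rewrite ler_pdivrMr ?ltr0n// mul1r; have : 1 <= k%:R :> R by rewrite ler1n.
  by rewrite /del; lra.
set lam := - ln (del / k%:R).
have lam0 : 0 <= lam by rewrite /lam oppr_ge0 -ln1 ler_ln ?posrE.
(* This mass of disagreement, multiplied by [lam], stays below e / 2. *)
have eta0 : 0 < e / 2 / (lam + 1) by rewrite !divr_gt0//; lra.
have [L [f [hf hnu]]] := partition_approx nu hxi eta0.
pose kap (a j : 'I_k) : R := if a == j then s else del / k%:R.
have kap0 a j : 0 < kap a j by rewrite /kap; case: ifP.
have kap_sum j : \sum_a kap a j <= 1.
  rewrite (bigD1 j)//= /kap eqxx.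
  have : \sum_(a < k | a != j) (if a == j then s else del / k%:R) <= \sum_(a < k) del / k%:R.
    rewrite [leRHS](bigD1 j)//= -[leLHS]add0r lerD//; first exact: ltW.
    by apply: ler_sum => a /negPf ->.
  have -> : \sum_(a < k) del / k%:R = del.
    by rewrite sumr_const card_ord -[LHS]mulr_natr divfK// pnatr_eq0 -lt0n.
  by rewrite /del; lra.
have mf : measurable_label f.
  move=> j; apply: (@measurable_determined _ L) => x y xy /= <-.
  by apply: hf; exact: agree_sym.
pose bad := [set x | xi x != f x].
have mbad : measurable bad.
  exact: (measurable_label_set (fun p => p.1 != p.2) (measurable_label_pair hxi mf)).
pose g x : R := e / 2 + lam * \1_bad x.
have bB := bm_regular th0 th1 hB.
have bbad : bounded_measurable (\1_bad : Omega d -> R) by exact: bm_indic.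
have bg : bounded_measurable g by apply: bmD; [exact: bm_cst|exact: bmZ].
have Exg : Ex nu g <= e.
  rewrite /g ExD; [|exact: bm_cst|exact: bmZ].
  rewrite Ex_cst ExZ// Ex_indic//.
  have h : lam * pr nu bad <= lam * (e / 2 / (lam + 1)) by rewrite ler_wpM2l.
  have h2 : lam * (e / 2 / (lam + 1)) <= e / 2.
    by rewrite mulrA ler_pdivrMr; nra.
  by have h3 := le_trans h h2; move: h3; rewrite /pr; lra.
exists (C - L%:R * Ex nu B) => n; set M := (n + L)%N.
pose V := itinerary n xi; pose W := @word d M.
have mV : measurable_label V by exact: measurable_itinerary.
have mW : measurable_label W by exact: measurable_word_label.
pose Z x := (V x, W x).
have mZ : measurable_label Z by exact: measurable_label_pair.
pose jt (i : 'I_n) (w : {ffun 'I_M -> 'I_d.+1}) := f (iter i shift (of_word w)).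
pose q (p : {ffun 'I_n -> 'I_k} * {ffun 'I_M -> 'I_d.+1}) : R :=
  pr m (cyl M (of_word p.2)) * \prod_(i < n) kap (p.1 i) (jt i p.2).
have mass0 x : 0 < pr m (cyl M x) by apply: lt_le_trans (hm M x).1; exact: expR_gt0.
have q0 p : 0 < q p by rewrite mulr_gt0// prodr_gt0.
have q1 : \sum_p q p <= 1.
  rewrite -(pair_bigA _ (fun v w => q (v, w)))/= exchange_big/=.
  rewrite -(label_pr_sum1 m (@measurable_word_label d M)); apply: ler_sum => w _.
  rewrite word_cyl /q /= -mulr_sumr -(bigA_distr_bigA (fun i a => kap a (jt i w))).
  rewrite ler_piMr ?pr_ge0// prodr_ile1// => i _.
  by rewrite kap_sum andbT sumr_ge0// => a _; exact: ltW.
pose b v := pr nu [set x | V x = v].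
pose a p := pr nu [set x | Z x = p].
(* The entropy is an expectation over the pair of labels, so that the mass [b p.1] of the itinerary
   dominates the joint mass [a p]. *)
have H : join_entropy nu xi n = \sum_p a p * - ln (b p.1).
  rewrite join_entropyE -/V -(Ex_label nu (fun v => - ln (b v)) mV).
  exact: (Ex_label nu (fun p => - ln (b p.1)) mZ).
have ab p : a p <= b p.1.
  by apply: pr_le; [exact: mZ|exact: mV|move=> x /= <-].
have H1 : join_entropy nu xi n <= Ex nu ((fun p => - ln (q p)) \o Z).
  rewrite H (Ex_label nu (fun p => - ln (q p)) mZ).
  have h1 : \sum_p a p * - ln (b p.1) <= \sum_p (a p * - ln (q p) + q p - a p).
    by apply: ler_sum => p _; apply: cross_entropy_term => //; exact: pr_ge0.
  have h2 : \sum_p a p = 1 := label_pr_sum1 nu mZ.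
  rewrite -[X in _ <= X]/(\sum_p a p * - ln (q p)).
  by move: h1; rewrite sumrB big_split/= h2; move: q1; lra.
apply: (le_trans H1).
pose U x := birk n g x + (C + -1 * birk M B x).
have hU x : - ln (q (Z x)) <= U x.
  rewrite -[U x]opprK lerN2 -[leLHS]expRK ler_ln ?posrE ?expR_gt0//.
  have -> : - U x = (birk M B x - C) + \sum_(i < n) - g (iter i shift x).
    by rewrite sumrN -[X in _ - X]/(birk n g x) /U; ring.
  rewrite expRD expR_sum /q /=; apply: ler_pM; rewrite ?expR_ge0//.
  - by apply: prodr_ge0 => i _; exact: expR_ge0.
  - rewrite (cyl_eq (agree_sym (agree_of_word (n := M) x))).
    by have := (hm M x).1; rewrite mulr0 subr0.
  - apply: ler_prod => i _; rewrite expR_ge0 /=.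
    have -> : jt i (W x) = f (iter i shift x).
      apply: hf; apply: agree_sym; apply: agree_iter_shift.
      apply: agreeW (agree_of_word (n := M) x).
      by rewrite /M leq_add2r ltnW.
    rewrite /V ffunE /kap /g indicE; set y := iter i shift x.
    have [E|E] := eqVneq (xi y) (f y).
      by rewrite memNset ?mulr0 ?addr0//= /bad /= E eqxx.
    rewrite mem_set//= mulr1 opprD expRD /lam opprK lnK ?posrE//.
    by rewrite ler_piMl ?ltW.
have bZ : bounded_measurable ((fun p => - ln (q p)) \o Z) by exact: bm_label.
have bC : bounded_measurable (fun x => C + -1 * birk M B x).
  by apply: bmD; [exact: bm_cst|apply: bmZ; exact: bm_birk].
have bU : bounded_measurable U by apply: bmD => //; exact: bm_birk.
apply: (le_trans (Ex_le nu bZ bU hU)).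
rewrite /U ExD ?ExD ?ExZ ?Ex_cst//; try exact: bm_birk; try exact: bm_cst; last first.
  by apply: bmZ; exact: bm_birk.
rewrite !Ex_birk// /M natrD.
have := ler_wpM2l (ler0n R n) Exg; lra.
Qed.

Lemma normalised_le0 B : normalised B -> forall x, B x <= 0.
Proof.
move=> nB x; rewrite -ler_expR expR0 -(nB (shift x)) -{1}(cons_shift x).
rewrite [leRHS](bigD1 (x 0%N : 'I_d.+1))//= lerDl.
by apply: sumr_ge0 => a _; exact: expR_ge0.
Qed.

Lemma partition_entropy_le nu m (k : nat) (xi : Omega d -> 'I_k) B (C th K : R) :
  0 < th -> th < 1 -> regular th K B -> normalised B -> Defs.invariant nu ->
  gibbs_bounds m B 0 C -> measurable_label xi ->
  partition_entropy nu xi <= - Ex nu B.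
Proof.
move=> th0 th1 hB nB inv hm hxi.
have ExB : Ex nu B <= 0.
  rewrite -(Ex_cst nu 0); apply: Ex_le; [exact: bm_regular hB|exact: bm_cst|].
  exact: normalised_le0.
rewrite /partition_entropy.
(* If the sequence diverges, [lim] takes its default value 0, and the bound holds because B <= 0. *)
have [hc|/dvgP ->] := pselect (cvg (n%:R^-1 * join_entropy nu xi n @[n --> \oo])); last first.
  by rewrite -[point]/(0 : R); lra.
apply/ler_addgt0Pr => e e0; have e20 : 0 < e / 2 by lra.
have [C' hC'] := join_entropy_upper th0 th1 hB inv hm hxi e20.
apply: limr_le => //.
near=> n.
have n0 : 0 < n%:R :> R by rewrite ltr0n; near: n; exact: nbhs_infty_gt.
rewrite ler_pdivrMl//; apply: (le_trans (hC' n)).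
have : C' / (e / 2) <= n%:R by near: n; exact: nbhs_infty_ger.
rewrite ler_pdivrMr//; lra.
Unshelve. all: by end_near.
Qed.

Definition first_letter x : 'I_d.+1 := x 0%N.

Lemma measurable_first_letter : measurable_label first_letter.
Proof.
move=> a; apply: (@measurable_determined _ 1%N) => x y xy /= <-.
by rewrite /first_letter (xy 0%N).
Qed.

(** Itineraries of first letters are cylinders, where -ln of the mass is minus the Birkhoff sum of B
    up to C. Integration bounds the distance of the join entropy from n times -[Ex m B] by C, so the
    limit exists without subadditivity. *)
Lemma partition_entropy_gibbs m B (C th K : R) :
  0 < th -> th < 1 -> regular th K B -> Defs.invariant m ->
  gibbs_bounds m B 0 C -> partition_entropy m first_letter = - Ex m B.
Proof.
move=> th0 th1 hB inv hm.
have bB := bm_regular th0 th1 hB.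
have H n : `|join_entropy m first_letter n - n%:R * - Ex m B| <= C.
  have mI := measurable_itinerary (n := n) measurable_first_letter.
  set b := fun w => pr m [set x | itinerary n first_letter x = w].
  have -> : join_entropy m first_letter n = Ex m ((fun w => - ln (b w)) \o itinerary n first_letter).
    by rewrite join_entropyE Ex_label.
  rewrite -[X in _ - X](_ : Ex m (fun x => -1 * birk n B x) = _); last first.
    by rewrite ExZ ?Ex_birk//; [ring|exact: bm_birk].
  apply: Ex_abs_le; [exact: bm_label|apply: bmZ; exact: bm_birk|move=> x /=].
  have -> : b (itinerary n first_letter x) = pr m (cyl n x).
    congr (pr m _); apply/seteqP; split => y /=.
      move=> /ffunP h i hi; have := h (Ordinal hi).
      by rewrite !ffunE /= /first_letter !iter_shiftE !addn0.
    move=> h; apply/ffunP => i; rewrite !ffunE /first_letter !iter_shiftE !addn0.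
    by rewrite (h i).
  have [h1 h2] := hm n x; rewrite mulr0 subr0 in h1 h2.
  have p0 : 0 < pr m (cyl n x) by apply: lt_le_trans h1; exact: expR_gt0.
  have l1 : birk n B x - C <= ln (pr m (cyl n x)).
    by rewrite -[leLHS]expRK ler_ln ?posrE ?expR_gt0.
  have l2 : ln (pr m (cyl n x)) <= birk n B x + C.
    by rewrite -[leRHS]expRK ler_ln ?posrE ?expR_gt0.
  by rewrite ler_norml; lra.
apply: cvg_lim => //; apply/cvgrPdist_le => e e0.
near=> n.
have n0 : 0 < n%:R :> R by rewrite ltr0n; near: n; exact: nbhs_infty_gt.
rewrite -(ler_pM2l n0) -[X in X * `|_| <= _](ger0_norm (ltW n0)) -normrM mulrBr.
rewrite mulrA divff ?gt_eqF// mul1r distrC; apply: (le_trans (H n)).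
have : C / e <= n%:R by near: n; exact: nbhs_infty_ger.
by rewrite ler_pdivrMr.
Unshelve. all: by end_near.
Qed.

End EntropyBounds.

(** * Variational principle and uniqueness of equilibria *)

Section VariationalPrinciple.
Context {R : realType} {d : nat}.
Implicit Types (x y : Omega d) (A B f g : Omega d -> R) (nu m : probability (Omega d) R).
Local Notation shift := (@seq_shift d).

Lemma entropy_le nu m B (C th K : R) :
  0 < th -> th < 1 -> regular th K B -> normalised B -> Defs.invariant nu ->
  gibbs_bounds m B 0 C -> (entropy nu <= (- Ex nu B)%:E)%E.
Proof.
move=> th0 th1 hB nB inv hm; apply: ub_ereal_sup => _ [k [xi [mxi ->]]].
by rewrite lee_fin; exact: (partition_entropy_le th0 th1 hB nB inv hm mxi).
Qed.

Lemma entropy_gibbs m B (C th K : R) :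
  0 < th -> th < 1 -> regular th K B -> normalised B -> Defs.invariant m ->
  gibbs_bounds m B 0 C -> entropy m = (- Ex m B)%:E.
Proof.
move=> th0 th1 hB nB inv hm; apply/eqP; rewrite eq_le (entropy_le th0 th1 hB nB inv hm)/=.
apply: ereal_sup_ubound; exists d.+1, (@first_letter d); split.
  by move=> j; exact: measurable_first_letter.
by rewrite (partition_entropy_gibbs th0 th1 hB inv hm).
Qed.

Lemma free_energyE A nu : bounded_measurable A ->
  free_energy A nu = ((Ex nu A)%:E + entropy nu)%E.
Proof. by move=> bA; rewrite /free_energy EFin_Ex. Qed.

Section Potential.
Variables (th K : R) (A : Omega d -> R).
Hypotheses (th0 : 0 < th) (th1 : th < 1) (hA : regular th K A).

(** Cohomologous to A - c: invariant integrals change only by c, and Birkhoff sums by n c and a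
    bounded term. *)
Definition normalisation c g x := A x + g x - g (shift x) - c.

Lemma regular_normalisation c L g : regular th L g ->
  regular th (K + L + L / th + 0) (normalisation c g).
Proof.
move=> hg; apply: regularB; last exact: regular_cst.
apply: regularB; first exact: regularD.
exact: (regular_shift th0 th1 hg).
Qed.

Lemma normalised_normalisation c g : eigenpair A c g -> normalised (normalisation c g).
Proof.
move=> h x; under eq_bigr do rewrite /normalisation shift_cons -addrA expRD.
rewrite -mulr_suml -(log_trK (fun y => A y + g y)) h -expRD -expR0; congr expR; ring.
Qed.

Lemma Ex_normalisation nu c L g : Defs.invariant nu -> regular th L g ->
  Ex nu A = Ex nu (normalisation c g) + c.
Proof.
move=> inv hg; have bg := bm_regular th0 th1 hg; have bA := bm_regular th0 th1 hA.
have bgs := bm_shift 1 bg.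
have -> : normalisation c g = fun x => A x + (g x + (-1 * (g \o iter 1 shift) x + - c)).
  by apply: funext => x; rewrite /normalisation /=; ring.
have b1 : bounded_measurable (fun x => -1 * (g \o iter 1 shift) x + - c).
  by apply: bmD; [exact: bmZ|exact: bm_cst].
have b2 : bounded_measurable (fun x => g x + (-1 * (g \o iter 1 shift) x + - c)).
  exact: bmD.
rewrite ExD// ExD// ExD; [|exact: bmZ|exact: bm_cst].
rewrite ExZ// Ex_cst Ex_iter_shift//; ring.
Qed.

Lemma gibbs_bounds_normalisation m c L g C : regular th L g ->
  gibbs_bounds m (normalisation c g) 0 C -> gibbs_bounds m A c (C + L).
Proof.
move=> hg hm n x; have [h1 h2] := hm n x.
have E : birk n (normalisation c g) x = birk n A x - n%:R * c + (g x - g (iter n shift x)).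
  rewrite -birk_coboundary -[X in _ - X + _](_ : birk n (fun=> c) x = _); last first.
    by rewrite /birk sumr_const card_ord mulr_natl.
  rewrite -[X in _ + X + _]mulN1r -birkZ -!birkD; congr birk.
  by apply: funext => y; rewrite /normalisation; ring.
have := hg 0%N x (iter n shift x) (agree0 _ _); rewrite expr0 mulr1 ler_norml => /andP[g1 g2].
rewrite mulr0 subr0 E in h1 h2; split.
  by apply: le_trans h1; rewrite ler_expR; lra.
by apply: (le_trans h2); rewrite ler_expR; lra.
Qed.

(** Reduces perturbations of [A] to perturbations of its normalised potential: adding a coboundary
    and a constant only translates eigenpairs. *)
Lemma eigenpair_normalisation A' c c' g g' : eigenpair A' c' g' ->
  eigenpair (fun y => A' y + g y - g (shift y) - c) (c' - c) (fun y => g' y - g y).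
Proof.
move=> h x.
have E a : A' (cons_letter a x) + g (cons_letter a x) - g (shift (cons_letter a x)) - c +
    (g' (cons_letter a x) - g (cons_letter a x)) =
    A' (cons_letter a x) + g' (cons_letter a x) + (- g x - c).
  by rewrite shift_cons; ring.
have -> : c' - c + (g' x - g x) = log_tr (fun y => A' y + g' y) x + (- g x - c).
  by rewrite h; ring.
apply/eqP; rewrite eq_le; apply/andP; split.
  by apply: log_tr_le => a; rewrite E.
by rewrite -lerBrDr; apply: log_tr_le => a; rewrite E addrK.
Qed.

(** [entropy_le] bounds every free energy by c, and the Gibbs measure of the normalised potential
    attains c. *)
Lemma variational_principle c L g : regular th L g -> eigenpair A c g ->
  exists m, [/\ Defs.invariant m, forall f W, regular th W f -> Ex m f = mean (normalisation c g) f,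
   exists C, gibbs_bounds m A c C,
   entropy m = (c - Ex m A)%:E & pressure A = c%:E].
Proof.
move=> hg hc; have nB := normalised_normalisation hc.
have hB := regular_normalisation c hg.
have [m [inv hmean [C hm]]] := gibbs_measure_exists th0 th1 hB nB.
have bA := bm_regular th0 th1 hA.
have Em := entropy_gibbs th0 th1 hB nB inv hm.
have Em' : entropy m = (c - Ex m A)%:E.
  by rewrite Em; congr EFin; rewrite (Ex_normalisation c inv hg); ring.
exists m; split=> //.
- by move=> f W; exact: hmean.
- by exists (C + L); exact: gibbs_bounds_normalisation hm.
apply/eqP; rewrite eq_le; apply/andP; split.
  apply: ub_ereal_sup => _ [nu invnu <-]; rewrite free_energyE//.
  have := entropy_le th0 th1 hB nB invnu hm.
  rewrite (Ex_normalisation c invnu hg); set b := Ex nu _.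
  move=> /(leeD2l (b + c)%:E)/le_trans; apply; rewrite -EFinD lee_fin; lra.
apply: ereal_sup_ubound; exists m => //; rewrite free_energyE// Em' -EFinD.
by congr EFin; lra.
Qed.

Lemma pressure_eigenvalue : exists c, pressure A = c%:E.
Proof.
have [c [g [L [hg hc]]]] := rpf th0 th1 hA.
by have [m [_ _ _ _ ->]] := variational_principle hg hc; exists c.
Qed.

Lemma fine_pressure_ge nu (h : R) : Defs.invariant nu -> entropy nu = h%:E ->
  Ex nu A + h <= fine (pressure A).
Proof.
move=> inv hnu; have [c hc] := pressure_eigenvalue.
rewrite hc /= -lee_fin -hc; apply: ereal_sup_ubound; exists nu => //.
by rewrite free_energyE ?hnu//; exact: bm_regular hA.
Qed.

End Potential.

Lemma pressure_expansion th K A c L g W f : 0 < th -> th < 1 -> regular th K A ->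
  regular th L g -> eigenpair A c g -> regular th W f ->
  forall e, 0 < e -> exists2 del, 0 < del & forall s, `|s| <= del ->
    `|fine (pressure (fun x => A x + s * f x)) - c - s * mean (normalisation A c g) f| <= e * `|s|.
Proof.
move=> th0 th1 hA hg hc hf e e0.
have hB := regular_normalisation th0 th1 hA c hg.
have nB := normalised_normalisation hc.
have [del del0 H] := eigenvalue_deriv th0 th1 hB nB hf e0.
exists del => // s /H {}H.
have hAs := regularD hA (regularZ s hf).
have [c' [g' [L' [hg' hc']]]] := rpf th0 th1 hAs.
have [m [_ _ _ _ ->]] := variational_principle th0 th1 hAs hg' hc'.
apply: (H _ (fun y => g' y - g y) _ (regularB hg' hg)).
rewrite (_ : (fun x => normalisation A c g x + s * f x) =
  fun y => (A y + s * f y) + g y - g (shift y) - c); last first.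
  by apply: funext => y; rewrite /normalisation; ring.
exact: eigenpair_normalisation hc'.
Qed.

(** An equilibrium is tangent to the pressure: the pressure of A + s f is at least c + s [Ex nu f]
    for both signs of s, so the first-order expansion forces [Ex nu f] = M. Indicators of cylinders
    serve as f. *)
Lemma equilibrium_unique th K A c L g m nu : 0 < th -> th < 1 -> regular th K A ->
  regular th L g -> eigenpair A c g ->
  (forall f W, regular th W f -> Ex m f = mean (normalisation A c g) f) ->
  equilibrium A nu -> same_probability nu m.
Proof.
move=> th0 th1 hA hg hc hm [inv hnu].
have bA := bm_regular th0 th1 hA.
have [m' [_ _ _ _ pA]] := variational_principle th0 th1 hA hg hc.
have Enu : entropy nu = (c - Ex nu A)%:E.
  move: hnu; rewrite free_energyE// pA.
  case: (entropy nu) => [h| |] //=; rewrite -?EFinD => -[] <-.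
  by congr EFin; lra.
apply: same_probability_cyl => n x; have mc := measurable_cyl n x.
rewrite -(pr_EFin nu mc) -(pr_EFin m mc); congr EFin.
rewrite -[LHS](Ex_indic nu mc) -[RHS](Ex_indic m mc).
have hf : regular th (th ^- n) (\1_(cyl n x) : Omega d -> R) := regular_ind_cyl th0 th1 n x.
rewrite (hm _ _ hf); set f := \1_(cyl n x) in hf *; set M := mean _ f.
have bf := bm_regular th0 th1 hf.
suff H e : 0 < e -> `|Ex nu f - M| <= e.
  by apply/eqP; rewrite -subr_eq0 -normr_le0; apply/ler_addgt0Pr => e /H; rewrite add0r.
move=> e0; have [del del0 hd] := pressure_expansion th0 th1 hA hg hc hf e0.
have key s : `|s| <= del -> s * (Ex nu f - M) <= e * `|s|.
  move=> /[dup] hs /hd; have hAs := regularD hA (regularZ s hf).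
  have := fine_pressure_ge th0 th1 hAs inv Enu.
  rewrite ExD ?ExZ//; last exact: bmZ.
  by rewrite -/M ler_norml; lra.
have := key del; have := key (- del).
rewrite !normrN gtr0_norm// lexx => /(_ isT) h1 /(_ isT) h2.
rewrite ler_norml; apply/andP; split; rewrite -(ler_pM2l del0); lra.
Qed.

End VariationalPrinciple.

(** * Derivatives from first-order expansions *)

Section DerivativeExpansion.
Context {R : realType}.

Lemma is_derive_expansion (phi : R -> R) (t l : R) :
  (forall e, 0 < e -> exists2 del, 0 < del & forall s, `|s| <= del ->
    `|phi (t + s) - phi t - s * l| <= e * `|s|) -> is_derive t 1 phi l.
Proof.
move=> H.
have hcv : (fun h => h^-1 *: ((phi \o shift t) (h *: (1 : R)) - phi t)) @ 0^' --> l.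
  apply/cvgrPdist_le => e e0; have [del del0 hd] := H e e0.
  near=> h.
  have h0 : h != 0 by near: h; exact: nbhs_dnbhs_neq.
  have hdel : `|h| <= del by near: h; apply: dnbhs0_le.
  have nh0 : 0 < `|h| by rewrite normr_gt0.
  rewrite /= -[h *: 1]/(h * 1) mulr1 -[_ *: (_ - _)]/(_ * (_ - _)) addrC.
  rewrite -(ler_pM2l nh0) -normrM mulrDr mulrN mulrA divff// mul1r.
  by have := hd _ hdel; rewrite -normrN opprB addrC (addrC t) (mulrC e).
by split; [exact: (cvgP l)|exact: cvg_lim hcv].
Unshelve. all: by end_near.
Qed.

End DerivativeExpansion.

(** * Hölder continuity as geometric decay of variations *)

Section HolderRegular.
Context {R : realType} {d : nat}.
Implicit Types (x y : Omega d) (A : Omega d -> R).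

Lemma seq_dist_has_sup x y :
  has_sup (range (fun n : nat => (x n != y n)%:R * 2 ^- n : R)).
Proof.
split; first by exists ((x 0%N != y 0%N)%:R * 2 ^- 0), 0%N.
exists 1 => _ [n _ <-]; rewrite -[leRHS]mulr1 ler_pM ?ler0n//.
- by rewrite lern1; case: (_ != _).
- by rewrite invf_le1 ?exprn_gt0// exprn_ege1// ler1n.
Qed.

Lemma seq_dist_le n x y : agree n x y -> seq_dist x y <= 2 ^- n :> R.
Proof.
move=> xy; apply: ge_sup; first exact: (seq_dist_has_sup x y).1.
move=> _ [k _ <-]; have [kn|nk] := ltnP k n.
  by rewrite (xy k kn) eqxx mul0r invr_ge0 exprn_ge0.
apply: (@le_trans _ _ (2 ^- k)).
  by rewrite ler_piMl ?invr_ge0 ?exprn_ge0// lern1; case: (_ != _).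
by rewrite lef_pV2 ?posrE ?exprn_gt0// ler_weXn2l// ler1n.
Qed.

Lemma seq_dist_ge n x y : x n != y n -> 2 ^- n <= seq_dist x y :> R.
Proof.
move=> xy; apply: ub_le_sup; first exact: (seq_dist_has_sup x y).2.
by exists n => //; rewrite xy mul1r.
Qed.

Lemma powR_exp2 n (al : R) : (2 ^- n) `^ al = expR (- (al * ln 2)) ^+ n :> R.
Proof.
rewrite /powR gt_eqF ?invr_gt0 ?exprn_gt0// -expRM_natl; congr expR.
by rewrite lnV ?posrE ?exprn_gt0// lnXn// -mulr_natl; ring.
Qed.

Lemma ln2_gt0 : 0 < ln 2 :> R.
Proof. by rewrite -ln1 ltr_ln ?posrE// ltr1n. Qed.

Lemma holder_regular A : holder A -> exists th K, [/\ 0 < th, th < 1 & regular th K A].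
Proof.
move=> [C [al [al0 al1 h]]].
exists (expR (- (al * ln 2))), `|C|; split; first exact: expR_gt0.
  by rewrite -[ltRHS]expR0 ltr_expR oppr_lt0 mulr_gt0// ln2_gt0.
move=> n x y xy; apply: (le_trans (h x y)).
apply: (@le_trans _ _ (`|C| * seq_dist x y `^ al)).
  by rewrite ler_wpM2r ?powR_ge0// ler_norm.
have d0 : 0 <= seq_dist x y :> R.
  apply: (@le_trans _ _ ((x 0%N != y 0%N)%:R * 2 ^- 0)).
    by rewrite mulr_ge0// invr_ge0 exprn_ge0.
  by apply: ub_le_sup; [exact: (seq_dist_has_sup x y).2|exists 0%N].
rewrite ler_wpM2l// -powR_exp2 ge0_ler_powR ?nnegrE//; first exact: ltW.
exact: seq_dist_le.
Qed.

Lemma regular_holder th K A : 0 < th -> th < 1 -> regular th K A -> holder A.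
Proof.
move=> th0 th1 h; have lth : ln th < 0 by rewrite -ln1 ltr_ln ?posrE.
have l2 := ln2_gt0.
(* The exponent with th = 2^-al is -ln th / ln 2; it is capped at 1 as [holder] demands, which only
   weakens the bound. *)
set al := Num.min 1 (- ln th / ln 2).
have al0 : 0 < al by rewrite /al lt_min ltr01 divr_gt0// oppr_gt0.
exists K, al; split=> //; first by rewrite /al ge_min lexx.
move=> x y; have K0 := regular_ge0 h.
have [xy|xy] := pselect (forall n, x n = y n).
  have -> : x = y by exact: funext.
  by rewrite subrr normr0 mulr_ge0// powR_ge0.
have ex : exists n, x n != y n.
  by apply: contrapT => hn; apply: xy => n; apply/eqP; apply: contrapT => hn'; apply: hn; exists n; exact/negP.
case: (ex_minnP ex) => n xyn nmin.
have xy' : agree n x y.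
  move=> i hi; apply/eqP; apply: contraTT hi => /nmin; by rewrite -leqNgt.
apply: (le_trans (h _ _ _ xy')); rewrite ler_wpM2l//.
apply: (@le_trans _ _ ((2 ^- n) `^ al)); last first.
  have p2 : 0 <= 2 ^- n :> R by rewrite invr_ge0 exprn_ge0.
  apply: ge0_ler_powR; rewrite ?nnegrE ?seq_dist_ge//; first exact: ltW.
  exact: le_trans p2 (seq_dist_ge xyn).
rewrite powR_exp2 lerXn2r ?nnegrE ?expR_ge0 ?(ltW th0)//.
rewrite -[leLHS]lnK ?posrE// ler_expR lerNr.
by rewrite -ler_pdivlMr// /al ge_min lexx orbT.
Qed.

Lemma regular_rate_le th th' K A : 0 <= th -> th <= th' -> regular th K A -> regular th' K A.
Proof.
move=> th0 tt h n x y /h/le_trans; apply; rewrite ler_wpM2l ?(regular_ge0 h)//.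
by rewrite lerXn2r// nnegrE (le_trans th0).
Qed.

End HolderRegular.

(** * Pressure along a line of potentials, and its strict convexity *)

Section PressureFamily.
Context {R : realType} {d : nat}.
Implicit Types (x y : Omega d) (nu m : probability (Omega d) R).
Variables (th K L : R) (psi a1 : Omega d -> R).
Hypotheses (th0 : 0 < th) (th1 : th < 1) (hpsi : regular th K psi) (ha1 : regular th L a1).

Definition line (t : R) x := t * psi x + a1 x.

Definition line_pressure t : R := fine (pressure (line t)).
Local Notation P := line_pressure.

(** Bundled so that one use of choice provides a whole family of states; the constant [C] may depend
    on t. *)
Definition gibbs_state t m := [/\ Defs.invariant m,
  equilibrium (line t) m /\ (forall nu, equilibrium (line t) nu -> same_probability nu m),
  (exists C, gibbs_bounds m (line t) (P t) C) /\ (exists J, gibbs J m),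
  entropy m = (P t - Ex m (line t))%:E /\ pressure (line t) = (P t)%:E &
  is_derive t 1 P (Ex m psi)].

Lemma regular_line t : regular th (`|t| * K + L) (line t).
Proof. by apply: regularD => //; exact: regularZ. Qed.

Lemma normalised_pressure (B : Omega d -> R) M : regular th M B -> normalised B ->
  pressure B = 0%:E.
Proof.
move=> hB nB; have hc : eigenpair B 0 (fun=> 0).
  by move=> x; rewrite /log_tr; under eq_bigr do rewrite addr0; rewrite nB ln1 addr0.
by have [m [_ _ _ _ ->]] := variational_principle th0 th1 hB (regular_cst th 0) hc.
Qed.

Lemma gibbs_state_exists t : exists m, gibbs_state t m.
Proof.
have hA := regular_line t.
have [c [g [M [hg hc]]]] := rpf th0 th1 hA.
have [m [inv hmean [C hm] Em pA]] := variational_principle th0 th1 hA hg hc.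
have Pt : P t = c by rewrite /line_pressure pA.
have hB := regular_normalisation th0 th1 hA c hg.
have nB := normalised_normalisation hc.
exists m; split=> //.
- split.
    split=> //; rewrite free_energyE; last exact: bm_regular hA.
    by rewrite Em pA -EFinD; congr EFin; lra.
  move=> nu hnu; exact: (equilibrium_unique th0 th1 hA hg hc hmean hnu).
- split; first by exists C; rewrite Pt.
  (* A Jacobian of the state is the exponential of the normalised potential, whose pressure is 0. *)
  exists (fun x => expR (normalisation (line t) c g x)).
  rewrite /gibbs /holder_jacobian; under eq_fun do rewrite expRK.
  split; first split.
  + by move=> x; exact: expR_gt0.
  + exact: regular_holder hB.
  + exact: nB.
  split=> //; rewrite (normalised_pressure hB nB) free_energyE; last exact: bm_regular hB.
  rewrite Em (Ex_normalisation th0 th1 hA c inv hg) -EFinD; congr EFin; ring.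
- by rewrite Em pA Pt.
apply: is_derive_expansion => e e0.
have [del del0 hd] := pressure_expansion th0 th1 hA hg hc hpsi e0.
exists del => // s /hd; rewrite Pt (hmean _ _ hpsi).
suff -> : (fun x => line t x + s * psi x) = line (t + s) by [].
by apply: funext => x; rewrite /line; ring.
Qed.

Lemma Ex_line nu s t : Ex nu (line t) = Ex nu (line s) + (t - s) * Ex nu psi.
Proof.
have b := bm_regular th0 th1 hpsi; have bs := bm_regular th0 th1 (regular_line s).
rewrite -ExZ// -ExD//; last exact: bmZ.
by congr Ex; apply: funext => x; rewrite /line; ring.
Qed.

(** The state at s competes in the supremum defining the pressure at t, and its free energy is
    affine in t. *)
Lemma subgradient s t m : gibbs_state s m -> P s + Ex m psi * (t - s) <= P t.
Proof.
move=> [inv _ _ [Em _] _].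
have := fine_pressure_ge th0 th1 (regular_line t) inv Em.
by rewrite (Ex_line m s t); rewrite -/(P t); lra.
Qed.

Lemma nat_mul_bounded (a C : R) : (forall n : nat, n%:R * a <= C) -> a <= 0.
Proof.
move=> h; rewrite leNgt; apply/negP => a0.
have := archi_boundP (normr_ge0 (C / a)).
move=> /(le_lt_trans (ler_norm _)); rewrite ltr_pdivrMr//.
by rewrite ltNge h.
Qed.

(* Equality in the subgradient inequality makes the two Gibbs states coincide,
   and comparing their Gibbs bounds forces the Birkhoff sums of psi to stay at
   bounded distance from those of a constant. *)
Lemma rigidity s t m m' : s != t -> gibbs_state s m -> gibbs_state t m' ->
  P t = P s + Ex m psi * (t - s) ->
  same_probability m m' /\ forall nu, Defs.invariant nu -> Ex nu psi = Ex m psi.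
Proof.
move=> st [inv _ [[C hm] _] [Em _] _] [inv' [_ uniq'] [[C' hm'] _] [_ pt] _] E.
have eq : equilibrium (line t) m.
  split=> //; rewrite free_energyE; last exact: bm_regular (regular_line t).
  by rewrite Em pt -EFinD; congr EFin; rewrite (Ex_line m s t) E; ring.
have same := uniq' _ eq; split=> // nu invnu; set k := Ex m psi.
have bd n x : `|birk n psi x - n%:R * k| <= (C + C') / `|t - s|.
  rewrite ler_pdivlMr ?normr_gt0 ?subr_eq0 1?eq_sym// -normrM.
  have bl r : birk n (line r) x = r * birk n psi x + birk n a1 x.
    by rewrite -birkZ -birkD.
  have [h1 h2] := hm n x; have [h3 h4] := hm' n x.
  have e : pr m (cyl n x) = pr m' (cyl n x) by rewrite /pr same//; exact: measurable_cyl.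
  have := le_trans h1 (eq_rect _ (fun z => z <= _) h4 _ (esym e)).
  have := le_trans h3 (eq_rect _ (fun z => z <= _) h2 _ e).
  rewrite !ler_expR !bl E -/k ler_norml; lra.
have b := bm_regular th0 th1 hpsi.
have H n : `|n%:R * (Ex nu psi - k)| <= (C + C') / `|t - s|.
  rewrite mulrBr -(Ex_birk n invnu b) -[X in _ - X](Ex_cst nu).
  by apply: Ex_abs_le => //; [exact: bm_birk|exact: bm_cst].
have D n : n%:R * `|Ex nu psi - k| <= (C + C') / `|t - s|.
  by have := H n; rewrite normrM ger0_norm.
have := nat_mul_bounded D; rewrite normr_le0 subr_eq0 => /eqP.
exact.
Qed.

Hypotheses (P_0 : P 0 = 0) (P_1 : P 1 = 0).
Variable m : R -> probability (Omega d) R.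
Hypotheses (hm : forall t, gibbs_state t (m t)) (m01 : ~ same_probability (m 1) (m 0)).

Definition slope t := Ex (m t) psi.
Local Notation e := slope.

Lemma same_sym nu nu' : same_probability nu nu' -> same_probability nu' nu.
Proof. by move=> h B mB; rewrite h. Qed.

(** Equality would, by [rigidity], give psi one mean k for all invariant probabilities. The
    subgradient inequalities between 0 and 1, where P vanishes, force k = 0; then equality also
    holds between 0 and 1, and the states there coincide. *)
Lemma strict_subgradient s t : s != t -> P s + e s * (t - s) < P t.
Proof.
move=> st; rewrite lt_neqAle subgradient// andbT; apply/eqP => E.
have [_ hnu] := rigidity st (hm s) (hm t) (esym E).
have inv t' : Defs.invariant (m t') by case: (hm t').
have h0 := subgradient 1 (hm 0); have h1 := subgradient 0 (hm 1).
rewrite (hnu _ (inv 0)) P_0 P_1 in h0; rewrite (hnu _ (inv 1)) P_0 P_1 in h1.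
have es0 : Ex (m s) psi = 0 by lra.
have E01 : P 1 = P 0 + Ex (m 0) psi * (1 - 0).
  by rewrite P_0 P_1 (hnu _ (inv 0)) es0; ring.
have n01 : (0 : R) != 1 by rewrite eq_sym oner_eq0.
have [same _] := rigidity n01 (hm 0) (hm 1) E01.
by apply: m01; exact: same_sym.
Qed.

Lemma slope_lt s t : s < t -> e s < e t.
Proof.
move=> st; have st' : s != t by rewrite lt_eqF.
have h1 := strict_subgradient st'; rewrite eq_sym in st'.
have h2 := strict_subgradient st'.
have h3 : 0 < (e t - e s) * (t - s) by lra.
by move: h3; rewrite pmulr_lgt0 ?subr_gt0.
Qed.

Lemma slope_inj s t : e s = e t -> s = t.
Proof.
by move=> est; case: (ltgtP s t) => // /slope_lt; rewrite est ltxx.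
Qed.

Lemma slope_0 : e 0 < 0.
Proof.
have n01 : (0 : R) != 1 by rewrite eq_sym oner_eq0.
by have := strict_subgradient n01; rewrite P_0 P_1; lra.
Qed.

Lemma slope_1 : 0 < e 1.
Proof. by have := strict_subgradient (oner_neq0 R); rewrite P_0 P_1; lra. Qed.

Lemma is_derive_P (t : R) : is_derive t 1 P (e t).
Proof. by case: (hm t). Qed.

Lemma slope_IVT a b E : a < b -> e a < E -> E < e b ->
  exists t, [/\ a < t, t < b & e t = E].
Proof.
move=> ab ea eb; pose phi t := P t - E * t.
have dphi (t : R) : is_derive t 1 phi (e t - E).
  have h1 := is_derive_P t.
  have h2 : is_derive t 1 (fun u : R => E * u) E.
    by apply: is_derive_eq; rewrite -[_ *: _]/(_ * _) mulr1.
  exact: is_deriveB.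
(* The interval is enlarged by 1 on each side so that the minimiser is interior. *)
have ab' : a - 1 <= b + 1 by lra.
have cphi : {within `[a - 1, b + 1], continuous phi}.
  apply: derivable_within_continuous => t _; exact: ex_derive.
have [c hc cmin] := EVT_min ab' cphi.
have ain : a \in `[a - 1, b + 1] by rewrite in_itv /=; apply/andP; split; lra.
have bin : b \in `[a - 1, b + 1] by rewrite in_itv /=; apply/andP; split; lra.
have ca : a <= c.
  rewrite leNgt; apply/negP => ca; have := cmin a ain; rewrite /phi.
  have := subgradient c (hm a); rewrite -/(e a).
  have : 0 < (E - e a) * (a - c) by rewrite mulr_gt0 ?subr_gt0.
  lra.
have cb : c <= b.
  rewrite leNgt; apply/negP => cb; have := cmin b bin; rewrite /phi.
  have := subgradient c (hm b); rewrite -/(e b).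
  have : 0 < (e b - E) * (c - b) by rewrite mulr_gt0 ?subr_gt0.
  lra.
have dc : is_derive c 1 phi 0.
  apply: (@derive1_at_min _ phi (a - 1) (b + 1)) => //.
  - by rewrite in_itv /=; apply/andP; split; lra.
  - move=> t; rewrite in_itv /= => /andP[t1 t2]; apply: cmin.
    by rewrite in_itv /= !ltW.
have ec : e c = E.
  have := @derive_val _ _ _ _ _ _ _ dc; rewrite (@derive_val _ _ _ _ _ _ _ (dphi c)); lra.
exists c; split=> //.
  by rewrite lt_neqAle ca andbT; apply: contraTneq ea => ->; rewrite ec ltxx.
by rewrite lt_neqAle cb andbT; apply: contraTneq eb => <-; rewrite ec ltxx.
Qed.

End PressureFamily.

(** * Chernoff bounds and tilting on cylinders *)

Section Deviations.
Context {R : realType} {d : nat}.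
Implicit Types (x y : Omega d) (nu : probability (Omega d) R).
Variables (th K L : R) (psi a1 : Omega d -> R).
Hypotheses (th0 : 0 < th) (th1 : th < 1) (hpsi : regular th K psi) (ha1 : regular th L a1).
Local Notation P := (line_pressure psi a1).
Local Notation line := (line psi a1).

(** Sum of K th^k over all k: a bound, uniform in n, for the oscillation of Birkhoff sums on a
    cylinder. *)
Definition variation : R := K / (1 - th).

Lemma variation_ge0 : 0 <= variation.
Proof. by rewrite /variation divr_ge0 ?(regular_ge0 hpsi)// subr_ge0 ltW. Qed.

Lemma birk_variation n x y : agree n x y -> `|birk n psi x - birk n psi y| <= variation.
Proof.
move=> xy; apply: (@le_trans _ _ (variation * (1 - th ^+ n))); last first.
  by rewrite ler_piMr ?variation_ge0// lerBlDl lerDr exprn_ge0// ltW.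
elim: n x y xy => [|n IH] x y xy; first by rewrite !birk0 subrr normr0 expr0 subrr mulr0.
rewrite !birkS.
have h1 := hpsi xy; have h2 := IH _ _ (agree_shift xy).
have h3 : K * th ^+ n.+1 <= variation * (th ^+ n - th ^+ n.+1).
  have -> : variation * (th ^+ n - th ^+ n.+1) = K * th ^+ n.
    by rewrite /variation exprS; field; rewrite gt_eqF// subr_gt0.
  by rewrite ler_wpM2l ?(regular_ge0 hpsi)// exprS ler_piMl ?exprn_ge0// ltW.
move: h1 h2; rewrite !ler_norml; lra.
Qed.

(** Dividing the two Gibbs bounds cancels the Birkhoff sums of [a1] and leaves only those of psi. *)
Lemma gibbs_ratio nu nu' a s Ca Cs : gibbs_bounds nu (line a) (P a) Ca ->
  gibbs_bounds nu' (line s) (P s) Cs -> forall n x,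
  pr nu (cyl n x) <= expR (n%:R * (P s - P a) - (s - a) * birk n psi x + (Ca + Cs)) *
    pr nu' (cyl n x).
Proof.
move=> ha hs n x; have [_ h1] := ha n x; have [h2 _] := hs n x.
apply: (le_trans h1); apply: le_trans (ler_wpM2l (expR_ge0 _) h2).
rewrite -expRD ler_expR; have bl r : birk n (line r) x = r * birk n psi x + birk n a1 x.
  by rewrite -birkZ -birkD.
rewrite !bl; lra.
Qed.

(** [gibbs_ratio] is summed over the cylinders meeting G, whose masses under nu' add up to at most
    1. As G need not be a union of cylinders, the threshold is lowered by the oscillation D. *)
Lemma chernoff nu nu' a s Ca Cs : gibbs_bounds nu (line a) (P a) Ca ->
  gibbs_bounds nu' (line s) (P s) Cs -> exists C, forall n (v : R) G, measurable G ->
  (forall y, G y -> n%:R * v <= (s - a) * birk n psi y) ->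
  pr nu G <= expR (n%:R * (P s - P a - v) + C).
Proof.
move=> ha hs; set D := `|s - a| * variation.
exists (Ca + Cs + D) => n v G mG hG.
pose Q (w : {ffun 'I_n -> 'I_d.+1}) := n%:R * v - D <= (s - a) * birk n psi (of_word w).
have mS : measurable [set y | Q (word n y)].
  by apply: measurable_label_set; exact: measurable_word_label.
apply: (@le_trans _ _ (pr nu [set y | Q (word n y)])).
  apply: pr_le => // y /hG hy; rewrite /= /Q.
  have := birk_variation (agree_of_word (n := n) y).
  move=> /(ler_wpM2l (normr_ge0 (s - a))); rewrite -/D -normrM mulrBr ler_norml; lra.
rewrite (pr_label_set nu Q (@measurable_word_label d n)).
apply: (@le_trans _ _ (\sum_(w | Q w) expR (n%:R * (P s - P a - v) + (Ca + Cs + D)) *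
    pr nu' [set x | word n x = w])).
  apply: ler_sum => w Qw; rewrite word_cyl.
  apply: (le_trans (gibbs_ratio ha hs n (of_word w))).
  by rewrite ler_wpM2r ?pr_ge0// ler_expR; move: Qw; rewrite /Q; lra.
rewrite -mulr_sumr ler_piMr ?expR_ge0//.
rewrite -(pr_label_set nu' Q (@measurable_word_label d n)).
rewrite -(label_pr_sum1 nu' (@measurable_word_label d n)) (pr_label_set nu' Q (@measurable_word_label d n)).
rewrite [leRHS](bigID Q)/= lerDl sumr_ge0// => w _; exact: pr_ge0.
Qed.

Hypotheses (P_0 : P 0 = 0) (P_1 : P 1 = 0).
Variable m : R -> probability (Omega d) R.
Hypotheses (hm : forall t, gibbs_state psi a1 t (m t)) (m01 : ~ same_probability (m 1) (m 0)).
Local Notation e := (slope psi m).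

Let slope_incr := slope_lt th0 th1 hpsi ha1 P_0 P_1 hm m01.
Let IVT := slope_IVT th0 th1 hpsi ha1 hm.

Lemma gibbs_state_bounds t : exists C, gibbs_bounds (m t) (line t) (P t) C.
Proof. by case: (hm t) => _ _ [[C hC] _] _ _; exists C. Qed.

Lemma measurable_birk_ge n (v : R) : measurable [set y | v <= birk n psi y].
Proof.
have [mf _] := bm_birk n (bm_regular th0 th1 hpsi).
have := mf measurableT `[v, +oo[%classic (measurable_itv _); rewrite setTI.
congr measurable; apply/seteqP; split => y /=; rewrite in_itv /= ?andbT//.
Qed.

Lemma measurable_birk_le n (v : R) : measurable [set y | birk n psi y <= v].
Proof.
have [mf _] := bm_birk n (bm_regular th0 th1 hpsi).
have := mf measurableT `]-oo, v]%classic (measurable_itv _); rewrite setTI.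
by congr measurable; apply/seteqP; split => y /=; rewrite in_itv.
Qed.

(** Exponential law of large numbers under [m t]: Chernoff's bound towards some s > t with slope at
    most e t + del / 2, whose exponent is at most -(s - t) del / 2. *)
Lemma birk_ge_small t del : 0 < del -> exists kap C, 0 < kap /\ forall n,
  pr (m t) [set y | n%:R * (e t + del) <= birk n psi y] <= expR (- (n%:R * kap) + C).
Proof.
move=> del0; have st : e t < e (t + 1) by apply: slope_incr; lra.
(* The second entry keeps E below the slope at t + 1, so that E is itself a slope. *)
pose E := e t + Num.min (del / 2) ((e (t + 1) - e t) / 2).
have E1 : e t < E by rewrite /E ltrDl lt_min !divr_gt0// subr_gt0.
have E2 : E < e (t + 1).
  have : E <= e t + (e (t + 1) - e t) / 2 by rewrite /E lerD2l ge_min lexx orbT.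
  lra.
have E3 : E <= e t + del / 2 by rewrite /E lerD2l ge_min lexx.
have tt : t < t + 1 by rewrite ltrDl.
have [s [ts s1 es]] := IVT tt E1 E2.
have [C1 hC1] := gibbs_state_bounds t; have [C2 hC2] := gibbs_state_bounds s.
have [C hC] := chernoff hC1 hC2.
exists ((s - t) * (del / 2)), C; split; first by rewrite mulr_gt0 ?divr_gt0 ?subr_gt0.
move=> n; have st0 : 0 <= s - t by rewrite subr_ge0 ltW.
apply: (le_trans (hC n ((s - t) * (e t + del)) _ (measurable_birk_ge _ _) _)).
  by move=> y /= hy; rewrite mulrCA ler_wpM2l.
rewrite ler_expR lerD2r -[leRHS]mulrN ler_wpM2l//.
have := subgradient th0 th1 hpsi ha1 t (hm s); rewrite -/(slope psi m s) es.
have := ler_wpM2l st0 E3; lra.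
Qed.

Lemma birk_le_small t del : 0 < del -> exists kap C, 0 < kap /\ forall n,
  pr (m t) [set y | birk n psi y <= n%:R * (e t - del)] <= expR (- (n%:R * kap) + C).
Proof.
move=> del0; have st : e (t - 1) < e t by apply: slope_incr; lra.
pose E := e t - Num.min (del / 2) ((e t - e (t - 1)) / 2).
have E1 : E < e t by rewrite /E gtrBl lt_min !divr_gt0// subr_gt0.
have E2 : e (t - 1) < E.
  have : Num.min (del / 2) ((e t - e (t - 1)) / 2) <= (e t - e (t - 1)) / 2.
    by rewrite ge_min lexx orbT.
  by rewrite /E; lra.
have E3 : e t - del / 2 <= E by rewrite /E lerD2l lerN2 ge_min lexx.
have tt : t - 1 < t by rewrite gtrBl.
have [s [ts s1 es]] := IVT tt E2 E1.
have [C1 hC1] := gibbs_state_bounds t; have [C2 hC2] := gibbs_state_bounds s.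
have [C hC] := chernoff hC1 hC2.
exists ((t - s) * (del / 2)), C; split; first by rewrite mulr_gt0 ?divr_gt0 ?subr_gt0.
move=> n; have st0 : 0 <= t - s by rewrite subr_ge0 ltW.
apply: (le_trans (hC n ((s - t) * (e t - del)) _ (measurable_birk_le _ _) _)).
  by move=> y /= hy; have := ler_wpM2l st0 hy; lra.
rewrite ler_expR lerD2r -[leRHS]mulrN ler_wpM2l//.
have := subgradient th0 th1 hpsi ha1 t (hm s); rewrite -/(slope psi m s) es.
have := ler_wpM2l st0 E3; lra.
Qed.

Lemma near_expR_le (kap C eta : R) : 0 < kap -> 0 < eta ->
  \forall n \near \oo, expR (- (n%:R * kap) + C) <= eta.
Proof.
move=> kap0 eta0; near=> n.
rewrite -[leRHS]lnK ?posrE// ler_expR.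
have : (C - ln eta) / kap <= n%:R by near: n; exact: nbhs_infty_ger.
by rewrite ler_pdivrMr//; lra.
Unshelve. all: by end_near.
Qed.

Lemma near_natmul_ge (a C : R) : 0 < a -> \forall n \near \oo, C <= n%:R * a.
Proof.
move=> a0; near=> n; rewrite -ler_pdivrMr//; near: n; exact: nbhs_infty_ger.
Unshelve. all: by end_near.
Qed.

(** Under [m t] Birkhoff averages concentrate at [e t]: at least half of its mass lies on cylinders
    with averages near [e t], and there [gibbs_ratio] bounds nu from below by [m t]. *)
Lemma deviation_lower nu a Ca t del (G : nat -> set (Omega d)) : 0 < del ->
  gibbs_bounds nu (line a) (P a) Ca -> (forall n, measurable (G n)) ->
  (\forall n \near \oo, forall y, `|birk n psi y - n%:R * e t| <= n%:R * del -> G n y) ->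
  \forall n \near \oo,
    expR (n%:R * (P t - P a - (t - a) * e t - `|t - a| * del - del)) <= pr nu (G n).
Proof.
move=> del0 ha mG hG; have del20 : 0 < del / 2 by lra.
have [Ct hCt] := gibbs_state_bounds t.
have [k1 [C1 [k10 h1]]] := birk_ge_small t del20.
have [k2 [C2 [k20 h2]]] := birk_le_small t del20.
set D := variation; have D0 : 0 <= D := variation_ge0.
have q0 : 0 < 1 / 4 :> R by lra.
near=> n.
have hGn : forall y, `|birk n psi y - n%:R * e t| <= n%:R * del -> G n y by near: n; exact: hG.
have s1 : pr (m t) [set y | n%:R * (e t + del / 2) <= birk n psi y] <= 1 / 4.
  by apply: le_trans (h1 n) _; near: n; exact: near_expR_le.
have s2 : pr (m t) [set y | birk n psi y <= n%:R * (e t - del / 2)] <= 1 / 4.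
  by apply: le_trans (h2 n) _; near: n; exact: near_expR_le.
have n1 : 2 * D <= n%:R * (del / 2) by near: n; exact: near_natmul_ge.
have n2 : Ct + Ca + 1 <= n%:R * del by near: n; exact: near_natmul_ge.
(* The margin D ensures that the whole cylinder of a selected word lies in G n. *)
pose Q (w : {ffun 'I_n -> 'I_d.+1}) :=
  `|birk n psi (of_word w) - n%:R * e t| <= n%:R * del - D.
have mW := @measurable_word_label d n.
have mS : measurable [set y | Q (word n y)] by exact: measurable_label_set.
have mS' : measurable [set y | [pred w | ~~ Q w] (word n y)] by exact: measurable_label_set.
have var y := birk_variation (agree_of_word (n := n) y).
have sub : pr (m t) [set y | [pred w | ~~ Q w] (word n y)] <= 1 / 4 + 1 / 4.
  apply: le_trans (lerD s1 s2).
  apply: le_trans (pr_setU_le _ (measurable_birk_ge _ _) (measurable_birk_le _ _)).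
  apply: pr_le => //; first by apply: measurableU; [exact: measurable_birk_ge|exact: measurable_birk_le].
  move=> y /=; rewrite /Q -ltNge ltr_normr => hy; have := var y; rewrite -/D ler_norml => hv.
  by case/orP : hy => hy; [left|right] => /=; lra.
have half : 1 / 2 <= pr (m t) [set y | Q (word n y)].
  have := label_pr_sum1 (m t) mW; rewrite (bigID Q)/= -!pr_label_set//.
  by move: sub; rewrite /=; lra.
have SG : [set y | Q (word n y)] `<=` G n.
  move=> y /=; rewrite /Q => hy; apply: hGn; have := var y; rewrite -/D.
  by move: hy; rewrite !ler_norml; lra.
apply: le_trans (pr_le nu mS (mG n) SG).
rewrite (pr_label_set nu Q mW); set X := n%:R * (P t - P a - (t - a) * e t - `|t - a| * del).
apply: (@le_trans _ _ (\sum_(w | Q w) expR (X - (Ct + Ca)) * pr (m t) [set x | word n x = w])).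
  rewrite -mulr_sumr -(pr_label_set (m t) Q mW).
  apply: le_trans (ler_wpM2l (expR_ge0 _) half).
  (* The factor 1/2 is at least exp(-1); this is the 1 added to the constants in [n2]. *)
  have h3 : expR (-1) <= 1 / 2 :> R.
    have := expR_ge1Dx (1 : R); have := expR_gt0 (1 : R) => p0 p1.
    by rewrite expRN mul1r lef_pV2 ?posrE//; lra.
  apply: le_trans (ler_wpM2l (expR_ge0 _) h3).
  by rewrite -expRD ler_expR /X; lra.
apply: ler_sum => w Qw; rewrite word_cyl.
have := ler_wpM2l (expR_ge0 (X - (Ct + Ca))) (gibbs_ratio hCt ha n (of_word w)).
move=> /le_trans; apply; rewrite mulrA -expRD ler_piMl ?pr_ge0// -[leRHS]expR0 ler_expR.
have : (t - a) * (birk n psi (of_word w) - n%:R * e t) <= `|t - a| * (n%:R * del - D).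
  by rewrite (le_trans (ler_norm _))// normrM ler_wpM2l.
have := mulr_ge0 (normr_ge0 (t - a)) D0; rewrite /X; lra.
Unshelve. all: by end_near.
Qed.

End Deviations.

(** * Values of the constants C0 and C1 *)

Section RateFunctions.
Context {R : realType} {d : nat}.
Variables (th K L : R) (psi a1 : Omega d -> R).
Hypotheses (th0 : 0 < th) (th1 : th < 1) (hpsi : regular th K psi) (ha1 : regular th L a1).
Local Notation P := (line_pressure psi a1).
Hypotheses (P_0 : P 0 = 0) (P_1 : P 1 = 0).
Variable m : R -> probability (Omega d) R.
Hypotheses (hm : forall t, gibbs_state psi a1 t (m t)) (m01 : ~ same_probability (m 1) (m 0)).
Local Notation e := (slope psi m).

Let subg s t : P s + e s * (t - s) <= P t.
Proof. exact: (subgradient th0 th1 hpsi ha1 t (hm s)). Qed.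

Let e_lt s t : s < t -> e s < e t.
Proof. exact: (slope_lt th0 th1 hpsi ha1 P_0 P_1 hm m01). Qed.

(** At x = 0 the Legendre transform is t e(t) - P(t), by the subgradient at t; for x >= 0 the term
    of index t alone is at least that large, because t >= 0. *)
Lemma C1_value t : 0 <= t ->
  ereal_inf (rate_function P (e t) @` [set x | 0 <= x]) = (t * e t - P t)%:E.
Proof.
move=> t0; apply/eqP; rewrite eq_le; apply/andP; split.
  apply: (@le_trans _ _ (rate_function P (e t) 0)).
    by apply: ereal_inf_lbound; exists 0 => /=.
  apply: ub_ereal_sup => _ [s _ <-]; rewrite lee_fin.
  by have := subg t s; lra.
apply: le_ereal_inf_tmp => _ [x /= x0 <-].
apply: le_trans (ereal_sup_ubound _); last by exists t.
by rewrite lee_fin; have := mulr_ge0 t0 x0; lra.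
Qed.

(** As for [C1_value], with the pressure translated by 1: the relevant index is t - 1 <= 0, and x <=
    0. *)
Lemma C0_value t : t <= 1 ->
  ereal_inf (rate_function (fun s => P (s + 1)) (e t) @` [set x | x <= 0]) =
  ((t - 1) * e t - P t)%:E.
Proof.
move=> t1; apply/eqP; rewrite eq_le; apply/andP; split.
  apply: (@le_trans _ _ (rate_function (fun s => P (s + 1)) (e t) 0)).
    by apply: ereal_inf_lbound; exists 0 => /=.
  apply: ub_ereal_sup => _ [s _ <-]; rewrite lee_fin.
  by have := subg t (s + 1); lra.
apply: le_ereal_inf_tmp => _ [x /= x0 <-].
apply: le_trans (ereal_sup_ubound _); last by exists (t - 1).
rewrite lee_fin subrK; have t1' : 0 <= 1 - t by rewrite subr_ge0.
by have x0' : 0 <= - x by [rewrite oppr_ge0]; have := mulr_ge0 t1' x0'; lra.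
Qed.

(** The transform is at most 0 at the typical slope [e 0], that is at x = e 0 - e t, which is
    positive for t < 0. *)
Lemma C1_nonpos t : t < 0 ->
  (ereal_inf (rate_function P (e t) @` [set x | (0 <= x)%R]) <= 0)%E.
Proof.
move=> /e_lt t0; apply: (@le_trans _ _ (rate_function P (e t) (e 0 - e t))).
  by apply: ereal_inf_lbound; exists (e 0 - e t) => //=; rewrite subr_ge0 ltW.
apply: ub_ereal_sup => _ [s _ <-]; rewrite lee_fin.
by have := subg 0 s; rewrite P_0; lra.
Qed.

Lemma C0_nonpos t : 1 < t ->
  (ereal_inf (rate_function (fun s => P (s + 1)) (e t) @` [set x | (x <= 0)%R]) <= 0)%E.
Proof.
move=> /e_lt t0; apply: (@le_trans _ _ (rate_function (fun s => P (s + 1)) (e t) (e 1 - e t))).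
  by apply: ereal_inf_lbound; exists (e 1 - e t) => //=; rewrite subr_le0 ltW.
apply: ub_ereal_sup => _ [s _ <-]; rewrite lee_fin.
by have := subg 1 (s + 1); rewrite P_1; lra.
Qed.

End RateFunctions.

(** * Exponential decay of the maximal cost *)

Section CostRate.
Context {R : realType} {d : nat}.
Implicit Types (x y : Omega d) (nu : probability (Omega d) R).
Variables (th K L : R) (psi a1 : Omega d -> R).
Hypotheses (th0 : 0 < th) (th1 : th < 1) (hpsi : regular th K psi) (ha1 : regular th L a1).
Local Notation P := (line_pressure psi a1).
Local Notation line := (line psi a1).
Hypotheses (P_0 : P 0 = 0) (P_1 : P 1 = 0).
Variable m : R -> probability (Omega d) R.
Hypotheses (hm : forall t, gibbs_state psi a1 t (m t)) (m01 : ~ same_probability (m 1) (m 0)).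
Local Notation e := (slope psi m).

Let subg s t : P s + e s * (t - s) <= P t.
Proof. exact: (subgradient th0 th1 hpsi ha1 t (hm s)). Qed.

Let e_lt s t : s < t -> e s < e t.
Proof. exact: (slope_lt th0 th1 hpsi ha1 P_0 P_1 hm m01). Qed.

Let IVT := slope_IVT th0 th1 hpsi ha1 hm.

Definition above (u : R^nat) n : set (Omega d) := [set y | u n < n%:R^-1 * birk n psi y].
Definition below (u : R^nat) n : set (Omega d) := [set y | n%:R^-1 * birk n psi y <= u n].

Lemma measurable_above u n : measurable (above u n).
Proof.
have [mf _] := bmZ n%:R^-1 (bm_birk n (bm_regular th0 th1 hpsi)).
have := mf measurableT `]u n, +oo[%classic (measurable_itv _); rewrite setTI.
by congr measurable; apply/seteqP; split => y /=; rewrite in_itv /= ?andbT.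
Qed.

Lemma measurable_below u n : measurable (below u n).
Proof.
have [mf _] := bmZ n%:R^-1 (bm_birk n (bm_regular th0 th1 hpsi)).
have := mf measurableT `]-oo, u n]%classic (measurable_itv _); rewrite setTI.
by congr measurable; apply/seteqP; split => y /=; rewrite in_itv.
Qed.

Lemma near_cst_le (c eps : R) : 0 < c -> 0 < eps ->
  \forall n \near \oo, expR (- (n%:R * eps)) <= c /\ c <= expR (n%:R * eps).
Proof.
move=> c0 eps0; near=> n.
have h1 : ln c <= n%:R * eps by near: n; exact: near_natmul_ge.
have h2 : - ln c <= n%:R * eps by near: n; exact: near_natmul_ge.
by rewrite -[X in _ <= X /\ _]lnK ?posrE// -[X in _ /\ X <= _]lnK ?posrE// !ler_expR; split; lra.
Unshelve. all: by end_near.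
Qed.

Lemma near_dist_le (u : R^nat) (l eps : R) : u @ \oo --> l -> 0 < eps ->
  \forall n \near \oo, `|l - u n| <= eps.
Proof. by move=> /cvgrPdist_le h /h. Qed.

Lemma above_upper nu Ca t u eps : gibbs_bounds nu (line 0) (P 0) Ca -> 0 <= t -> t <= 1 ->
  u @ \oo --> e t -> 0 < eps ->
  \forall n \near \oo, pr nu (above u n) <= expR (n%:R * (P t - t * e t + eps)).
Proof.
move=> hnu t0 t1 hu eps0; have [Ct hCt] := gibbs_state_bounds hm t.
have [C hC] := chernoff th0 th1 hpsi hnu hCt.
have e20 : 0 < eps / 2 by lra.
near=> n.
have n0 : 0 < n%:R :> R by rewrite ltr0n; near: n; exact: nbhs_infty_gt.
have un : `|e t - u n| <= eps / 2 by near: n; exact: near_dist_le hu e20.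
have nC : C <= n%:R * (eps / 2) by near: n; exact: near_natmul_ge.
apply: (le_trans (hC n (t * u n) _ (measurable_above u n) _)).
  move=> y; rewrite /above /= => hy; rewrite subr0 mulrCA ler_wpM2l//.
  by move: hy; rewrite mulrC ltr_pdivlMr// mulrC => /ltW.
rewrite ler_expR P_0 subr0.
have : t * (e t - u n) <= eps / 2.
  rewrite (le_trans (ler_norm _))// normrM ger0_norm// (le_trans _ un)//.
  by rewrite ler_piMl.
move=> /(ler_wpM2l (ltW n0)); lra.
Unshelve. all: by end_near.
Qed.

Lemma below_upper nu Ca t u eps : gibbs_bounds nu (line 1) (P 1) Ca -> 0 <= t -> t <= 1 ->
  u @ \oo --> e t -> 0 < eps ->
  \forall n \near \oo, pr nu (below u n) <= expR (n%:R * (P t - (t - 1) * e t + eps)).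
Proof.
move=> hnu t0 t1 hu eps0; have [Ct hCt] := gibbs_state_bounds hm t.
have [C hC] := chernoff th0 th1 hpsi hnu hCt.
have e20 : 0 < eps / 2 by lra.
near=> n.
have n0 : 0 < n%:R :> R by rewrite ltr0n; near: n; exact: nbhs_infty_gt.
have un : `|e t - u n| <= eps / 2 by near: n; exact: near_dist_le hu e20.
have nC : C <= n%:R * (eps / 2) by near: n; exact: near_natmul_ge.
have t1' : 0 <= 1 - t by rewrite subr_ge0.
apply: (le_trans (hC n ((t - 1) * u n) _ (measurable_below u n) _)).
  move=> y; rewrite /below /= mulrC ler_pdivrMr// => hy.
  by have := ler_wpM2l t1' hy; lra.
rewrite ler_expR P_1 subr0.
have : (1 - t) * (u n - e t) <= eps / 2.
  rewrite (le_trans (ler_norm _))// normrM ger0_norm// distrC (le_trans _ un)//.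
  by rewrite ler_piMl//; lra.
move=> /(ler_wpM2l (ltW n0)); lra.
Unshelve. all: by end_near.
Qed.

Lemma above_lower nu Ca t u eps : gibbs_bounds nu (line 0) (P 0) Ca -> 0 <= t -> t <= 1 ->
  u @ \oo --> e t -> 0 < eps ->
  \forall n \near \oo, expR (n%:R * (P t - t * e t - eps)) <= pr nu (above u n).
Proof.
move=> hnu t0 t1 hu eps0.
have st : e t < e (t + 1) by apply: e_lt; lra.
(* The tilted slope e t + 2 del leaves room for fluctuations del and for u n within del / 2 of its
   limit. The loss in the exponent is at most 3 s del + del with s < 2, hence the 7. *)
pose del := Num.min (eps / 7) ((e (t + 1) - e t) / 4).
have del0 : 0 < del by rewrite /del lt_min !divr_gt0// subr_gt0.
have del1 : del <= eps / 7 by rewrite /del ge_min lexx.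
have del2 : del <= (e (t + 1) - e t) / 4 by rewrite /del ge_min lexx orbT.
have tt : t < t + 1 by rewrite ltrDl.
have E1 : e t < e t + 2 * del by lra.
have E2 : e t + 2 * del < e (t + 1) by lra.
have [s [ts s1 es]] := IVT tt E1 E2.
have hinc : \forall n \near \oo, forall y,
    `|birk n psi y - n%:R * e s| <= n%:R * del -> above u n y.
  near=> n => y.
  have n0 : 0 < n%:R :> R by rewrite ltr0n; near: n; exact: nbhs_infty_gt.
  have un : `|e t - u n| <= del / 2 by near: n; apply: near_dist_le hu _; rewrite divr_gt0.
  rewrite /above /= es ltr_pdivlMl// ler_norml => /andP[h _].
  have : n%:R * u n <= n%:R * (e t + del / 2).
    by rewrite (ler_pM2l n0); move: un; rewrite ler_norml; lra.
  have := mulr_gt0 n0 del0; lra.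
have := deviation_lower th0 th1 hpsi ha1 P_0 P_1 hm m01 del0 hnu (measurable_above u) hinc.
apply: filterS => n; apply: le_trans; rewrite ler_expR ler_wpM2l ?ler0n//.
rewrite es P_0 !subr0 ger0_norm; last by lra.
have := subg t s; have sd : s * del <= 2 * del by rewrite (ler_pM2r del0); lra.
lra.
Unshelve. all: by end_near.
Qed.

Lemma below_lower nu Ca t u eps : gibbs_bounds nu (line 1) (P 1) Ca -> 0 <= t -> t <= 1 ->
  u @ \oo --> e t -> 0 < eps ->
  \forall n \near \oo, expR (n%:R * (P t - (t - 1) * e t - eps)) <= pr nu (below u n).
Proof.
move=> hnu t0 t1 hu eps0.
have st : e (t - 1) < e t by apply: e_lt; lra.
(* Mirror image: slope e t - 2 del, with 1 - s < 2 in place of s < 2. *)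
pose del := Num.min (eps / 7) ((e t - e (t - 1)) / 4).
have del0 : 0 < del by rewrite /del lt_min !divr_gt0// subr_gt0.
have del1 : del <= eps / 7 by rewrite /del ge_min lexx.
have del2 : del <= (e t - e (t - 1)) / 4 by rewrite /del ge_min lexx orbT.
have tt : t - 1 < t by rewrite gtrBl.
have E1 : e (t - 1) < e t - 2 * del by lra.
have E2 : e t - 2 * del < e t by lra.
have [s [ts s1 es]] := IVT tt E1 E2.
have hinc : \forall n \near \oo, forall y,
    `|birk n psi y - n%:R * e s| <= n%:R * del -> below u n y.
  near=> n => y.
  have n0 : 0 < n%:R :> R by rewrite ltr0n; near: n; exact: nbhs_infty_gt.
  have un : `|e t - u n| <= del / 2 by near: n; apply: near_dist_le hu _; rewrite divr_gt0.
  rewrite /below /= es ler_pdivrMl// ler_norml => /andP[_ h].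
  have : n%:R * (e t - del / 2) <= n%:R * u n.
    by rewrite (ler_pM2l n0); move: un; rewrite ler_norml; lra.
  have := mulr_gt0 n0 del0; lra.
have := deviation_lower th0 th1 hpsi ha1 P_0 P_1 hm m01 del0 hnu (measurable_below u) hinc.
apply: filterS => n; apply: le_trans; rewrite ler_expR ler_wpM2l ?ler0n//.
rewrite es P_1 !subr0 -normrN opprB ger0_norm; last by lra.
have := subg t s; have sd : (1 - s) * del <= 2 * del by rewrite (ler_pM2r del0); lra.
lra.
Unshelve. all: by end_near.
Qed.

(** For t in [0, 1] this is the opposite of the smaller of C0 and C1 at [e t]: the slower of the two
    decays governs the cost. *)
Definition worst_rate t : R := Num.max (P t - t * e t) (P t - (t - 1) * e t).

(** Upper and lower bounds with error eps / 2 for both probabilities; the losses y0 and y1 lie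
    between exp(-n eps / 2) and exp(n eps / 2) for large n, and so leave the rate unchanged. *)
Lemma cost_rate_value (nu0 nu1 : probability (Omega d) R) (Ca Cb y0 y1 t : R) (u : R^nat) :
  gibbs_bounds nu0 (line 1) (P 1) Ca -> gibbs_bounds nu1 (line 0) (P 0) Cb ->
  0 < y0 -> 0 < y1 -> 0 <= t -> t <= 1 -> u @ \oo --> e t ->
  ((n%:R^-1)%:E * lne (maxe (y1%:E * nu1 (above u n)) (y0%:E * nu0 (below u n))))%E
    @[n --> \oo] --> (worst_rate t)%:E.
Proof.
move=> h0 h1 y00 y10 t0 t1 hu; set F := (X in X @ \oo --> _).
set rho := worst_rate t.
have FE n : F n = ((n%:R^-1)%:E * lne (Num.max (y1 * pr nu1 (above u n)) (y0 * pr nu0 (below u n)))%:E)%E.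
  rewrite /F -(pr_EFin nu1 (measurable_above u n)) -(pr_EFin nu0 (measurable_below u n)).
  by rewrite -!EFinM -EFin_max.
(* Besides the estimate, this records that the extended-real term is eventually finite, as needed to
   descend to a real limit. *)
have key eps : 0 < eps -> \forall n \near \oo, exists c, F n = (n%:R^-1 * c)%:E /\
    `|n%:R * rho - c| <= n%:R * eps.
  move=> eps0; have e20 : 0 < eps / 2 by lra.
  near=> n.
  have u1 : pr nu1 (above u n) <= expR (n%:R * (P t - t * e t + eps / 2)).
    by near: n; exact: above_upper h1 t0 t1 hu e20.
  have u0 : pr nu0 (below u n) <= expR (n%:R * (P t - (t - 1) * e t + eps / 2)).
    by near: n; exact: below_upper h0 t0 t1 hu e20.
  have l1 : expR (n%:R * (P t - t * e t - eps / 2)) <= pr nu1 (above u n).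
    by near: n; exact: above_lower h1 t0 t1 hu e20.
  have l0 : expR (n%:R * (P t - (t - 1) * e t - eps / 2)) <= pr nu0 (below u n).
    by near: n; exact: below_lower h0 t0 t1 hu e20.
  have [c1 d1] : expR (- (n%:R * (eps / 2))) <= y1 /\ y1 <= expR (n%:R * (eps / 2)).
    by near: n; exact: near_cst_le.
  have [c0 d0] : expR (- (n%:R * (eps / 2))) <= y0 /\ y0 <= expR (n%:R * (eps / 2)).
    by near: n; exact: near_cst_le.
  set c := Num.max (y1 * pr nu1 (above u n)) (y0 * pr nu0 (below u n)).
  have n0 : 0 <= n%:R :> R by exact: ler0n.
  have U1 : y1 * pr nu1 (above u n) <= expR (n%:R * (P t - t * e t + eps)).
    apply: (le_trans (ler_pM (ltW y10) (pr_ge0 _ _) d1 u1)).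
    by rewrite -expRD ler_expR; lra.
  have U0 : y0 * pr nu0 (below u n) <= expR (n%:R * (P t - (t - 1) * e t + eps)).
    apply: (le_trans (ler_pM (ltW y00) (pr_ge0 _ _) d0 u0)).
    by rewrite -expRD ler_expR; lra.
  have L1 : expR (n%:R * (P t - t * e t - eps)) <= y1 * pr nu1 (above u n).
    apply: le_trans (ler_pM (expR_ge0 _) (expR_ge0 _) c1 l1).
    by rewrite -expRD ler_expR; lra.
  have L0 : expR (n%:R * (P t - (t - 1) * e t - eps)) <= y0 * pr nu0 (below u n).
    apply: le_trans (ler_pM (expR_ge0 _) (expR_ge0 _) c0 l0).
    by rewrite -expRD ler_expR; lra.
  have r1 : P t - t * e t <= rho by rewrite /rho /worst_rate le_max lexx.
  have r0 : P t - (t - 1) * e t <= rho by rewrite /rho /worst_rate le_max lexx orbT.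
  have cU : c <= expR (n%:R * (rho + eps)).
    rewrite /c ge_max; apply/andP; split.
      by apply: (le_trans U1); rewrite ler_expR ler_wpM2l// lerD2r.
    by apply: (le_trans U0); rewrite ler_expR ler_wpM2l// lerD2r.
  have cL : expR (n%:R * (rho - eps)) <= c.
    rewrite /rho /worst_rate /c le_max.
    case: (leP (P t - t * e t) (P t - (t - 1) * e t)) => _; [rewrite L0 orbT|rewrite L1]; exact: isT.
  have cpos : 0 < c := lt_le_trans (expR_gt0 _) cL.
  exists (ln c); split; first by rewrite FE lne_EFin// -EFinM.
  have h2 : ln c <= n%:R * (rho + eps) by rewrite -ler_expR lnK ?posrE.
  have h3 : n%:R * (rho - eps) <= ln c by rewrite -ler_expR lnK ?posrE.
  by rewrite ler_norml; lra.
apply: cvg_EFin.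
  have := key 1 ltr01; by apply: filterS => n [c [-> _]].
apply/cvgrPdist_le => eps eps0; near=> n.
have n0 : 0 < n%:R :> R by rewrite ltr0n; near: n; exact: nbhs_infty_gt.
have [c [Fc hc]] : exists c, F n = (n%:R^-1 * c)%:E /\ `|n%:R * rho - c| <= n%:R * eps.
  by near: n; exact: key.
rewrite /= Fc /= -(ler_pM2l n0) -[X in X * `|_| <= _](ger0_norm (ltW n0)) -normrM mulrBr.
by rewrite [n%:R * (_ * c)]mulrA divff ?gt_eqF// mul1r.
Unshelve. all: by end_near.
Qed.

End CostRate.

(** * The Min-Max test *)

Section HypothesisTest.
Context {R : realType} {d : nat}.
Implicit Types (J : Omega d -> R) (mu nu : probability (Omega d) R).

Lemma normalised_jacobian J : holder_jacobian J -> normalised (fun x => ln (J x)).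
Proof.
by move=> [J0 _ J1] b; rewrite -(J1 b); apply: eq_bigr => a _; rewrite lnK// posrE.
Qed.

Lemma mean_llrE (J0 J1 : Omega d -> R) n x :
  (forall y, 0 < J0 y) -> (forall y, 0 < J1 y) ->
  mean_llr J0 J1 n x = n%:R^-1 * birk n (fun y => ln (J0 y) - ln (J1 y)) x.
Proof.
move=> p0 p1; rewrite /mean_llr; congr (_ * _); apply: eq_bigr => i _.
by rewrite ln_div ?posrE.
Qed.

Lemma gibbs_bounds_same mu nu (A : Omega d -> R) (c C : R) : same_probability mu nu ->
  gibbs_bounds nu A c C -> gibbs_bounds mu A c C.
Proof.
move=> h hnu n x; have -> : pr mu (cyl n x) = pr nu (cyl n x).
  by rewrite /pr h//; exact: measurable_cyl.
exact: hnu.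
Qed.

End HypothesisTest.

Theorem theoremB (R : realType) (d : nat) (J0 J1 : Omega d -> R)
    (mu0 mu1 : probability (Omega d) R) (y0 y1 : R)
    (hmu0 : gibbs J0 mu0) (hmu1 : gibbs J1 mu1)
    (hneq : ~ same_probability mu0 mu1) (hy0 : 0 < y0) (hy1 : 0 < y1) :
  exists (r t0 : R) (mu : probability (Omega d) R),
    (* E = 0 is the best choice *)
    [/\ admissible J0 J1 0,
        maxe (C0 J0 J1 0) (C1 J0 J1 0) = (- r)%:E,
        forall E : R, admissible J0 J1 E -> E != 0 ->
          (maxe (C0 J0 J1 0) (C1 J0 J1 0) < maxe (C0 J0 J1 E) (C1 J0 J1 E))%E,
        cost_rate J0 J1 mu0 mu1 y0 y1 0 r &
        forall E : R, admissible J0 J1 E -> E != 0 ->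
          exists2 rho : R, r < rho & cost_rate J0 J1 mu0 mu1 y0 y1 E rho] /\
    (* r is the minimum value of the pressure function, and it is negative *)
    [/\ r < 0, P1 J0 J1 t0 = r & forall t : R, r <= P1 J0 J1 t] /\
    (* t0 is the only critical point of the pressure function *)
    (forall t : R, is_derive t 1 (P1 J0 J1) 0 <-> t = t0) /\
    (* mu is the equilibrium probability at t0, and it is Gibbs *)
    [/\ equilibrium (tilt J0 J1 J1 t0) mu,
        forall nu : probability (Omega d) R,
          equilibrium (tilt J0 J1 J1 t0) nu -> same_probability nu mu,
        exists J : Omega d -> R, gibbs J mu,
        (\int[mu]_x (ln (J0 x) - ln (J1 x))%:E = 0)%E &
        (r%:E = entropy mu + \int[mu]_x (ln (J1 x))%:E)%E].
Proof.
have [hJ0 eq0] := hmu0; have [hJ1 eq1] := hmu1.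
have [p0 hol0 _] := hJ0; have [p1 hol1 _] := hJ1.
have [tha [Ka [tha0 tha1 hA]]] := holder_regular hol0.
have [thb [Kb [thb0 thb1 hB]]] := holder_regular hol1.
set th := Num.max tha thb.
have th0 : 0 < th by rewrite lt_max tha0.
have th1 : th < 1 by rewrite gt_max tha1.
have h0 : regular th Ka (fun x => ln (J0 x)).
  by apply: regular_rate_le (ltW tha0) _ hA; rewrite le_max lexx.
have h1 : regular th Kb (fun x => ln (J1 x)).
  by apply: regular_rate_le (ltW thb0) _ hB; rewrite le_max lexx orbT.
pose psi x := ln (J0 x) - ln (J1 x); pose a1 x := ln (J1 x).
have hpsi : regular th (Ka + Kb) psi by exact: regularB.
have ha1 : regular th Kb a1 by exact: h1.
pose P := line_pressure psi a1.
have line0 : line psi a1 0 = fun x => ln (J1 x).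
  by apply: funext => x; rewrite /line mul0r add0r.
have line1 : line psi a1 1 = fun x => ln (J0 x).
  by apply: funext => x; rewrite /line /psi /a1 mul1r subrK.
have P_0 : P 0 = 0.
  by rewrite /P /line_pressure line0 (normalised_pressure th0 th1 h1)//; exact: normalised_jacobian.
have P_1 : P 1 = 0.
  by rewrite /P /line_pressure line1 (normalised_pressure th0 th1 h0)//; exact: normalised_jacobian.
have /choice[m hm] : forall t, exists mt, gibbs_state psi a1 t mt.
  by move=> t; exact: (gibbs_state_exists th0 th1 hpsi ha1 t).
(* Uniqueness of equilibria identifies mu1 with the state at 0 and mu0 with the state at 1. *)
have s1 : same_probability mu1 (m 0).
  by have [_ [_ u] _ _ _] := hm 0; apply: u; rewrite line0.
have s0 : same_probability mu0 (m 1).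
  by have [_ [_ u] _ _ _] := hm 1; apply: u; rewrite line1.
have m01 : ~ same_probability (m 1) (m 0).
  by move=> h; apply: hneq => B mB; rewrite s0// s1// h.
have [Ca hCa] := gibbs_state_bounds hm 1; have [Cb hCb] := gibbs_state_bounds hm 0.
have g0 := gibbs_bounds_same s0 hCa; have g1 := gibbs_bounds_same s1 hCb.
pose e := slope psi m.
have subg s t : P s + e s * (t - s) <= P t by exact: (subgradient th0 th1 hpsi ha1 t (hm s)).
have strict s t : s != t -> P s + e s * (t - s) < P t.
  exact: (strict_subgradient th0 th1 hpsi ha1 P_0 P_1 hm m01).
have e_lt s t : s < t -> e s < e t by exact: (slope_lt th0 th1 hpsi ha1 P_0 P_1 hm m01).
have e0 : e 0 < 0 by exact: (slope_0 th0 th1 hpsi ha1 P_0 P_1 hm m01).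
have e1 : 0 < e 1 by exact: (slope_1 th0 th1 hpsi ha1 P_0 P_1 hm m01).
have dP (t : R) : is_derive t 1 P (e t) by exact: is_derive_P hm t.
have [t0 [t00 t01 et0]] := slope_IVT th0 th1 hpsi ha1 hm ltr01 e0 e1.
have P1E : P1 J0 J1 = P by [].
have P0E : P0 J0 J1 = fun s => P (s + 1).
  apply: funext => t; rewrite /P0 /tilted_pressure /P /line_pressure; congr (fine (pressure _)).
  by apply: funext => x; rewrite /tilt /line /psi /a1; ring.
have d1 t : derive1 (P1 J0 J1) t = e t by rewrite P1E derive1E; exact: derive_val.
have C1E t : 0 <= t -> C1 J0 J1 (e t) = (t * e t - P t)%:E.
  by move=> tpos; rewrite /C1 P1E; exact: (C1_value th0 th1 hpsi ha1 hm tpos).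
have C0E t : t <= 1 -> C0 J0 J1 (e t) = ((t - 1) * e t - P t)%:E.
  by move=> tle; rewrite /C0 P0E; exact: (C0_value th0 th1 hpsi ha1 hm tle).
(* Between c- and c+ every E is a slope e t. For t < 0 or t > 1 one of C1, C0 is not positive, and
   at t = 0 or t = 1 it vanishes. *)
have adm E : admissible J0 J1 E -> exists t, [/\ 0 < t, t < 1 & e t = E].
  move=> [cm cp pC0 pC1].
  have [_ [a _ <-]] := ereal_inf_lt cm; rewrite d1 lte_fin => ea.
  have [_ [b _ <-]] := ereal_sup_gt cp; rewrite d1 lte_fin => eb.
  have ab : a < b.
    rewrite ltNge le_eqVlt; apply/negP => /orP[/eqP ba|/e_lt ba].
      by move: (lt_trans ea eb); rewrite ba ltxx.
    by move: (lt_trans ea (lt_trans eb ba)); rewrite ltxx.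
  have [t [_ _ et]] := slope_IVT th0 th1 hpsi ha1 hm ab ea eb.
  rewrite -/(e t) in et; rewrite -et in pC0 pC1.
  have tge : 0 <= t.
    rewrite leNgt; apply/negP => /(C1_nonpos th0 th1 hpsi ha1 P_0 P_1 hm m01).
    by rewrite leNgt => /negP; apply; exact: pC1.
  have tle : t <= 1.
    rewrite leNgt; apply/negP => /(C0_nonpos th0 th1 hpsi ha1 P_0 P_1 hm m01).
    by rewrite leNgt => /negP; apply; move: pC0; rewrite /C0 P0E.
  exists t; split=> //.
    rewrite lt_neqAle tge andbT; apply/eqP => tE.
    by move: pC1; rewrite C1E// -tE P_0 mul0r subrr ltxx.
  rewrite lt_neqAle tle andbT; apply/eqP => tE.
  by move: pC0; rewrite C0E// tE P_1 subrr mul0r subrr ltxx.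
have r0 : P t0 < 0.
  have t0n : t0 != 0 by rewrite gt_eqF.
  by have := strict t0 0 t0n; rewrite [e t0]et0 P_0 mul0r addr0.
have C10 : C1 J0 J1 0 = (- P t0)%:E.
  by rewrite -[X in C1 _ _ X]et0 -/(e t0) C1E ?ltW// [e t0]et0 mulr0 sub0r.
have C00 : C0 J0 J1 0 = (- P t0)%:E.
  by rewrite -[X in C0 _ _ X]et0 -/(e t0) C0E ?ltW// [e t0]et0 mulr0 sub0r.
have max0 : maxe (C0 J0 J1 0) (C1 J0 J1 0) = (- P t0)%:E by rewrite C00 C10 maxxx.
have rmin t : P t0 <= P t by have := subg t0 t; rewrite [e t0]et0 mul0r addr0.
have rate t : 0 < t -> t < 1 ->
    cost_rate J0 J1 mu0 mu1 y0 y1 (e t) (worst_rate psi a1 m t).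
  move=> tpos tlt u _ hu.
  have := cost_rate_value th0 th1 hpsi ha1 P_0 P_1 hm m01 g0 g1 hy0 hy1 (ltW tpos) (ltW tlt) hu.
  rewrite (_ : (fun n => _) = (fun n => (n%:R^-1)%:E * lne (max_cost J0 J1 mu0 mu1 y0 y1 u n))%E)//.
  apply: funext => n; rewrite /max_cost /above /below.
  have -> : mean_llr J0 J1 n = (fun y => n%:R^-1 * birk n psi y).
    by apply: funext => y; exact: mean_llrE.
  by [].
have [inv [equ uniq] [_ [J hJ]] [Em pE] _] := hm t0.
exists (P t0), t0, (m t0); split; [split|split; [split|split; [|split]]].
- split; rewrite ?C00 ?C10 ?lte_fin ?oppr_gt0//.
  + apply: (@le_lt_trans _ _ (derive1 (P1 J0 J1) 0)%:E); last by rewrite d1 lte_fin.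
    by apply: ereal_inf_lbound; exists 0.
  + apply: (@lt_le_trans _ _ (derive1 (P1 J0 J1) 1)%:E); first by rewrite d1 lte_fin.
    by apply: ereal_sup_ubound; exists 1.
- exact: max0.
- move=> E /adm[t [tpos tlt <-]] En0; rewrite max0 C0E ?ltW// C1E ?ltW// -EFin_max lte_fin lt_max.
  (* The tangent at t, read at t0, gives t e(t) - P(t) >= t0 e(t) - P(t0). For e t > 0 this makes C1
     larger than -P(t0); for e t < 0, subtracting e t makes C0 larger, as t0 < 1. *)
  have := subg t t0; case: (ltgtP (e t) 0) En0 => // es _ hs.
    have : 0 < (t0 - 1) * e t by rewrite nmulr_lgt0// subr_lt0.
    by move=> hh; apply/orP; left; lra.
  have : 0 < t0 * e t by rewrite mulr_gt0.
  by move=> hh; apply/orP; right; lra.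
- have := rate t0 t00 t01; rewrite [e t0]et0 /worst_rate.
  by rewrite -/(e t0) [e t0]et0 !mulr0 subr0 maxxx.
- move=> E /adm[t [tpos tlt <-]] En0; exists (worst_rate psi a1 m t); last exact: rate.
  (* For e t < 0 the entry P(t) - t e(t) exceeds P(t) >= P(t0), and for e t > 0 the other entry
     does. *)
  rewrite /worst_rate -/(e t) -/(P t) lt_max; have := rmin t.
  case: (ltgtP (e t) 0) En0 => // es _ hr.
    have : t * e t < 0 by rewrite pmulr_rlt0.
    by move=> hh; apply/orP; left; lra.
  have : (t - 1) * e t < 0 by rewrite nmulr_rlt0 ?subr_lt0.
  by move=> hh; apply/orP; right; lra.
- exact: r0.
- by rewrite P1E.
- by move=> t; rewrite P1E.
- move=> t; rewrite P1E; split => [dt|->]; last by rewrite -et0; exact: dP.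
  apply: (slope_inj th0 th1 hpsi ha1 P_0 P_1 hm m01); rewrite et0.
  have := @derive_val _ _ _ _ _ _ _ dt; rewrite (@derive_val _ _ _ _ _ _ _ (dP t)).
  exact.
- exact: equ.
- exact: uniq.
- by exists J.
- by rewrite EFin_Ex ?[Ex _ _]et0//; exact: bm_regular hpsi.
- rewrite Em EFin_Ex; last exact: bm_regular h1.
  rewrite -EFinD; congr EFin.
  (* As psi has mean 0 under the state, the potential at t0 has the same integral as log J1, the
     potential at 0. *)
  have := Ex_line th0 th1 hpsi ha1 (m t0) 0 t0; rewrite line0.
  by move: et0; rewrite /slope => ->; rewrite mulr0 addr0 => ->; rewrite subrK.
Qed.
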